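(* Let $g\colon\mathbb{R}^n\times\mathbb{R}^m\to\mathbb{R}$ be continuously differentiable and convex in the second argument. Let $\{(v_i,c_i)\}_{i\in\mathbb{N}}$ be an i.i.d. sequence obtained from $\zeta_\Theta\otimes\mathfrak{m}$. Let $X\subset\mathbb{R}^n$ be a compact set such that every $x\in X$ is a $\mathfrak{z}$-uniform Slater point and $g$ satisfies the exponential growth condition at every $x\in X$. Then, with probability $1$, the approximations $$\Phi_N(x)=\frac1N\sum_{i=1}^N e_{c_i}(x,v_i)\quad\text{and}\quad\nabla\Phi_N(x)=\frac1N\sum_{i=1}^N\nabla_x e_{c_i}(x,v_i)$$ converge uniformly on $X$ to $\Phi$ and $\nabla\Phi$, respectively, as $N\to\infty$.
   Context: Setting. $\mathcal{C}\subset\mathbb{R}^p$ is a Borel set with Borel $\sigma$-algebra $\mathcal{F}$, and $\mathfrak{m}$ is a probability measure on $(\mathcal{C},\mathcal{F})$ (the law of a random parameter $C$). The maps $\mathfrak{z}\colon\mathcal{C}\to\mathbb{R}^m$ and $\mathfrak{L}\colon\mathcal{C}\to\mathbb{R}^{m\times m}$ are measurable; $\Sigma(c)$ is a positive definite $m\times m$ matrix and $\mathfrak{L}(c)$ is its Cholesky factor, i.e. the lower triangular matrix with positive diagonal such that $\mathfrak{L}(c)\mathfrak{L}(c)^\top=\Sigma(c)$. There exists $\eta_0>0$ with $\|\mathfrak{z}(c)\|_2+\|\mathfrak{L}(c)\|_M\le\eta_0$ for all $c\in\mathcal{C}$ ($\|\cdot\|_2$ Euclidean norm, $\|\cdot\|_M$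 the induced operator norm). Conditionally on $C=c$, the random vector $\xi$ has law $\mathcal{N}(\mathfrak{z}(c),\Sigma(c))$, with density $$h_c(z)=\frac{1}{\sqrt{(2\pi)^m\det\Sigma(c)}}\exp\left(-\tfrac12(z-\mathfrak{z}(c))^\top\Sigma(c)^{-1}(z-\mathfrak{z}(c))\right).$$ Probability function. $\varphi_c(x)=\int_{\{z:\,g(x,z)\le0\}}h_c(z)\,dz$ and $\Phi(x)=\int_{\mathcal{C}}\varphi_c(x)\,d\mathfrak{m}(c)$, which equals $\mathbb{P}(g(x,\xi)\le 0)$. Radial probability function. $\mathbb{S}^{m-1}$ is the Euclidean unit sphere of $\mathbb{R}^m$ and $\zeta_\Theta$ the uniform probability measure on it. Let $\chi(r)=\frac{1}{2^{m/2-1}\Gamma(m/2)}r^{m-1}e^{-r^2/2}$ for $r\ge0$, and $$e_c(x,v)=\int_{\{r\ge0:\,g(x,r\mathfrak{L}(c)v+\mathfrak{z}(c))\le0\}}\chi(r)\,dr,\qquad (x,v,c)\in\mathbb{R}^n\times\mathbb{S}^{m-1}\times\mathcal{C}.$$ $\nabla_x e_c(x,v)$ is the gradient of $e_c(\cdot,v)$ at $x$; it is set to $0$ on the exceptional $\mathfrak{m}$-null set of $c$ for which it may fail to exist. Uniform Slater point. $\bar{x}\in\mathbb{R}^n$ is a $\mathfrak{z}$-uniform Slater point if there exist an open neighborhood $U$ of $\bar{x}$ and $\gamma_0>0$ such that $g(x,\mathfrak{z}(c))<-\gamma_0$ for all $x\in U$ and $\mathfrak{m}$-almost all $c\in\mathcal{C}$.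 Exponential growth condition. $g$ satisfies it at $\bar{x}$ if there are $\varepsilon,a,b>0$ with $\|\nabla_x g(x,z)\|\le a\exp(b\|z\|)$ for all $(x,z)\in\mathbb{B}_\varepsilon(\bar{x})\times\mathbb{R}^m$, where $\mathbb{B}_\varepsilon(\bar{x})$ is the ball of radius $\varepsilon$ centered at $\bar{x}$. *)

(* Defs.v *)
From HB Require Import structures.
From mathcomp Require Import all_boot all_order all_algebra.
From mathcomp Require Import all_classical all_reals all_analysis.
From mathcomp Require Import measurable_realfun.

Set Implicit Arguments.
Unset Strict Implicit.
Unset Printing Implicit Defensive.

Import Order.TTheory GRing.Theory Num.Theory.
Import numFieldNormedType.Exports.

Local Open Scope classical_set_scope.
Local Open Scope ring_scope.

(* Vectors of R^k are row vectors ['rV[R]_k]; hence the column-vector product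
   [A v] is written [v *m A^T].  The topology and uniformity of the library on
   ['rV[R]_k] (sup norm) are those of the Euclidean norm, but the library norm
   [`|v|] is not: Euclidean norms are written [norm2]. *)

Section borel_matrix.
Variables (R : realType) (m n : nat).

HB.instance Definition _ := @isMeasurable.Build
  (sigma_display (@open 'M[R]_(m, n))) 'M[R]_(m, n) <<s @open 'M[R]_(m, n) >>
  (@sigma_algebra0 _ setT _) (@sigma_algebraC _ _)
  (@sigma_algebra_bigcup _ setT _).

Lemma open_measurable_mx (A : set 'M[R]_(m, n)) : open A -> measurable A.
Proof. by move=> oA; exact: sub_sigma_algebra. Qed.

Lemma measurable_mx_coord i j :
  measurable_fun setT (fun M : 'M[R]_(m, n) => M i j).
Proof.
apply: (measurability _ (RGenOInfty.measurableE R)) => /= _ [_ [a ->] <-].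
rewrite setTI; apply: open_measurable_mx.
apply: open_comp; last exact: interval_open.
by move=> x _; exact: coord_continuous.
Qed.

Lemma open_bigcup_mx_ball (O : set 'M[R]_(m, n)) : open O ->
  O = \bigcup_(q : 'M[rat]_(m, n) * nat)
        [set M | ball (map_mx ratr q.1 : 'M[R]_(m, n)) q.2.+1%:R^-1 M /\
                 ball (map_mx ratr q.1 : 'M[R]_(m, n)) q.2.+1%:R^-1 `<=` O].
Proof.
move=> oO; apply/seteqP; split=> [M OM|M [q _ [qM]]]; last exact.
have : nbhs M O by exact: open_nbhs_nbhs.
rewrite -nbhs_ballE => -[e /= e0 eO].
have [k ke] : exists k : nat, k.+1%:R^-1 < e / 2.
  have /ltr_add_invr[k] : (0 : R) < e / 2 by rewrite divr_gt0.
  by rewrite add0r; exists k.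
have k0 : 0 < k.+1%:R^-1 :> R by rewrite invr_gt0.
have /choice[q qP] : forall ij : 'I_m * 'I_n, exists q : rat,
    ball (M ij.1 ij.2) k.+1%:R^-1 (ratr q : R).
  move=> ij; have /rat_in_itvoo[q] : M ij.1 ij.2 - k.+1%:R^-1 < M ij.1 ij.2 + k.+1%:R^-1.
    by rewrite ltrD2l gtrN.
  by move=> Mq; exists q; rewrite ball_itv.
exists (\matrix_(i, j) q (i, j), k) => //=.
have qM : ball (map_mx ratr (\matrix_(i, j) q (i, j)) : 'M[R]_(m, n)) k.+1%:R^-1 M.
  by split=> // i j; rewrite !mxE; apply: ball_sym; exact: (qP (i, j)).
split=> // N qN; apply: eO; rewrite (splitr e).
have leB x y : ball (x : 'M[R]_(m, n)) k.+1%:R^-1 y -> ball x (e / 2) y.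
  by apply: le_ball; exact: ltW.
by apply: ball_triangle (leB _ _ qN); apply/ball_sym/leB.
Qed.

Lemma measurable_fun_mx d (T : measurableType d) (D : set T)
    (f : T -> 'M[R]_(m, n)) :
  (forall i j, measurable_fun D (fun x => f x i j)) -> measurable_fun D f.
Proof.
move=> mf mD; move: (mD); apply: (measurability (@open 'M[R]_(m, n))) => //.
move=> _ [U oU <-]; rewrite (open_bigcup_mx_ball oU) preimage_bigcup.
rewrite setI_bigcupr; apply: countable_bigcupT_measurable => [|[q k] /=].
  exact: countableP.
have [qU|qU] := pselect
    (ball (map_mx ratr q : 'M[R]_(m, n)) k.+1%:R^-1 `<=` U); last first.
  rewrite (_ : _ `&` _ = set0)//; apply/seteqP; split=> // x [_ []] //.
rewrite (_ : f @^-1` _ = \bigcap_(ij in [set: 'I_m * 'I_n])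
    (fun x => f x ij.1 ij.2) @^-1` ball (ratr (q ij.1 ij.2) : R) k.+1%:R^-1).
  have [->|/set0P[ij0 _]] := eqVneq [set: 'I_m * 'I_n] set0.
    by rewrite bigcap_set0 setIT.
  rewrite -bigcapIr; last by exists ij0.
  apply: fin_bigcap_measurable => // ij _; apply: mf => //.
  by apply: open_measurable; exact: ball_open.
apply/seteqP; split=> [x /= [[_ qf] _] ij _|x qf /=].
  by have := qf ij.1 ij.2; rewrite mxE.
by split=> //; split=> [|i j]; [rewrite invr_gt0|rewrite mxE; exact: (qf (i, j))].
Qed.

End borel_matrix.

Definition row_cons (R : realType) n (xv : measurableTypeR R * 'rV[R]_n) : 'rV[R]_n.+1 :=
  row_mx (xv.1 : R)%:M xv.2.

Section lebesgue_rV.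
Variables (R : realType) (n : nat).

Let uncons (v : 'rV[R]_n.+1) : measurableTypeR R * 'rV[R]_n :=
  (v 0 0, \row_j v 0 (lift ord0 j)).

Lemma row_consE (xv : measurableTypeR R * 'rV[R]_n) (j : 'I_n.+1) : row_cons xv 0 j =
  if unlift ord0 j is Some k then xv.2 0 k else xv.1 :> R.
Proof.
rewrite /row_cons; case: unliftP => [k ->|->].
  have -> : lift ord0 k = @rshift 1 n k by exact: val_inj.
  exact: row_mxEr.
have -> : ord0 = @lshift 1 n ord0 by exact: val_inj.
by apply: etrans (row_mxEl _ _ _ _) _; rewrite mxE eqxx mulr1n.
Qed.

Lemma measurable_row_cons : measurable_fun setT (@row_cons R n).
Proof.
apply: measurable_fun_mx => i j; rewrite (ord1 i).
under eq_fun do rewrite row_consE.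
case: unliftP => [k _|_]; last exact: measurable_fst.
exact: (measurableT_comp (@measurable_mx_coord R 1 n 0 k) measurable_snd).
Qed.

Let measurable_uncons : measurable_fun setT uncons.
Proof.
apply/measurable_fun_pairP; split.
  exact: measurable_mx_coord.
apply: measurable_fun_mx => i j /=.
under eq_fun do rewrite mxE.
exact: measurable_mx_coord.
Qed.

Let row_consK : cancel (@row_cons R n) uncons.
Proof.
case=> x v; rewrite /uncons row_consE unlift_none; congr pair.
by apply/rowP => j; rewrite mxE row_consE liftK.
Qed.

Variable mu : {sigma_finite_measure set 'rV[R]_n -> \bar R}.

Definition lebesgue_cons : set 'rV[R]_n.+1 -> \bar R :=
  pushforward (@lebesgue_measure R \x mu)%E (@row_cons R n).

Let lebesgue_cons0 : lebesgue_cons set0 = 0%E.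
Proof. by rewrite /lebesgue_cons /pushforward preimage_set0 measure0. Qed.

Let lebesgue_cons_ge0 A : (0 <= lebesgue_cons A)%E.
Proof. by rewrite /lebesgue_cons /pushforward measure_ge0. Qed.

Let lebesgue_cons_sigma_additive : semi_sigma_additive lebesgue_cons.
Proof.
have mcons A : measurable A -> measurable (@row_cons R n @^-1` A).
  by move=> mA; rewrite -[X in measurable X]setTI; exact: measurable_row_cons.
move=> F mF tF mUF; rewrite /lebesgue_cons /pushforward preimage_bigcup.
apply: measure_semi_sigma_additive => [i||]; first exact: mcons.
- apply/trivIsetP => i j _ _ ij; rewrite -preimage_setI.
  by move/trivIsetP : tF => /(_ _ _ _ _ ij) ->//; rewrite preimage_set0.
- by rewrite -preimage_bigcup; exact: mcons.
Qed.

HB.instance Definition _ := isMeasure.Build _ _ _ lebesgue_cons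
  lebesgue_cons0 lebesgue_cons_ge0 lebesgue_cons_sigma_additive.

Let lebesgue_cons_sigma_finite : sigma_finite setT lebesgue_cons.
Proof.
have /sigma_finiteP[F [FT ndF Foo]] := sigma_finiteT (@lebesgue_measure R).
have /sigma_finiteP[G [GT ndG Goo]] := sigma_finiteT mu.
exists (fun k => uncons @^-1` (F k `*` G k)).
  apply/seteqP; split=> // v _.
  have [i _ Fi] : (\bigcup_i F i) (uncons v).1 by rewrite -FT.
  have [j _ Gj] : (\bigcup_j G j) (uncons v).2 by rewrite -GT.
  exists (maxn i j) => //; split.
    by move: Fi; exact/subsetPset/ndF/leq_maxl.
  by move: Gj; exact/subsetPset/ndG/leq_maxr.
move=> k; have [mFk Fkoo] := Foo k; have [mGk Gkoo] := Goo k; split.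
  rewrite -[X in measurable X]setTI; apply: measurable_uncons => //.
  exact: measurableX.
rewrite /lebesgue_cons /pushforward -comp_preimage (_ : _ \o _ = id); last first.
  by apply/funext => xv /=; rewrite row_consK.
by rewrite preimage_id product_measure1E// lte_mul_pinfty// ge0_fin_numE.
Qed.

HB.instance Definition _ := Measure_isSigmaFinite.Build _ _ _ lebesgue_cons
  lebesgue_cons_sigma_finite.

End lebesgue_rV.

(* Lebesgue measure on R^n, by iterating the product with the Lebesgue measure on
   the first coordinate. *)
Fixpoint lebesgue_rV (R : realType) n :
    {sigma_finite_measure set 'rV[R]_n -> \bar R} :=
  match n with
  | 0 => \d_(0 : 'rV[R]_0)
  | n'.+1 => lebesgue_cons (lebesgue_rV R n')
  end.

Section euclidean.
Variable R : realType.

Definition norm2 n (v : 'rV[R]_n) : R := Num.sqrt (\sum_(i < n) v 0 i ^+ 2).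

Definition opnorm m (A : 'M[R]_m) : R :=
  sup [set norm2 (v *m A^T) | v in [set v : 'rV[R]_m | norm2 v <= 1]].

Definition unit_sphere m : set 'rV[R]_m := [set v | norm2 v = 1].
Definition unit_ball m : set 'rV[R]_m := [set v | norm2 v <= 1].

Definition normalize_rV m (v : 'rV[R]_m) : 'rV[R]_m := (norm2 v)^-1 *: v.

Lemma measurable_norm2 m : measurable_fun setT (@norm2 m).
Proof.
rewrite (_ : @norm2 m = fun v => (\sum_(i < m) v 0 i ^+ 2) `^ 2^-1).
  apply: (measurableT_comp (@measurable_powR R 2^-1)).
  apply: measurable_sum => i.
  by apply: measurable_funX; exact: measurable_mx_coord.
by apply/funext => v; rewrite powR12_sqrt// sumr_ge0// => i _; exact: sqr_ge0.
Qed.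

Lemma measurable_unit_ball m : measurable (@unit_ball m).
Proof.
rewrite (_ : @unit_ball m = setT `&` @norm2 m @^-1` `]-oo, 1]).
  exact: measurable_norm2.
by rewrite setTI; apply/seteqP; split => v /=; rewrite in_itv.
Qed.

Lemma measurable_normalize_rV m : measurable_fun setT (@normalize_rV m).
Proof.
apply: measurable_fun_mx => i j.
rewrite (_ : (fun _ => _) = fun v : 'rV[R]_m => norm2 v `^ (-1) * v i j).
  apply: measurable_funM; last exact: measurable_mx_coord.
  exact: (measurableT_comp (@measurable_powR R (-1)) (@measurable_norm2 m)).
by apply/funext => v; rewrite mxE powR_inv1// sqrtr_ge0.
Qed.

HB.instance Definition _ m := isMeasurableFun.Build _ _ _ _ (@normalize_rV m)
  (@measurable_normalize_rV m).

(* The Dirac mass is only the default that [mnormalize] asks for when the total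
   mass is 0 or +oo, which is not the case of the unit ball. *)
Definition uniform_ball m : probability 'rV[R]_m R :=
  mnormalize (mrestr (lebesgue_rV R m) (@measurable_unit_ball m))
    (\d_(0 : 'rV[R]_m)).

(* The normalized surface (cone) measure of the sphere, as a measure on R^m:
   the mass of [A] is the relative volume of the part of the unit ball lying on
   the rays through [A].  Meaningful for [0 < m]. *)
Definition uniform_sphere m : probability 'rV[R]_m R :=
  distribution (uniform_ball m) (@normalize_rV m).

End euclidean.

Section smooth.
Variable R : realType.

(* Total gradient: 0 where [f] is not differentiable. *)
Definition gradient n (f : 'rV[R]_n -> R) (x : 'rV[R]_n) : 'rV[R]_n :=
  if `[< differentiable f x >] then \row_i 'd f x (delta_mx 0 i) else 0.

(* Pointwise continuity of the differential; in finite dimension this is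
   continuity for the operator norm. *)
Definition continuously_differentiable (V W : normedModType R) (f : V -> W) :=
  (forall p, differentiable f p) /\
  (forall w, continuous (fun p => 'd f p w : W)).

End smooth.

Section gaussian.
Variables (R : realType) (m : nat).

Definition posdefmx (S : 'M[R]_m) :=
  S^T = S /\ forall v : 'rV[R]_m, v != 0 -> 0 < (v *m S *m v^T) 0 0.

Definition cholesky_factor (S L : 'M[R]_m) :=
  [/\ is_trig_mx L, forall i, 0 < L i i & L *m L^T = S].

Definition gauss_density (mean : 'rV[R]_m) (S : 'M[R]_m) (y : 'rV[R]_m) : R :=
  (Num.sqrt ((2 * pi) ^+ m * \det S))^-1 *
  expR (- 2^-1 * ((y - mean) *m invmx S *m (y - mean)^T) 0 0).

Definition Gamma (s : R) : R :=
  \int[lebesgue_measure]_(t in `]0, +oo[) (t `^ (s - 1) * expR (- t)).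

Definition chi_density (r : R) : R :=
  (2 `^ (m%:R / 2 - 1) * Gamma (m%:R / 2))^-1 * r ^+ m.-1
  * expR (- (r ^+ 2 / 2)).

End gaussian.

(* The parameter [c] lives in a Borel set [C] of R^p; its law [mu] is a
   probability measure on R^p with [mu C = 1], and the values of [z], [Sigma]
   and [L] outside [C] are irrelevant. *)
Section model.
Variables (R : realType) (n m p : nat).
Variables (C : set 'rV[R]_p) (mu : probability 'rV[R]_p R).
Variables (z : 'rV[R]_p -> 'rV[R]_m) (Sigma L : 'rV[R]_p -> 'M[R]_m).
Variable g : 'rV[R]_n * 'rV[R]_m -> R.

Definition cond_prob_fun (c : 'rV[R]_p) (x : 'rV[R]_n) : R :=
  \int[lebesgue_rV R m]_(y in [set y | g (x, y) <= 0])
    gauss_density (z c) (Sigma c) y.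

Definition prob_fun (x : 'rV[R]_n) : R :=
  \int[mu]_(c in C) cond_prob_fun c x.

Definition radial_prob_fun (c : 'rV[R]_p) (x : 'rV[R]_n) (v : 'rV[R]_m) : R :=
  \int[lebesgue_measure]_(r in
      [set r : R | 0 <= r /\ g (x, r *: (v *m (L c)^T) + z c) <= 0])
    chi_density m r.

Definition uniform_slater_point (xbar : 'rV[R]_n) :=
  exists (U : set 'rV[R]_n) (gamma0 : R), [/\ open_nbhs xbar U, 0 < gamma0 &
    forall x, U x -> {ae mu, forall c, C c -> g (x, z c) < - gamma0}].

Definition exp_growth_at (xbar : 'rV[R]_n) :=
  exists eps a b : R, [/\ 0 < eps, 0 < a, 0 < b &
    forall x y, norm2 (x - xbar) < eps ->
      norm2 (gradient (fun x' => g (x', y)) x) <= a * expR (b * norm2 y)].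

End model.

(* Identically distributed with law [Q], and mutually independent: the product
   rule holds for every finite subfamily. *)
Definition iid (R : realType) (d d' : measure_display) (Omega : measurableType d)
    (T : measurableType d') (P : probability Omega R) (X : nat -> Omega -> T)
    (Q : set T -> \bar R) :=
  [/\ forall i, measurable_fun setT (X i),
      forall i A, measurable A -> P (X i @^-1` A) = Q A &
      forall (s : seq nat) (A : nat -> set T), uniq s ->
        (forall i, measurable (A i)) ->
        P (\bigcap_(i in [set` s]) X i @^-1` A i) =
        (\prod_(i <- s) P (X i @^-1` A i))%E].

(* Main.v *)
(** For a parameter [t = (u, s)] the radial value [E (x, t)] is the chi mass of
    [{r >= 0 | g (x, r u + s) <= 0}].  In polar coordinates
    [Phi x = E[E (x, T)]], where [T = (L(c) v, z(c))] for the pair [(v, c)] of the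
    sample.  If [g (x, s) <= - gamma < 0], convexity along the ray gives at most one
    root [r] of [g (x, r u + s) = 0], crossed with slope at least [gamma / r], so
    [E (x, t)] is the chi distribution function at [r], or [1] without root.  Two
    mean value theorems give first-order expansions of [E (., t)] near a parameter
    with a root; near a parameter without root the roots are far away, and the
    Gaussian tail beats the exponential growth of the gradient.  By compactness
    these expansions are uniform in [t], hence [Phi] is differentiable with
    gradient the mean of the gradients of [E (., T)], and [E] and its gradient are
    locally approximated in [x], uniformly in [t], by bounded functions of [t]
    alone.  The strong law of large numbers for the latter and a finite cover of
    [X] conclude. *)

Require Import Defs.
From HB Require Import structures.
From mathcomp Require Import all_boot all_order all_algebra.
From mathcomp Require Import all_classical all_reals all_analysis.
From mathcomp Require Import measurable_realfun gauss_integral.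
From mathcomp Require finmap.
From mathcomp Require Import ring lra.

Set Implicit Arguments.
Unset Strict Implicit.
Unset Printing Implicit Defensive.

Import Order.TTheory GRing.Theory Num.Theory.
Import numFieldNormedType.Exports.

Local Open Scope classical_set_scope.
Local Open Scope ring_scope.

(** * Lebesgue measure on row vectors *)

(** The Slater inequality holds for almost every [c], with a null set that may depend on [x]. Around
    a centre [x0] of [X] the parameters are therefore confined by the inequality at [x0] alone. With
    the bounds on [u] and [s] this cuts out one compact set that contains almost every sampled ray,
    and compactness extends the inequality to a neighbourhood of [x0] with half of [gamma]. The root
    is never differentiated as an implicit function: the increments of [g] and of the chi
    distribution function are written exactly through intermediate points, and joint continuity of
    the resulting quotient does the rest. No surface measure is constructed: polar coordinates come
    from Tonelli's theorem and scaling, and the volume of the unit ball is eliminated by evaluating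
    the Gaussian integral in both coordinate systems. The Cholesky factor being triangular, the
    affine change of variables is a succession of one-dimensional ones. *)

Section affine_line.
Context {R : realType}.
Notation leb := (@lebesgue_measure R).

Lemma measurable_affine (a b : R) : measurable_fun [set: measurableTypeR R]
  (fun x : measurableTypeR R => a * x + b : measurableTypeR R).
Proof. by apply: measurable_funD => //; apply: measurable_funM. Qed.

(** The right-hand side is a measure in [A] with the right value on half-open intervals, and these
    determine Lebesgue measure. *)
Lemma lebesgue_measure_affine (a b : R) (a0 : 0 < a)
    (A : set (measurableTypeR R)) : measurable A ->
  leb A = (a%:E * leb ((fun x : R => a * x + b)%R @^-1` A))%E.
Proof.
move=> mA; pose nu := mscale (NngNum (ltW a0))
  (pushforward leb (fun x : measurableTypeR R => a * x + b : measurableTypeR R)).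
apply: (@lebesgue_measure_unique _ (nu (measurable_affine a b))) => // _ [[x y] _ <-].
rewrite /nu/= /mscale/= /pushforward/=.
rewrite (_ : _ @^-1` _ = `](x - b) / a, (y - b) / a]%classic); last first.
  apply/seteqP; split=> r /=; rewrite !in_itv/=;
    by rewrite ltr_pdivrMr// ler_pdivlMr// ltrBlDr lerBrDr (mulrC r).
rewrite !lebesgue_measure_itv/= !lte_fin ltr_pM2r ?invr_gt0// ltrD2r.
case: ifPn => // xy; last by rewrite mule0.
rewrite -!EFinD -EFinM; congr EFin; field; exact: lt0r_neq0.
Qed.

Lemma ge0_integral_affine (a b : R) (f : measurableTypeR R -> \bar R) : 0 < a ->
  measurable_fun setT f -> (forall x, 0 <= f x)%E ->
  (\int[leb]_x f x = a%:E * \int[leb]_x f (a * x + b)%R)%E.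
Proof.
move=> a0 mf f0; pose nu := mscale (NngNum (ltW a0))
  (pushforward leb (fun x : measurableTypeR R => a * x + b : measurableTypeR R)).
rewrite (eq_measure_integral (nu (measurable_affine a b))); last first.
  by move=> A mA _; exact: lebesgue_measure_affine.
rewrite ge0_integral_mscale//; congr (_ * _)%E.
by rewrite ge0_integral_pushforward //=; exact: measurable_affine.
Qed.

End affine_line.

Section lebesgue_rVS.
Context {R : realType}.

Lemma ge0_integral_lebesgue_rVS n (f : 'rV[R]_n.+1 -> \bar R) :
  measurable_fun setT f -> (forall y, 0 <= f y)%E ->
  (\int[lebesgue_rV R n.+1]_y f y =
   \int[@lebesgue_measure R]_x \int[lebesgue_rV R n]_w f (row_cons (x, w)))%E.
Proof.
move=> mf f0.
have := ge0_integral_pushforward (@measurable_row_cons R n)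
  (@lebesgue_measure R \x lebesgue_rV R n)%E measurableT mf
  (fun y _ => f0 y).
rewrite preimage_setT fubini_tonelli1//.
  by apply: measurableT_comp; [exact: mf|exact: measurable_row_cons].
by move=> ?; exact: f0.
Qed.

Lemma measurable_mulmxr m n p (A : 'M[R]_(n, p)) :
  measurable_fun setT (fun w : 'M[R]_(m, n) => w *m A).
Proof.
apply: measurable_fun_mx => i j; under eq_fun do rewrite mxE.
apply: measurable_sum => k; apply: measurable_funM => //.
exact: measurable_mx_coord.
Qed.

Lemma measurable_addmxr m n (B : 'M[R]_(m, n)) :
  measurable_fun setT (fun w : 'M[R]_(m, n) => w + B).
Proof.
apply: measurable_fun_mx => i j; under eq_fun do rewrite mxE.
by apply: measurable_funD => //; exact: measurable_mx_coord.
Qed.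

Lemma measurable_row_consr n (x : measurableTypeR R) :
  measurable_fun setT (fun w : 'rV[R]_n => row_cons (x, w)).
Proof.
apply: measurable_fun_mx => i j; rewrite ord1.
under eq_fun do rewrite row_consE.
case: unliftP => [k _|_]; last exact: measurable_cst.
exact: (@measurable_mx_coord R 1 n 0 k).
Qed.

(** The induction peels off the first coordinate. With [L] lower triangular it is only scaled and
    shifted, and it enters the other coordinates as a translation by [x *: k^T]. The shift absorbs
    that translation, so [z] is quantified inside the induction. *)
Lemma ge0_integral_trig_affine n (L : 'M[R]_n) : is_trig_mx L ->
  (forall i, 0 < L i i) -> forall (z : 'rV_n) (f : 'rV[R]_n -> \bar R),
  measurable_fun setT f -> (forall y, 0 <= f y)%E ->
  (\int[lebesgue_rV R n]_y f y =
    (\det L)%:E * \int[lebesgue_rV R n]_w f (w *m L^T + z)%R)%E.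
Proof.
elim/trigsqmx_ind => {n L} [|n l k L tL IH] L0 z f mf f0.
  rewrite det_mx00 mul1e; apply: eq_integral => y _; congr (f _).
  by apply/rowP => -[].
have l0 : 0 < l 0 0.
  have := L0 (lshift n 0); by rewrite block_mxEul.
have Li i : 0 < L i i.
  have := L0 (rshift 1 i); by rewrite block_mxEdr.
rewrite det_lblock det_mx11.
have mLz p (A : 'M[R]_(p, p)) (y : 'rV_p) (h : 'rV[R]_p -> \bar R) :
    measurable_fun setT h -> measurable_fun setT (fun w => h (w *m A + y)).
  move=> mh; apply: (measurableT_comp mh).
  by apply: (measurableT_comp (measurable_addmxr y)); exact: measurable_mulmxr.
have mrow (h : 'rV[R]_n.+1 -> \bar R) (x : measurableTypeR R) : measurable_fun setT h ->
    measurable_fun setT (fun w => h (row_cons (x, w))).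
  by move=> mh; apply: (measurableT_comp mh); exact: measurable_row_consr.
rewrite !ge0_integral_lebesgue_rVS//; last exact: mLz.
have det0 : 0 < \det L by rewrite det_trig// prodr_gt0.
have rowE x w : row_cons (x, w) *m (block_mx l 0 k L)^T + z =
  row_cons (l 0 0 * x + lsubmx z 0 0,
            w *m L^T + ((x : R) *: k^T + rsubmx z)).
  transitivity (row_mx (x : R)%:M w *m block_mx l^T k^T 0^T L^T +
                row_mx (lsubmx z) (rsubmx z)).
    by rewrite hsubmxK tr_block_mx.
  rewrite mul_row_block trmx0 mulmx0 addr0 add_row_mx; congr row_mx.
    by apply/matrixP => i j; rewrite !ord1 !mxE big_ord1 !mxE eqxx !mulr1n mulrC.
  by rewrite mul_scalar_mx addrA (addrC (_ *: _)).
have mI (h : 'rV[R]_n.+1 -> \bar R) : measurable_fun setT h ->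
    (forall y, 0 <= h y)%E -> measurable_fun setT
      (fun x : measurableTypeR R => \int[lebesgue_rV R n]_w h (row_cons (x, w)))%E.
  move=> mh h0; apply: (@measurable_fun_fubini_tonelli_F _ _ _ _ R
    (lebesgue_rV R n) (h \o @row_cons R n)) => [|?]; last exact: h0.
  by apply: measurableT_comp; [exact: mh|exact: measurable_row_cons].
pose G (x : measurableTypeR R) :=
  (\int[lebesgue_rV R n]_w f (row_cons (x, w)))%E.
have mG : measurable_fun setT G.
  exact: mI.
have G0 x : (0 <= G x)%E by exact: integral_ge0.
rewrite -/G (ge0_integral_affine (lsubmx z 0 0) l0)// EFinM -muleA; congr (_ * _)%E.
rewrite -ge0_integralZl//; last 3 first.
- by apply: (mI (fun w => f (w *m (block_mx l 0 k L)^T + z))) => //; exact: mLz.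
- by move=> x _; exact: integral_ge0.
- by rewrite lee_fin ltW.
apply: eq_integral => x _.
under [in RHS]eq_integral do rewrite rowE.
by rewrite /G (IH Li (x *: k^T + rsubmx z)) //; exact: mrow.
Qed.

End lebesgue_rVS.

(** * Polar coordinates *)

Section polar.
Context {R : realType}.
Notation leb := (@lebesgue_measure R).

Lemma norm2_ge0 n (v : 'rV[R]_n) : 0 <= norm2 v.
Proof. exact: sqrtr_ge0. Qed.

Lemma norm2_sqr n (v : 'rV[R]_n) : norm2 v ^+ 2 = \sum_(i < n) v 0 i ^+ 2.
Proof. by rewrite sqr_sqrtr// sumr_ge0// => i _; exact: sqr_ge0. Qed.

Lemma norm2_eq0 n (v : 'rV[R]_n) : (norm2 v == 0) = (v == 0).
Proof.
apply/eqP/eqP => [v0|->]; last first.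
  by rewrite /norm2 big1 ?sqrtr0// => i _; rewrite mxE expr0n.
apply/rowP => i; rewrite mxE; apply/eqP; rewrite -sqrf_eq0; apply/eqP.
have /eqP := norm2_sqr v; rewrite v0 expr0n/= eq_sym psumr_eq0; last first.
  by move=> j _; exact: sqr_ge0.
by move=> /allP/(_ i (mem_index_enum _))/eqP.
Qed.

Lemma norm2_gt0 n (v : 'rV[R]_n) : (0 < norm2 v) = (v != 0).
Proof. by rewrite lt0r norm2_eq0 norm2_ge0 andbT. Qed.

Lemma norm2Z n a (v : 'rV[R]_n) : norm2 (a *: v) = `|a| * norm2 v.
Proof.
rewrite -sqrtr_sqr /norm2 -sqrtrM ?sqr_ge0// mulr_sumr; congr Num.sqrt.
by apply: eq_bigr => i _; rewrite mxE exprMn.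
Qed.

Lemma ge0_integral_scale_rV n (s : R) (f : 'rV[R]_n -> \bar R) : 0 < s ->
  measurable_fun setT f -> (forall y, 0 <= f y)%E ->
  (\int[lebesgue_rV R n]_y f y =
   (s ^+ n)%:E * \int[lebesgue_rV R n]_w f (s *: w))%E.
Proof.
move=> s0 mf f0.
rewrite (@ge0_integral_trig_affine _ _ s%:M _ _ 0) ?scalar_mx_is_trig//; last first.
  by move=> i; rewrite mxE eqxx.
rewrite det_scalar; congr (_ * _)%E; apply: eq_integral => w _.
by rewrite tr_scalar_mx mul_mx_scalar addr0.
Qed.

Lemma measurable_scale_rV n :
  measurable_fun setT (fun ws : 'rV[R]_n * measurableTypeR R => (ws.2 : R) *: ws.1).
Proof.
apply: measurable_fun_mx => i j; under eq_fun do rewrite mxE.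
apply: measurable_funM; first exact: measurable_snd.
exact: (measurableT_comp (@measurable_mx_coord R 1 n i j) measurable_fst).
Qed.

Lemma measurable_norm2_fst n :
  measurable_fun setT (fun ws : 'rV[R]_n * measurableTypeR R => norm2 ws.1).
Proof. exact: (measurableT_comp (@measurable_norm2 R n) measurable_fst). Qed.

(** The integrand spreads a unit mass over [s >= a]. With [a = norm2 y] it averages a point [y] over
    the centred balls that contain it, which is the starting point of the polar formula. *)
Lemma integral_inv_pow_tail m (a : R) : (0 < m)%N -> 0 < a ->
  (\int[leb]_(s in `[a, +oo[) (m%:R * a ^+ m * s^-1 ^+ m.+1)%:E = 1)%E.
Proof.
move=> m0 a0.
have dF (x : R) : 0 < x -> is_derive x 1 (fun s => - (a ^+ m * s^-1 ^+ m))
    (m%:R * a ^+ m * x^-1 ^+ m.+1).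
  move=> x0; have dV : is_derive x 1 (fun s : R => s^-1) (- x ^- 2 *: 1).
    by apply: is_deriveV; rewrite ?gt_eqF.
  rewrite (_ : (fun _ => _) = - (a ^+ m \*: ((fun s : R => s^-1) ^+ m))); last first.
    by apply/funext => s; rewrite !fctE.
  apply: is_derive_eq.
  rewrite (_ : x^-1 ^+ m.+1 = x^-1 ^+ m.-1 * x ^- 2); last first.
    by rewrite -exprVn -exprD addn2 prednK.
  by rewrite /GRing.scale/=; ring.
transitivity (0%:E - (- (a ^+ m * a^-1 ^+ m))%:E)%E; last first.
  by rewrite -exprMn divff ?gt_eqF// expr1n -EFinN opprK add0e.
apply: (@ge0_continuous_FTC2y _ (fun s => m%:R * a ^+ m * s^-1 ^+ m.+1)
  (fun s => - (a ^+ m * s^-1 ^+ m)) a 0).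
- move=> x ax; have x0 := lt_le_trans a0 ax.
  by rewrite !mulr_ge0// exprn_ge0// ?invr_ge0 ltW.
- apply: continuous_in_subspaceT => x; rewrite inE/= in_itv/= andbT => ax.
  have x0 := lt_le_trans a0 ax.
  apply: cvgM; first exact: cvg_cst.
  apply: (@cvg_comp _ _ _ (fun s : R => s^-1) (fun y => y ^+ m.+1) _ (nbhs x^-1)).
    by apply: inv_continuous; rewrite gt_eqF.
  exact: exprn_continuous.
- rewrite -oppr0 -(mulr0 (a ^+ m)); apply: cvgN; apply: cvgM; first exact: cvg_cst.
  rewrite (_ : 0 = 0 ^+ m); last by rewrite expr0n gtn_eqF.
  apply: (@cvg_comp _ _ _ (fun s : R => s^-1) (fun y => y ^+ m) _ (nbhs (0 : R))).
    by apply/gtr0_cvgV0; [exact: nbhs_pinfty_gt|exact: cvg_id].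
  exact: exprn_continuous.
- by move=> x ax; have ? := dF x (lt_trans a0 ax); exact: ex_derive.
- apply: cvg_at_right_filter.
  have /derivable1_diffP/differentiable_continuous : derivable
    (fun s : R => - (a ^+ m * s^-1 ^+ m)) a 1 by have ? := dF a a0; exact: ex_derive.
  exact.
- move=> x; rewrite in_itv/= andbT => ax; rewrite derive1E.
  by have ? := dF x (lt_trans a0 ax); exact: derive_val.
Qed.

Lemma norm2_normalize n (w : 'rV[R]_n) s : 0 < norm2 w ->
  (norm2 w * s) *: normalize_rV w = s *: w.
Proof.
by move=> w0; rewrite /normalize_rV scalerA mulrAC divff ?gt_eqF// mul1r.
Qed.

Variables (m : nat) (m0 : (0 < m)%N).
Notation lam := (lebesgue_rV R m).

Hypothesis lam0 : lam [set 0] = 0%E.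

Lemma ae_neq0 : {ae lam, forall w, w != 0}.
Proof.
exists [set 0]; split => //.
  rewrite (_ : [set 0] = setT `&` @norm2 R m @^-1` [set 0]).
    exact: measurable_norm2.
  by rewrite setTI; apply/seteqP; split => v /=; [move=> ->|move=> /eqP];
    [apply/eqP; rewrite norm2_eq0|rewrite norm2_eq0 => /eqP].
by move=> w /= /negP; rewrite negbK => /eqP.
Qed.

Lemma measurable_if_pos d (T : measurableType d) (b : T -> bool) (F : T -> \bar R) :
  measurable_fun setT b -> measurable_fun setT F ->
  measurable_fun setT (fun t => if b t then F t else 0%E).
Proof. by move=> mb mF; exact: measurable_fun_ifT. Qed.

Let wt (r : R) := m%:R * r ^+ m.-1.

Let wt_ge0 r : 0 <= r -> 0 <= wt r.
Proof. by move=> r0; rewrite mulr_ge0// exprn_ge0. Qed.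

Let measurable_wt : measurable_fun [set: measurableTypeR R] (fun r : measurableTypeR R => wt r).
Proof. by apply: measurable_funM => //; exact: measurable_funX. Qed.

Let expr_m (r : R) : r ^+ m = r * r ^+ m.-1.
Proof. by rewrite -exprS prednK. Qed.

Section tonelli.
Variable f : 'rV[R]_m -> \bar R.
Hypothesis mf : measurable_fun setT f.
Hypothesis f0 : forall y, (0 <= f y)%E.

Let ray (w : 'rV[R]_m) : \bar R := (\int[leb]_r
  (if (0 < r)%R then f (r *: normalize_rV w)%R * (wt r)%:E else 0))%E.

(** [K] and [H] are two forms of one integrand. [H] spreads each [y] over the radii [s >= norm2 y].
    For fixed [s] the substitution [y = s w] turns [H] into [K], which lives on the unit ball; for
    fixed [w] the substitution [r = norm2 w * s] turns [K] into the ray integral. *)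
Let K (ws : 'rV[R]_m * measurableTypeR R) : \bar R :=
  (if ((0 : R) < ws.2)%R && (norm2 ws.1 <= 1)%R then
     f ((ws.2 : R) *: ws.1)%R * (wt ws.2 * norm2 ws.1 ^+ m)%:E else 0)%E.

(** The power with exponent -1 is the inverse on the positive radii selected by the test, in a form
    that is measurable on the whole line. *)
Let H (ys : 'rV[R]_m * measurableTypeR R) : \bar R :=
  (if ((0 : R) < ys.2)%R && (norm2 ys.1 <= ys.2)%R then
     f ys.1 * (m%:R * norm2 ys.1 ^+ m * (ys.2 `^ (-1)) ^+ m.+1)%:E else 0)%E.

Let measurable_pos : measurable_fun setT
  (fun ws : 'rV[R]_m * measurableTypeR R => (0 : R) < ws.2).
Proof. by apply: measurable_fun_ltr => //; exact: measurable_snd. Qed.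

Let mK : measurable_fun setT K.
Proof.
apply: measurable_if_pos.
  apply: measurable_and; first exact: measurable_pos.
  by apply: measurable_fun_ler => //; exact: measurable_norm2_fst.
apply: emeasurable_funM.
  by apply: (measurableT_comp mf); exact: measurable_scale_rV.
apply/measurable_EFinP; apply: measurable_funM.
  exact: (measurableT_comp measurable_wt measurable_snd).
by apply: measurable_funX; exact: measurable_norm2_fst.
Qed.

Let K_ge0 ws : (0 <= K ws)%E.
Proof.
rewrite /K; case: ifPn => // /andP[s0 _]; apply: mule_ge0 => //.
rewrite lee_fin mulr_ge0 ?exprn_ge0 ?norm2_ge0//.
exact/wt_ge0/ltW.
Qed.

Let mH : measurable_fun setT H.
Proof.
apply: measurable_if_pos.
  apply: measurable_and; first exact: measurable_pos.
  by apply: measurable_fun_ler; [exact: measurable_norm2_fst|exact: measurable_snd].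
apply: emeasurable_funM.
  by apply: (measurableT_comp mf); exact: measurable_fst.
apply/measurable_EFinP; apply: measurable_funM.
  apply: measurable_funM => //.
  by apply: measurable_funX; exact: measurable_norm2_fst.
apply: measurable_funX.
exact: (measurableT_comp (measurable_powR (-1)) measurable_snd).
Qed.

Let H_ge0 ys : (0 <= H ys)%E.
Proof.
rewrite /H; case: ifPn => // /andP[s0 _]; apply: mule_ge0 => //.
by rewrite lee_fin !mulr_ge0// ?exprn_ge0// ?norm2_ge0 ?powR_ge0.
Qed.

Let measurable_ray_fun w : measurable_fun setT
  (fun r : measurableTypeR R => (if (0 < r)%R then f (r *: w)%R * (wt r)%:E else 0)%E).
Proof.
apply: measurable_if_pos; first exact: measurable_fun_ltr.
apply: emeasurable_funM; last first.
  apply/measurable_EFinP; exact: measurable_wt.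
apply: (measurableT_comp mf); apply: measurable_fun_mx => i j.
by under eq_fun do rewrite mxE; apply: measurable_funM.
Qed.

Let ray_fun_ge0 w (r : R) : (0 <= if (0 < r)%R then f (r *: w)%R * (wt r)%:E else 0)%E.
Proof. by case: ifPn => // r0; rewrite mule_ge0// lee_fin wt_ge0// ltW. Qed.

Let rayE w : w != 0 -> norm2 w <= 1 -> ray w = (\int[leb]_s K (w, s))%E.
Proof.
rewrite -norm2_gt0 => w0 w1.
rewrite /ray (ge0_integral_affine 0 w0)//.
have mr := measurableT_comp (measurable_ray_fun (normalize_rV w))
  (measurable_affine (norm2 w) 0).
rewrite -(ge0_integralZl _ _ mr) ?lee_fin ?norm2_ge0//; last first.
  by move=> r _; exact: ray_fun_ge0.
apply: eq_integral => s _; rewrite /= addr0 /K/= w1 andbT pmulr_rgt0//.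
case: ifPn => s0; last by rewrite mule0.
rewrite norm2_normalize// muleCA -EFinM; congr (_ * _%:E)%E.
by rewrite /wt exprMn expr_m; ring.
Qed.

Let KH (s : measurableTypeR R) :
  (\int[lam]_w K (w, s) = \int[lam]_y H (y, s))%E.
Proof.
have [s0|s0] := ltP (0 : R) s; last first.
  by apply: eq_integral => w _; rewrite /K /H/= ltNge s0.
rewrite [RHS](ge0_integral_scale_rV s0)//; last first.
  by apply: (measurableT_comp mH); exact: measurable_pair2.
rewrite -ge0_integralZl//; last 2 first.
- apply: (measurableT_comp (f := fun y => H (y, s))).
    by apply: (measurableT_comp mH); exact: measurable_pair2.
  apply: measurable_fun_mx => i j; under eq_fun do rewrite mxE.
  by apply: measurable_funM => //; exact: measurable_mx_coord.
- by rewrite lee_fin exprn_ge0// ltW.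
apply: eq_integral => w _; rewrite /K /H/= s0/=.
rewrite norm2Z gtr0_norm//.
rewrite (_ : (s * norm2 w <= s) = (norm2 w <= 1)); last first.
  by rewrite -{2}(mulr1 s) ler_pM2l.
case: ifPn => w1; last by rewrite mule0.
rewrite muleCA -EFinM; congr (_ * _%:E)%E.
rewrite powR_inv1 ?ltW// /wt exprMn exprVn exprS !(expr_m s).
by field; rewrite !gt_eqF// exprn_gt0.
Qed.

Let HE y : y != 0 -> (\int[leb]_s H (y, s) = f y)%E.
Proof.
rewrite -norm2_gt0 => y0.
have mt : measurable_fun (`[norm2 y, +oo[%classic : set (measurableTypeR R))
    (fun s : measurableTypeR R => (m%:R * norm2 y ^+ m * s^-1 ^+ m.+1)%:E).
  apply/measurable_EFinP; apply: measurable_funM => //.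
  apply: measurable_funX; apply: (@eq_measurable_fun _ _ _ _ _ (@powR R ^~ (-1))).
    move=> x; rewrite inE/= in_itv/= andbT => yx.
    by rewrite powR_inv1// (le_trans _ yx)// norm2_ge0.
  by apply: measurable_funTS; exact: measurable_powR.
transitivity (f y * 1)%E; last by rewrite mule1.
rewrite -(integral_inv_pow_tail m0 y0).
apply: etrans; last apply: (ge0_integralZl _ _ mt) => //; last first.
  move=> x /=; rewrite in_itv/= andbT => yx.
  have x0 := le_trans (norm2_ge0 y) yx.
  by rewrite lee_fin mulr_ge0 ?exprn_ge0 ?invr_ge0// mulr_ge0 ?exprn_ge0 ?norm2_ge0.
rewrite [RHS]integral_mkcond; apply: eq_integral => s _.
rewrite patchE /H/= mem_setE in_itv/= andbT.
case: ifPn => [/andP[s0 ->]|]; first by rewrite powR_inv1// ltW.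
rewrite negb_and; case: ifPn => //= ys; rewrite orbF -leNgt => s0.
by have := lt_le_trans y0 (le_trans ys s0); rewrite ltxx.
Qed.

(** Integrated over [s], [H] gives [f] and [K] gives the ray integral; two exchanges of integrals
    join them. The origin, where no direction is defined, is a null set. *)
Lemma polar_integral :
  (\int[lam]_y f y = \int[lam]_(w in @unit_ball R m)
     \int[leb]_r (if (0 < r)%R then f (r *: normalize_rV w)%R * (wt r)%:E else 0))%E.
Proof.
transitivity (\int[lam]_y \int[leb]_s H (y, s))%E.
  apply: ge0_ae_eq_integral => //.
  - exact: (measurable_fun_fubini_tonelli_F _ mH).
  - by move=> y _; exact: integral_ge0.
  - by apply: filterS ae_neq0 => y y0 _; rewrite HE.
rewrite (fubini_tonelli _ mH)//.
under eq_integral do rewrite -KH.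
rewrite -(fubini_tonelli _ mK)// [RHS]integral_mkcond.
apply: ge0_ae_eq_integral => //.
- exact: (measurable_fun_fubini_tonelli_F _ mK).
- apply/(measurable_restrictT _ _).1; first exact: measurable_unit_ball.
  apply: measurable_funTS.
  apply: (measurable_fun_fubini_tonelli_F (m2 := leb)
    (fun ws : 'rV[R]_m * measurableTypeR R => (if (0 < ws.2 :> R)%R then
       f ((ws.2 : R) *: normalize_rV ws.1)%R * (wt ws.2)%:E else 0)%E)) => [|ws].
    apply: measurable_if_pos; first exact: measurable_pos.
    apply: emeasurable_funM; last first.
      by apply/measurable_EFinP; exact: (measurableT_comp measurable_wt measurable_snd).
    apply: (measurableT_comp mf); apply: measurable_fun_mx => i j.
    under eq_fun do rewrite mxE.
    apply: measurable_funM; first exact: measurable_snd.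
    apply: (measurableT_comp (@measurable_mx_coord R 1 m i j)).
    exact: (measurableT_comp (@measurable_normalize_rV R m) measurable_fst).
  exact: ray_fun_ge0.
- by move=> y _; exact: integral_ge0.
- by move=> y _; apply: erestrict_ge0 => w _; exact: integral_ge0.
- apply: filterS ae_neq0 => w w0 _; rewrite patchE; case: ifPn.
    by rewrite inE => w1; rewrite -rayE.
  rewrite notin_setE /unit_ball/= => /negP/negbTE w1.
  by apply: integral0_eq => s _; rewrite /K/= w1 andbF.
Qed.

End tonelli.

End polar.

(** * Gaussian integrals on row vectors *)

Section gauss.
Context {R : realType}.
Notation leb := (@lebesgue_measure R).

Lemma measurable_rV0 n : measurable [set 0 : 'rV[R]_n].
Proof.
rewrite (_ : [set 0] = setT `&` @norm2 R n @^-1` [set 0]).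
  exact: measurable_norm2.
by rewrite setTI; apply/seteqP; split => v /=; [move=> ->|move=> /eqP];
  [apply/eqP; rewrite norm2_eq0|rewrite norm2_eq0 => /eqP].
Qed.

Lemma lebesgue_rV0 n : (0 < n)%N -> lebesgue_rV R n [set 0] = 0%E.
Proof.
case: n => // n _.
rewrite -[LHS]/((leb \x lebesgue_rV R n)%E (@row_cons R n @^-1` [set 0])).
rewrite (_ : _ @^-1` _ = [set 0] `*` [set 0]).
  rewrite product_measure1E//; last exact: measurable_rV0.
  transitivity (0 * lebesgue_rV R n [set 0%R])%E; last by rewrite mul0e.
  by congr (_ * _)%E; exact: lebesgue_measure_set1.
apply/seteqP; split => [[x w] /= xw0|[x w] /= [-> ->]].
  split; last apply/rowP => j.
    by have := row_consE (x, w) ord0; rewrite xw0 mxE unlift_none.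
  by have := row_consE (x, w) (lift ord0 j); rewrite xw0 !mxE liftK.
apply/rowP => j; rewrite row_consE mxE.
by case: unliftP => [k _|//]; rewrite mxE.
Qed.

Lemma norm2_row_cons n (x : measurableTypeR R) (w : 'rV[R]_n) :
  norm2 (row_cons (x, w)) ^+ 2 = (x : R) ^+ 2 + norm2 w ^+ 2.
Proof.
rewrite !norm2_sqr big_ord_recl row_consE unlift_none; congr (_ + _).
by apply: eq_bigr => i _; rewrite row_consE liftK.
Qed.

Definition gaussian n (w : 'rV[R]_n) : R := expR (- (norm2 w ^+ 2 / 2)).

Lemma measurable_gaussian n : measurable_fun setT (@gaussian n).
Proof.
apply: measurableT_comp => //; apply: measurable_funN; apply: measurable_funM => //.
by apply: measurable_funX; exact: measurable_norm2.
Qed.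

Lemma integral_gaussian1 :
  (\int[leb]_x (expR (- ((x : R) ^+ 2 / 2)))%:E = (Num.sqrt (2 * pi))%:E)%E.
Proof.
have s0 : 0 < (Num.sqrt 2)^-1 :> R by rewrite invr_gt0 sqrtr_gt0.
have : (\int[leb]_x (gauss_fun (x : R))%:E = (Num.sqrt pi)%:E)%E
  by exact: integralT_gauss.
rewrite (ge0_integral_affine 0 s0)/=; last 2 first.
- by apply/measurable_EFinP; exact: measurable_gauss_fun.
- by move=> x; rewrite lee_fin gauss_fun_ge0.
rewrite (eq_integral (fun x : measurableTypeR R => (expR (- ((x : R) ^+ 2 / 2)))%:E)); last first.
  move=> x _; rewrite /gauss_fun addr0 exprMn exprVn sqr_sqrtr//.
  by congr (expR (- _))%:E; rewrite mulrC.
move=> H; transitivity ((Num.sqrt 2 : R)%:E * (Num.sqrt (pi : R))%:E)%E.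
  rewrite -H muleA -EFinM divff; first by rewrite mul1e.
  by rewrite gt_eqF// -invr_gt0.
by rewrite -EFinM sqrtrM.
Qed.

Lemma integral_gaussian n :
  (\int[lebesgue_rV R n]_w (gaussian w)%:E = (Num.sqrt (2 * pi) ^+ n)%:E)%E.
Proof.
have mg k : measurable_fun setT (EFin \o @gaussian k).
  by apply/measurable_EFinP; exact: measurable_gaussian.
elim: n => [|n IH].
  rewrite integral_dirac// diracT mul1e /gaussian norm2_sqr big_ord0 mul0r oppr0.
  by rewrite expR0 expr0.
rewrite ge0_integral_lebesgue_rVS//; last by move=> y; rewrite lee_fin expR_ge0.
have E (x : measurableTypeR R) :
    (\int[lebesgue_rV R n]_w (gaussian (row_cons (x, w)))%:E =
     (expR (- ((x : R) ^+ 2 / 2)))%:E * (Num.sqrt (2 * pi) ^+ n)%:E)%E.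
  rewrite -IH -(ge0_integralZl _ _ (mg n)) ?lee_fin ?expR_ge0//; last first.
    by move=> w _; rewrite lee_fin expR_ge0.
  apply: eq_integral => w _.
  by rewrite /gaussian norm2_row_cons mulrDl opprD expRD EFinM.
rewrite (eq_integral _ _ (fun x _ => E x)).
have mx : measurable_fun setT (fun x : measurableTypeR R => expR (- ((x : R) ^+ 2 / 2))).
  apply: measurableT_comp => //; apply: measurable_funN; apply: measurable_funM => //.
have /measurable_EFinP mx' := mx.
rewrite (ge0_integralZr _ _ mx') ?lee_fin ?exprn_ge0 ?sqrtr_ge0//; last first.
  by move=> w _; rewrite lee_fin expR_ge0.
by rewrite integral_gaussian1 -EFinM exprS.
Qed.

End gauss.

(** * The uniform law on the sphere as the angular part of Lebesgue measure *)

Section uniform_sphere.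
Context {R : realType} (m : nat) (m0 : (0 < m)%N).
Notation leb := (@lebesgue_measure R).
Notation lam := (lebesgue_rV R m).
Notation B := (@unit_ball R m).
Notation zeta := (uniform_sphere R m).

Lemma integral_mrestr d (T : measurableType d) (mu : {measure set T -> \bar R})
    (D : set T) (mD : measurable D) (f : T -> \bar R) :
  measurable_fun setT f -> (forall x, 0 <= f x)%E ->
  (\int[mrestr mu mD]_x f x = \int[mu]_(x in D) f x)%E.
Proof.
move=> mf f0; have mDC := measurableC mD.
rewrite -(setUv D) ge0_integral_setU//; last 2 first.
- by rewrite setUv.
- by apply/disj_setPCl.
rewrite addeC [X in (X + _)%E]null_set_integral ?add0e//.
- by apply: eq_measure_integral => A mA AD /=; rewrite /mrestr setIidl.
- exact: measurable_funTS.
- by rewrite /= /mrestr setICl.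
Qed.

(** On the ball the Gaussian is at least [e^(-1/2)], and its total integral is finite. *)
Lemma lebesgue_unit_ball_lty : (lam B < +oo)%E.
Proof.
have mB := @measurable_unit_ball R m.
have : ((expR (- 2^-1))%:E * lam B < +oo)%E.
  apply: (@le_lt_trans _ _ (\int[lam]_w (gaussian w)%:E)%E); last first.
    by rewrite integral_gaussian ltry.
  rewrite -integral_cst// [leLHS]integral_mkcond.
  apply: ge0_le_integral => //.
  - by move=> w _; apply: erestrict_ge0 => ? _; rewrite lee_fin expR_ge0.
  - by apply/(measurable_restrictT _ _).1.
  - by apply/measurable_EFinP; exact: measurable_gaussian.
  - move=> w _; rewrite patchE; case: ifPn => [|_]; last by rewrite lee_fin expR_ge0.
    rewrite inE /unit_ball/= => w1; rewrite lee_fin /gaussian ler_expR lerN2.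
    by rewrite ler_pdivrMr// mulVf// expr_le1// norm2_ge0.
case: (lam B) => [r| |]; rewrite ?ltry//.
by rewrite gt0_muley// lte_fin expR_gt0.
Qed.

Definition ray_integral (f : 'rV[R]_m -> \bar R) (v : 'rV[R]_m) : \bar R :=
  (\int[leb]_r (if (0 < r)%R then f (r *: v)%R * (r ^+ m.-1)%:E else 0))%E.

Let measurable_ray2 f : measurable_fun setT f ->
  measurable_fun setT (fun vr : 'rV[R]_m * measurableTypeR R =>
    (if (0 < vr.2 :> R)%R then f ((vr.2 : R) *: vr.1)%R * ((vr.2 : R) ^+ m.-1)%:E else 0)%E).
Proof.
move=> mf; apply: measurable_if_pos.
  by apply: measurable_fun_ltr => //; exact: measurable_snd.
apply: emeasurable_funM.
  by apply: (measurableT_comp mf); exact: measurable_scale_rV.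
by apply/measurable_EFinP; apply: measurable_funX; exact: measurable_snd.
Qed.

Lemma ray_integrand_ge0 (f : 'rV[R]_m -> \bar R) v (r : R) : (forall v, 0 <= f v)%E ->
  (0 <= if (0 < r)%R then f (r *: v)%R * (r ^+ m.-1)%:E else 0)%E.
Proof.
by move=> f0; case: ifPn => // r0; rewrite mule_ge0// lee_fin exprn_ge0// ltW.
Qed.

Lemma ray_integral_ge0 f v : (forall v, 0 <= f v)%E -> (0 <= ray_integral f v)%E.
Proof. by move=> f0; apply: integral_ge0 => r _; exact: ray_integrand_ge0. Qed.

Lemma measurable_ray_integral f : measurable_fun setT f -> (forall v, 0 <= f v)%E ->
  measurable_fun setT (ray_integral f).
Proof.
move=> mf f0; apply: (measurable_fun_fubini_tonelli_F (m2 := leb) _ (measurable_ray2 mf)).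
by move=> vr; exact: ray_integrand_ge0.
Qed.

Lemma polar_integral_ball f : measurable_fun setT f -> (forall v, 0 <= f v)%E ->
  (\int[lam]_y f y = m%:R%:E * \int[lam]_(w in B) ray_integral f (normalize_rV w))%E.
Proof.
move=> mf f0; rewrite (polar_integral m0 (lebesgue_rV0 m0))//.
have mB := @measurable_unit_ball R m.
have mr : measurable_fun B (fun w => ray_integral f (normalize_rV w)).
  apply: measurable_funTS; apply: measurableT_comp.
    exact: measurable_ray_integral.
  exact: measurable_normalize_rV.
rewrite -(ge0_integralZl _ _ mr) ?lee_fin//; last first.
  by move=> w _; exact: ray_integral_ge0.
apply: eq_integral => w _.
have mw := measurableT_comp (measurable_ray2 mf) (pair1_measurable (normalize_rV w)).
rewrite /ray_integral -(ge0_integralZl _ _ mw) ?lee_fin//=; last first.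
  by move=> r _; exact: ray_integrand_ge0.
apply: eq_integral => r _; case: ifPn => r0; last by rewrite mule0.
by rewrite EFinM muleCA.
Qed.

(** If the ball were null, the polar formula would make the Gaussian integral vanish. *)
Lemma lebesgue_unit_ball_gt0 : (0 < lam B)%E.
Proof.
rewrite lt_neqAle measure_ge0 andbT eq_sym; apply/eqP => B0.
have : (\int[lam]_w (gaussian w)%:E = 0)%E.
  have mg : measurable_fun setT (EFin \o @gaussian R m).
    by apply/measurable_EFinP; exact: measurable_gaussian.
  have g0 (w : 'rV[R]_m) : (0 <= (EFin \o @gaussian R m) w)%E by rewrite lee_fin expR_ge0.
  rewrite (polar_integral_ball mg)// null_set_integral ?mule0//.
  - exact: measurable_unit_ball.
  - apply: measurable_funTS; apply: measurableT_comp.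
      exact: measurable_ray_integral.
    exact: measurable_normalize_rV.
rewrite integral_gaussian => /eqP; rewrite eqe gt_eqF// exprn_gt0// sqrtr_gt0.
by rewrite mulr_gt0// pi_gt0.
Qed.

Let kappa := fine (lam B).

Lemma kappa_gt0 : 0 < kappa.
Proof. by apply: fine_gt0; rewrite lebesgue_unit_ball_gt0 lebesgue_unit_ball_lty. Qed.

Lemma lebesgue_unit_ballE : lam B = kappa%:E.
Proof. by rewrite fineK// ge0_fin_numE// lebesgue_unit_ball_lty. Qed.

Lemma integral_uniform_sphere (F : 'rV[R]_m -> \bar R) :
  measurable_fun setT F -> (forall v, 0 <= F v)%E ->
  (\int[lam]_(w in B) F (normalize_rV w) = kappa%:E * \int[zeta]_v F v)%E.
Proof.
move=> mF F0.
have mB := @measurable_unit_ball R m.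
have mFn : measurable_fun setT (F \o @normalize_rV R m).
  by apply: measurableT_comp => //; exact: measurable_normalize_rV.
transitivity (\int[mrestr lam mB]_w F (normalize_rV w))%E.
  by rewrite integral_mrestr.
transitivity (kappa%:E * \int[uniform_ball R m]_w (F \o @normalize_rV R m) w)%E; last first.
  congr (_ * _)%E; rewrite -[RHS]/(\int[pushforward _ _]_v F v)%E.
  by rewrite ge0_integral_pushforward.
have k0 : 0 <= kappa^-1 by rewrite invr_ge0 ltW// kappa_gt0.
rewrite [X in (_ * X)%E](eq_measure_integral (mscale (NngNum k0) (mrestr lam mB))).
  rewrite ge0_integral_mscale//; last by move=> w _; exact: F0.
  rewrite muleA -EFinM divff ?mul1e// gt_eqF//.
  exact: kappa_gt0.
move=> A mA _; rewrite /= /uniform_ball /mnormalize /mscale/= /mrestr setTI.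
(* The default branch of [mnormalize] is excluded, the mass of the ball being positive and
   finite. *)
rewrite ifF; last first.
  rewrite lebesgue_unit_ballE; apply/negbTE; rewrite negb_or eqe gt_eqF//.
  exact: kappa_gt0.
by rewrite muleC.
Qed.

(** Normalization sends every nonzero vector to the sphere but leaves 0 at 0; the origin is a null
    set. *)
Lemma uniform_sphere_ae : {ae zeta, forall v, norm2 v = 1}.
Proof.
have mN : measurable [set v : 'rV[R]_m | norm2 v != 1].
  rewrite (_ : [set _ | _] = setT `&` @norm2 R m @^-1` (~` [set 1])).
    by apply: measurable_norm2 => //; exact: measurableC.
  by rewrite setTI; apply/seteqP; split => v /= /eqP.
exists [set v | norm2 v != 1]; split => //; last by move=> v /= /eqP.
have : (kappa%:E * zeta [set v : 'rV[R]_m | norm2 v != 1%R] = 0)%E.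
  transitivity (kappa%:E * \int[zeta]_v (\1_[set v : 'rV[R]_m | norm2 v != 1%R] v)%:E)%E.
    by rewrite integral_indic// setIT.
  rewrite -integral_uniform_sphere//; last first.
    by apply/measurable_EFinP; exact: measurable_indic.
  rewrite (ae_eq_integral (cst 0%E)) ?integral0//.
  - exact: measurable_unit_ball.
  - apply: measurable_funTS; apply/measurable_EFinP.
    by apply: measurableT_comp; [exact: measurable_indic|exact: measurable_normalize_rV].
  - apply: filterS (ae_neq0 (lebesgue_rV0 m0)) => w w0 _ /=.
    rewrite indicE memNset//= => /eqP; apply.
    rewrite /normalize_rV norm2Z ger0_norm ?invr_ge0 ?norm2_ge0//.
    by rewrite mulVf// norm2_eq0.
move=> /eqP; rewrite mule_eq0 eqe gt_eqF ?kappa_gt0//= => /eqP; exact.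
Qed.

Lemma ge0_polar (f : 'rV[R]_m -> \bar R) :
  measurable_fun setT f -> (forall v, 0 <= f v)%E ->
  (\int[lam]_y f y = (kappa * m%:R)%:E * \int[zeta]_v ray_integral f v)%E.
Proof.
move=> mf f0; rewrite (polar_integral_ball mf)// integral_uniform_sphere//.
- by rewrite EFinM muleCA muleA.
- exact: measurable_ray_integral.
- by move=> v; exact: ray_integral_ge0.
Qed.

End uniform_sphere.

(** * The chi law *)

Section gamma.
Context {R : realType}.
Notation leb := (@lebesgue_measure R).

Lemma bigcup_itvcc_pos (u w : nat -> R) :
  (forall n, 0 < u n) -> u n @[n --> \oo] --> 0 -> w n @[n --> \oo] --> +oo ->
  \bigcup_n `[u n, w n]%classic = `]0, +oo[%classic.
Proof.
move=> u0 cu cw; apply/seteqP; split => x /=.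
  by move=> [n _ /=]; rewrite !in_itv/= andbT => /andP[+ _]; apply: lt_le_trans.
rewrite in_itv/= andbT => x0.
have [N _ NP] : \forall n \near \oo, u n <= x /\ x <= w n.
  near=> n; split; near: n.
  - have /cvgrPdist_le/(_ x x0) := cu; apply: filterS => n.
    by rewrite sub0r normrN ger0_norm// ltW.
  - by move/cvgryPge : cw; exact.
exists N => //=; rewrite in_itv/=.
by have [-> ->] := NP N (leqnn N).
Unshelve. all: by end_near. Qed.

(** The substitution [t = r^2 / 2] is made on the intervals [[1 / (n + 1), n + 1]], followed by
    monotone convergence on both sides. Staying away from 0 matters: the Gamma kernel is unbounded
    there when [m = 1]. *)
Lemma ge0_integral_half_sqr (G : R -> R) :
  (forall t, 0 < t -> {for t, continuous G}) -> (forall t, 0 < t -> 0 <= G t) ->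
  (\int[leb]_(t in `]0%R, +oo[) (G t)%:E =
   \int[leb]_(r in `]0%R, +oo[) (G (r ^+ 2 / 2) * r)%:E)%E.
Proof.
move=> cG G0.
pose F (r : R) := r ^+ 2 / 2.
have dF (x : R) : is_derive x 1 F x.
  rewrite /F (_ : (fun _ => _) = (2^-1 \*: ((id : R -> R) ^+ 2))); last first.
    by apply/funext => r; rewrite !fctE/= mulrC.
  by apply: is_derive_eq; rewrite /GRing.scale/= mulr1; field.
have cF : continuous F.
  move=> y; apply: differentiable_continuous.
  by apply/derivable1_diffP; have ? := dF y; exact: ex_derive.
have F'E : (F^`())%classic = id by apply/funext => x; rewrite derive1E; exact: derive_val.
pose u n : R := n.+1%:R^-1; pose w n : R := n.+1%:R.
have u0 n : 0 < u n by rewrite invr_gt0.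
have uw n : u n <= w n.
  by rewrite /u /w (le_trans (y := 1))// ?invf_le1// ler1n.
have cu : u n @[n --> \oo] --> 0 by exact: cvg_harmonic.
have cw : w n @[n --> \oo] --> +oo.
  apply/cvgryPge => A; exists (Num.trunc A) => // n /= An.
  rewrite /w ltW// (lt_le_trans (truncnS_gt A))// ler_nat ltnS.
  exact: An.
have E n : (\int[leb]_(t in `[F (u n), F (w n)]) (G t)%:E =
   \int[leb]_(r in `[u n, w n]) (G (F r) * r)%:E)%E.
  rewrite integration_by_substitution_increasing//.
  - by apply: eq_integral => r _; rewrite /= F'E.
  - move=> x y; rewrite !in_itv/= => /andP[ux _] /andP[uy _] xy.
    rewrite /F ltr_pM2r ?invr_gt0// ltr_pXn2r// nnegrE ltW//; last first.
      exact: lt_le_trans (u0 n) uy.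
    exact: lt_le_trans (u0 n) ux.
  - by rewrite F'E => x _; exact: cvg_id.
  - by rewrite F'E; apply/cvg_ex; exists (u n); exact: cvg_at_right_filter.
  - by rewrite F'E; apply/cvg_ex; exists (w n); exact: cvg_at_left_filter.
  - split; first by move=> x _; have ? := dF x; exact: ex_derive.
      by apply: cvg_at_right_filter; exact: cF.
    by apply: cvg_at_left_filter; exact: cF.
  - apply: continuous_in_subspaceT => x; rewrite inE/= in_itv/= => /andP[Fux _].
    by apply: cG; apply: lt_le_trans Fux; rewrite divr_gt0// exprn_gt0.
have nd (u' w' : nat -> R) : {homo u' : m n / (m <= n)%N >-> n <= m} ->
    {homo w' : m n / (m <= n)%N >-> m <= n} ->
    nondecreasing_seq (fun n => `[u' n, w' n]%classic : set (measurableTypeR R)).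
  move=> hu hw m n mn; rewrite subsetEset => x /=; rewrite !in_itv/= => /andP[a b].
  by rewrite (le_trans (hu _ _ mn))// (le_trans b)// hw.
have hu : {homo u : m n / (m <= n)%N >-> n <= m}.
  by move=> m n mn; rewrite lef_pV2 ?posrE// ler_nat ltnS.
have hw : {homo w : m n / (m <= n)%N >-> m <= n} by move=> m n mn; rewrite ler_nat ltnS.
have F0 x : 0 < x -> 0 < F x by move=> x0; rewrite divr_gt0// exprn_gt0.
have leF x y : 0 <= x -> x <= y -> F x <= F y.
  move=> x0 xy; rewrite /F ler_pM2r ?invr_gt0// lerXn2r// nnegrE//.
  exact: le_trans x0 xy.
have mG (h : R -> R) (A : set R) : (forall t, 0 < t -> {for t, continuous h}) ->
    A `<=` `]0, +oo[ -> measurable_fun A h.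
  move=> ch sA; apply: (measurable_funS _ sA) => //.
  apply: open_continuous_measurable_fun; first exact: interval_open.
  by move=> x; rewrite inE/= in_itv/= andbT; exact: ch.
have C1 : (\int[leb]_(t in `[F (u n), F (w n)]) (G t)%:E @[n --> \oo] -->
    \int[leb]_(t in `]0%R, +oo[) (G t)%:E)%E.
  rewrite -(bigcup_itvcc_pos (u := F \o u) (w := F \o w)).
  - apply: ge0_nondecreasing_set_cvg_integral => //.
    + apply: nd => m n mn; first by apply: leF; [exact: ltW|exact: hu].
      by apply: leF; [exact: ltW|exact: hw].
    + move=> n; apply/measurable_EFinP; apply: mG => // x /=.
      rewrite !in_itv/= andbT => /andP[+ _]; apply: lt_le_trans; exact: F0.
    + move=> n x /=; rewrite in_itv/= => /andP[a _]; rewrite lee_fin.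
      by apply: G0; apply: lt_le_trans a; exact: F0.
  - by move=> n; exact: F0.
  - rewrite (_ : 0 = F 0); last by rewrite /F expr0n mul0r.
    exact: (@cvg_comp _ _ _ u F _ _ _ cu (cF 0)).
  - apply/cvgryPge => A; move/cvgryPge : cw => /(_ (`|A| + 1)).
    apply: filterS => n wn; rewrite /= /F; have A0 := normr_ge0 A.
    have := ler_norm A; nra.
have C2 : (\int[leb]_(r in `[u n, w n]) (G (F r) * r)%:E @[n --> \oo] -->
    \int[leb]_(r in `]0%R, +oo[) (G (F r) * r)%:E)%E.
  rewrite -(bigcup_itvcc_pos (u := u) (w := w))//.
  apply: ge0_nondecreasing_set_cvg_integral => //.
  + exact: nd.
  + move=> n; apply/measurable_EFinP; apply: mG => [t t0|x /=].
      apply: cvgM; last exact: cvg_id.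
      by apply: continuous_comp; [exact: cF|apply: cG; exact: F0].
    by rewrite !in_itv/= andbT => /andP[+ _]; exact: lt_le_trans.
  + move=> n x /=; rewrite in_itv/= => /andP[a _]; rewrite lee_fin.
    have x0 : 0 < x by exact: lt_le_trans a.
    by rewrite mulr_ge0 ?(ltW x0)// G0// F0.
by move: C1; under eq_fun do rewrite E; move=> C1; exact: cvg_unique C1 C2.
Qed.

(** This ties the Gamma function in the constant of [chi_density] to the radial mass of the
    Gaussian. *)
Lemma integral_gamma_kernel m : (0 < m)%N ->
  (\int[leb]_(t in `]0%R, +oo[) (t `^ (m%:R / 2 - 1) * expR (- t))%:E =
   (2 `^ (1 - m%:R / 2))%:E *
   \int[leb]_(r in `]0%R, +oo[) (r ^+ m.-1 * expR (- (r ^+ 2 / 2)))%:E)%E.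
Proof.
move=> m0; pose G (t : R) := t `^ (m%:R / 2 - 1) * expR (- t).
rewrite (@ge0_integral_half_sqr G)//; last 2 first.
- move=> t t0; apply: cvgM; last first.
    by apply: continuous_comp; [exact: opp_continuous|exact: continuous_expR].
  have /derivable1_diffP/differentiable_continuous : derivable
      (@powR R ^~ (m%:R / 2 - 1)) t 1 by apply: derivable_powR; rewrite in_itv/= andbT.
  exact.
- by move=> t t0; rewrite mulr_ge0// ?powR_ge0// expR_ge0.
have mf : measurable_fun (`]0%R, +oo[%classic : set (measurableTypeR R))
    (fun r : measurableTypeR R => ((r : R) ^+ m.-1 * expR (- ((r : R) ^+ 2 / 2)))%:E).
  apply/measurable_EFinP; apply: measurable_funTS; apply: measurable_funM.
    exact: exprn_measurable.
  apply: measurableT_comp => //; apply: measurable_funN; apply: measurable_funM => //.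
apply: etrans; last apply: (ge0_integralZl _ _ mf) => //; last first.
- by move=> r /=; rewrite in_itv/= andbT => r0; rewrite lee_fin mulr_ge0 ?expR_ge0// exprn_ge0// ltW.
apply: eq_integral => r; rewrite inE/= in_itv/= andbT => r0.
rewrite -EFinM; congr EFin; rewrite /G.
have r2 : (r ^+ 2 / 2) `^ (m%:R / 2 - 1) * r = 2 `^ (1 - m%:R / 2) * r ^+ m.-1.
  rewrite powRM ?sqr_ge0 ?invr_ge0// mulrAC [RHS]mulrC; congr (_ * _).
    rewrite -powR_mulrn ?(ltW r0)// -powRrM -{2}(powRr1 (ltW r0)) -powRD; last first.
      by rewrite (gt_eqF r0) implybT.
    rewrite -powR_mulrn ?(ltW r0)//; congr powR.
    by rewrite -subn1 natrB//; field.
  by rewrite -powR_inv1// -powRrM; congr powR; field.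
by rewrite mulrA -r2; ring.
Qed.

End gamma.

Section chi_law.
Context {R : realType} (m : nat) (m0 : (0 < m)%N).
Notation leb := (@lebesgue_measure R).
Notation lam := (lebesgue_rV R m).
Notation zeta := (uniform_sphere R m).
Let kappa := fine (lam (@unit_ball R m)).

Let w (r : R) := r ^+ m.-1 * expR (- (r ^+ 2 / 2)).
Let I := (\int[leb]_(r in `]0%R, +oo[) (w r)%:E)%E.

Lemma ray_integral_gaussian (S : set 'rV[R]_m) (v : 'rV[R]_m) : norm2 v = 1 ->
  (ray_integral (fun y => (\1_S y * gaussian y)%:E) v =
   \int[leb]_(r in `]0%R, +oo[) (\1_S ((r : R) *: v) * w r)%:E)%E.
Proof.
move=> v1; rewrite /ray_integral [RHS]integral_mkcond; apply: eq_integral => r _.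
rewrite patchE mem_setE in_itv/= andbT; case: ifPn => // r0.
rewrite -EFinM /gaussian norm2Z v1 mulr1 real_normK ?num_real// /w.
by congr EFin; ring.
Qed.

(** Polar coordinates applied to the Gaussian itself. The identity eliminates the volume [kappa] of
    the ball, which is never computed. *)
Lemma kappa_chi_mass : ((kappa * m%:R)%:E * I = (Num.sqrt (2 * pi) ^+ m)%:E)%E.
Proof.
rewrite -integral_gaussian (ge0_polar m0); last 2 first.
- by apply/measurable_EFinP; exact: measurable_gaussian.
- by move=> y; rewrite lee_fin expR_ge0.
congr (_ * _)%E.
have -> : (fun y : 'rV[R]_m => (gaussian y)%:E) = (fun y => (\1_[set: 'rV[R]_m] y * gaussian y)%:E).
  by apply/funext => y; rewrite indicT mul1r.
transitivity (\int[zeta]_v I)%E.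
  rewrite integral_cst//; transitivity (I * 1)%E; first by rewrite mule1.
  by congr (_ * _)%E; apply/esym; exact: (@probability_setT _ _ _ zeta).
apply: ae_eq_integral => //.
- apply: measurable_ray_integral.
    apply/measurable_EFinP; apply: measurable_funM; last exact: measurable_gaussian.
    exact: measurable_indic.
  by move=> y; rewrite lee_fin mulr_ge0// expR_ge0.
- apply: filterS (uniform_sphere_ae m0) => v v1 _.
  rewrite ray_integral_gaussian//; apply: eq_integral => r _.
  by rewrite indicT mul1r.
Qed.

Lemma chi_mass_fin : I = (fine I)%:E.
Proof.
have K0 : 0 < kappa * m%:R by rewrite mulr_gt0 ?kappa_gt0// ltr0n.
have I0 : (0 <= I)%E.
  apply: integral_ge0 => r /=; rewrite in_itv/= andbT => r0.
  by rewrite lee_fin mulr_ge0 ?expR_ge0// exprn_ge0// ltW.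
rewrite fineK// ge0_fin_numE//.
have := kappa_chi_mass; case: I I0 => [r| |]//; first by rewrite ltry.
by rewrite gt0_muley// lte_fin.
Qed.

Lemma chi_densityE (r : R) : chi_density m r = (fine I)^-1 * w r.
Proof.
rewrite /chi_density -mulrA; congr (_^-1 * _).
rewrite /Gamma /Rintegral integral_gamma_kernel// -/I chi_mass_fin -EFinM/= mulrA.
rewrite -powRD ?pnatr_eq0 ?implybT// (_ : _ - 1 + _ = 0) ?powRr0 ?mul1r//.
by ring.
Qed.

Lemma chi_const : (fine I)^-1 * Num.sqrt (2 * pi) ^+ m = kappa * m%:R.
Proof.
have := kappa_chi_mass; rewrite chi_mass_fin -EFinM => -[H].
have K0 : 0 < kappa * m%:R by rewrite mulr_gt0 ?kappa_gt0// ltr0n.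
have I0 : fine I != 0.
  apply/eqP => I0; move: H; rewrite I0 mulr0 => /eqP; rewrite eq_sym gt_eqF//.
  by rewrite exprn_gt0// sqrtr_gt0 mulr_gt0// pi_gt0.
by rewrite -H; field.
Qed.

Lemma chi_density_ge0 (r : R) : 0 <= r -> 0 <= chi_density m r.
Proof.
move=> r0; rewrite chi_densityE mulr_ge0//.
  by rewrite invr_ge0 fine_ge0//; apply: integral_ge0 => s /=;
    rewrite in_itv/= andbT => s0; rewrite lee_fin mulr_ge0 ?expR_ge0// exprn_ge0// ltW.
by rewrite mulr_ge0 ?expR_ge0// exprn_ge0.
Qed.

Lemma measurable_chi_density : measurable_fun [set: measurableTypeR R]
  (fun r : measurableTypeR R => chi_density m (r : R)).
Proof.
apply: measurable_funM; first by apply: measurable_funM => //; exact: exprn_measurable.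
by apply: measurableT_comp => //; apply: measurable_funN; apply: measurable_funM.
Qed.

Lemma integral_chi_pos (A : set R) : measurable (A : set (measurableTypeR R)) ->
  (\int[leb]_(r in [set r : R | (0 <= r)%R /\ A r]) (chi_density m (r : R))%:E =
   (fine I)^-1%:E * \int[leb]_(r in `]0%R, +oo[) (\1_A r * w r)%:E)%E.
Proof.
move=> mA.
have mw : measurable_fun (`]0%R, +oo[%classic : set (measurableTypeR R))
    (fun r : measurableTypeR R => (\1_A r * w r)%:E).
  apply: measurable_funTS; apply/measurable_EFinP; apply: measurable_funM.
    exact: measurable_indic.
  apply: measurable_funM; first exact: exprn_measurable.
  by apply: measurableT_comp => //; apply: measurable_funN; apply: measurable_funM.
have I0 : 0 <= (fine I)^-1.
  by rewrite invr_ge0 fine_ge0//; apply: integral_ge0 => s /=;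
    rewrite in_itv/= andbT => s0; rewrite lee_fin mulr_ge0 ?expR_ge0// exprn_ge0// ltW.
apply: etrans; last apply: (ge0_integralZl _ _ mw) => //; last first.
- move=> r /=; rewrite in_itv/= andbT => r0.
  by rewrite lee_fin !mulr_ge0 ?expR_ge0// exprn_ge0// ltW.
rewrite [LHS]integral_mkcond [RHS]integral_mkcond; apply: ge0_ae_eq_integral => //.
- apply/(measurable_restrictT _ _).1.
    rewrite (_ : [set _ | _] = `[0%R, +oo[%classic `&` A); last first.
      by apply/seteqP; split => r /=; rewrite in_itv/= andbT.
    by apply: measurableI.
  by apply: measurable_funTS; apply/measurable_EFinP; exact: measurable_chi_density.
- by apply/(measurable_restrictT _ _).1 => //; exact: measurable_funeM.
- by move=> r _; apply: erestrict_ge0 => s [s0 _]; rewrite lee_fin chi_density_ge0.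
- move=> r _; apply: erestrict_ge0 => s; rewrite /= in_itv/= andbT => s0.
  by rewrite -EFinM lee_fin !mulr_ge0 ?expR_ge0// exprn_ge0// ltW.
(* One domain contains the radius 0, the other does not; a single point is negligible. *)
- exists [set 0]; split => //.
    exact: lebesgue_measure_set1.
  move=> r /=; apply: contra_notP => r0 _; rewrite !patchE.
  rewrite mem_setE in_itv/= andbT lt_neqAle eq_sym.
  have -> /= : r != 0 by apply/eqP => r00; apply: r0.
  have [r1|r1] := boolP (0 <= r); last first.
    by rewrite memNset// => -[] /= /negPf; rewrite (negPf r1).
  rewrite indicE -EFinM; have [rA|rA] := boolP (r \in A).
    by rewrite mem_set/= ?mul1r ?chi_densityE//; move: rA; rewrite inE.
  rewrite memNset/= ?mul0r ?mulr0// => -[_ Ar].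
  by move: rA; rewrite notin_setE.
Qed.

(** Tonelli's theorem for the joint set [D] gives measurability in the parameter. It serves for the
    direction alone here, and later for the sample pair [(v, c)]. *)
Lemma measurable_chi_section d (T : measurableType d) (D : set (T * measurableTypeR R)) :
  measurable D -> measurable_fun setT (fun t =>
    \int[leb]_(r in [set r : R | (0 <= r)%R /\ D (t, r)]) (chi_density m (r : R))%:E)%E.
Proof.
move=> mD.
pose F (tr : T * measurableTypeR R) : \bar R :=
  (if ((0 : R) <= tr.2)%R then (\1_D tr * chi_density m (tr.2 : R))%:E else 0)%E.
have mF : measurable_fun setT F.
  apply: measurable_if_pos.
    by apply: measurable_fun_ler => //; exact: measurable_snd.
  apply/measurable_EFinP; apply: measurable_funM; first exact: measurable_indic.
  exact: (measurableT_comp measurable_chi_density measurable_snd).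
have F0 tr : (0 <= F tr)%E.
  by rewrite /F; case: ifPn => // r0; rewrite lee_fin mulr_ge0// chi_density_ge0.
have := measurable_fun_fubini_tonelli_F (m2 := leb) _ mF F0.
apply: eq_measurable_fun => t _; rewrite [RHS]integral_mkcond.
apply: eq_integral => r _; rewrite patchE /F/= indicE.
case: (boolP (0 <= r)) => [r0|/negP r0]; last by rewrite memNset// => -[].
have [rD|rD] := boolP ((t, r) \in D).
  by rewrite mul1r mem_set//; split => //; move: rD; rewrite inE.
by rewrite mul0r memNset// => -[_ Ar]; move: rD; rewrite notin_setE.
Qed.

Lemma sqrtr_exp (x : R) k : 0 <= x -> Num.sqrt (x ^+ k) = Num.sqrt x ^+ k.
Proof.
by move=> x0; elim: k => [|k IH]; rewrite ?expr0 ?sqrtr1// !exprS sqrtrM// IH.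
Qed.

Lemma cholesky_det_gt0 (S L : 'M[R]_m) : cholesky_factor S L -> 0 < \det L.
Proof. by move=> [tL L0 _]; rewrite det_trig// prodr_gt0. Qed.

(** [L^T S^(-1) L = 1] reduces the quadratic form to the squared norm, and [det S] is the square of
    [det L], so the Jacobian cancels the determinant. *)
Lemma gauss_density_cholesky (z y : 'rV[R]_m) (S L : 'M[R]_m) : cholesky_factor S L ->
  \det L * gauss_density z S (y *m L^T + z) = (Num.sqrt (2 * pi) ^+ m)^-1 * gaussian y.
Proof.
move=> SL; have dL := cholesky_det_gt0 SL; case: SL => tL L0 SE.
have uL : L \in unitmx by rewrite unitmxE unitfE gt_eqF.
have uLT : L^T \in unitmx by rewrite unitmx_tr.
have uS : S \in unitmx by rewrite -SE unitmx_mul uL.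
have LSL : L^T *m invmx S *m L = 1%:M.
  apply: (can_inj (mulmxK uLT)); rewrite mul1mx -!mulmxA SE mulVmx//.
  by rewrite mulmx1.
rewrite /gauss_density addrK trmx_mul trmxK.
have -> : y *m L^T *m invmx S *m (L *m y^T) = y *m y^T.
  by rewrite !mulmxA -(mulmxA y) -(mulmxA y) LSL mulmx1.
have -> : (y *m y^T) 0 0 = norm2 y ^+ 2.
  by rewrite norm2_sqr mxE; apply: eq_bigr => i _; rewrite mxE expr2.
rewrite -SE det_mulmx det_tr -expr2 sqrtrM ?exprn_ge0 ?mulr_ge0 ?pi_ge0//.
rewrite sqrtr_sqr gtr0_norm// sqrtr_exp ?mulr_ge0 ?pi_ge0//.
rewrite (_ : expR _ = gaussian y); last by congr expR; ring.
have p0 : Num.sqrt (2 * pi) ^+ m != 0 :> R.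
  by rewrite gt_eqF// exprn_gt0// sqrtr_gt0 mulr_gt0// pi_gt0.
by field; rewrite p0 gt_eqF.
Qed.

(** The affine map carries the standard Gaussian to the given one, and the radius of a standard
    Gaussian has the chi law, independently of its direction. *)
Lemma gauss_density_polar (z : 'rV[R]_m) (S L : 'M[R]_m) (A : set 'rV[R]_m) :
  cholesky_factor S L -> measurable A ->
  (\int[lam]_(y in A) (gauss_density z S y)%:E =
   \int[zeta]_v \int[leb]_(r in [set r : R | (0 <= r)%R /\ A (r *: (v *m L^T) + z)%R])
     (chi_density m (r : R))%:E)%E.
Proof.
move=> SL mA; have dL := cholesky_det_gt0 SL.
pose B := (fun w : 'rV[R]_m => w *m L^T + z) @^-1` A.
have mLz : measurable_fun setT (fun w : 'rV[R]_m => w *m L^T + z).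
  exact: (measurableT_comp (measurable_addmxr z) (measurable_mulmxr _)).
have mB : measurable B by rewrite -[B]setTI; exact: mLz.
have mgd : measurable_fun setT (gauss_density z S).
  apply: measurable_funM => //; apply: measurableT_comp => //.
  apply: measurable_funM => //.
  under eq_fun do rewrite mxE.
  apply: measurable_sum => k; apply: measurable_funM.
    apply: (measurableT_comp (@measurable_mx_coord R 1 m 0 k)).
    exact: (measurableT_comp (measurable_mulmxr _) (measurable_addmxr (- z))).
  under eq_fun do rewrite mxE.
  exact: (measurableT_comp (@measurable_mx_coord R 1 m 0 k) (measurable_addmxr (- z))).
have gd0 y : 0 <= gauss_density z S y by rewrite mulr_ge0 ?expR_ge0// invr_ge0 sqrtr_ge0.
have mf : measurable_fun setT (fun y => (\1_A y * gauss_density z S y)%:E).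
  by apply/measurable_EFinP; apply: measurable_funM => //; exact: measurable_indic.
have mh : measurable_fun setT (fun y => (\1_B y * gaussian y)%:E).
  apply/measurable_EFinP; apply: measurable_funM; first exact: measurable_indic.
  exact: measurable_gaussian.
have h0 y : (0 <= (\1_B y * gaussian y)%:E)%E by rewrite lee_fin mulr_ge0// expR_ge0.
transitivity (\int[lam]_y (\1_A y * gauss_density z S y)%:E)%E.
  rewrite integral_mkcond; apply: eq_integral => y _.
  by rewrite patchE indicE; case: ifPn => _; rewrite ?mul1r ?mul0r.
case: (SL) => tL L0 _.
rewrite (ge0_integral_trig_affine tL L0 z mf); last first.
  by move=> y; rewrite lee_fin mulr_ge0.
have mf' := measurableT_comp mf mLz.
rewrite -(ge0_integralZl _ _ mf') ?lee_fin ?ltW//=; last first.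
  by move=> y _; rewrite lee_fin mulr_ge0.
transitivity (\int[lam]_w (((Num.sqrt (2 * pi) ^+ m)^-1)%:E * (\1_B w * gaussian w)%:E))%E.
  apply: eq_integral => y _; rewrite -!EFinM mulrCA gauss_density_cholesky//.
  by rewrite (mulrCA (\1_A _)).
have c0 : (0 <= ((Num.sqrt (2 * pi : R) ^+ m)^-1)%:E)%E.
  by rewrite lee_fin invr_ge0 exprn_ge0// sqrtr_ge0.
rewrite (ge0_integralZl lam measurableT mh (fun y _ => h0 y) c0).
rewrite (ge0_polar m0 mh)// muleA -EFinM.
(* The Gaussian normalization times the polar constant [kappa * m] is the inverse of the radial
   mass, which is the chi normalization. *)
rewrite (_ : _ * _ = (fine I)^-1); last first.
  rewrite -chi_const mulrCA mulVf ?mulr1//.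
  by rewrite gt_eqF// exprn_gt0// sqrtr_gt0 mulr_gt0// pi_gt0.
have I0 : 0 <= (fine I)^-1.
  by rewrite invr_ge0 fine_ge0//; apply: integral_ge0 => s /=;
    rewrite in_itv/= andbT => s0; rewrite lee_fin mulr_ge0 ?expR_ge0// exprn_ge0// ltW.
have mri := measurable_ray_integral mh h0.
rewrite -(ge0_integralZl zeta measurableT mri); last 2 first.
- by move=> v _; exact: ray_integral_ge0.
- by rewrite lee_fin.
apply: ge0_ae_eq_integral => //.
- exact: measurable_funeM.
- apply: (@measurable_chi_section _ _ [set vr | A ((vr.2 : R) *: (vr.1 *m L^T) + z)]).
  rewrite -[X in measurable X]setTI.
  apply: (measurableT_comp (measurable_addmxr z)) => //.
  apply: (measurableT_comp (@measurable_scale_rV R m) (g := fun vr : 'rV[R]_m * measurableTypeR R => (vr.1 *m L^T, vr.2))).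
  apply/measurable_fun_pairP; split => /=.
    exact: (measurableT_comp (measurable_mulmxr _) measurable_fst).
  exact: measurable_snd.
- by move=> v _; rewrite mule_ge0 ?lee_fin//; exact: ray_integral_ge0.
- by move=> v _; apply: integral_ge0 => r [r0 _]; rewrite lee_fin chi_density_ge0.
- apply: filterS (uniform_sphere_ae m0) => v v1 _.
  rewrite ray_integral_gaussian//.
  have mBv : measurable ((fun r : measurableTypeR R => (r : R) *: v) @^-1` B).
    rewrite -[X in measurable X]setTI.
    have mv : measurable_fun setT (fun r : measurableTypeR R => (r : R) *: v).
      apply: measurable_fun_mx => i j; under eq_fun do rewrite mxE.
      exact: measurable_funM.
    exact: mv.
  rewrite -(integral_chi_pos mBv).
  congr (integral _ _ _); apply/seteqP; split => r /= [r0];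
    by rewrite /B/= scalemxAl.
Qed.

End chi_law.

(** * Differential calculus *)

Section differential.
Context {R : realType}.

Definition dotr n (D h : 'rV[R]_n) : R := \sum_(i < n) h 0 i * D 0 i.

Fact dotr_is_linear n (D : 'rV[R]_n) : linear (dotr D).
Proof.
move=> a u w; rewrite /dotr scaler_sumr -big_split/=; apply: eq_bigr => i _.
by rewrite !mxE mulrDl -mulrA.
Qed.

HB.instance Definition _ n (D : 'rV[R]_n) :=
  GRing.isLinear.Build R 'rV[R]_n R _ (dotr D) (dotr_is_linear D).

Lemma continuous_dotr n (D : 'rV[R]_n) : continuous (dotr D).
Proof.
apply: continuous_big => [|i _ h]; first exact: add_continuous.
apply: (@cvgM _ _ _ _ (fun h : 'rV[R]_n => h 0 i) (fun=> D 0 i) (h 0 i) (D 0 i)).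
- exact: nbhs_filter.
- exact: (@coord_continuous R 1 n 0 i h).
- by apply: cvg_cst; exact: nbhs_filter.
Qed.

Lemma differentiable_dotr n (f : 'rV[R]_n -> R) (x D : 'rV[R]_n) :
  (forall e : R, 0 < e -> \forall y \near x,
     `|f y - f x - dotr D (y - x)| <= e * `|y - x|) ->
  differentiable f x /\ 'd f x = dotr D :> ('rV[R]_n -> R).
Proof.
move=> H.
have H0 (e : R) : 0 < e -> \forall h \near (0 : 'rV[R]_n),
    `|f (h + x) - (f x + dotr D h)| <= e * `|h|.
  move=> e0; have := H e e0; rewrite (near_shift 0 x) subr0.
  by apply: filterS => h /=; rewrite addrK opprD addrA.
have dE : 'd f x = dotr D :> ('rV[R]_n -> R).
  apply: (@diff_unique R 'rV[R]_n R f (dotr D)); first exact: continuous_dotr.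
  by apply/eqaddoP => e e0; exact: H0.
split => //; apply/diff_locallyP; rewrite dE; split; first exact: continuous_dotr.
by apply/eqaddoP => e e0; exact: H0.
Qed.

Lemma gradient_dotr n (f : 'rV[R]_n -> R) (x D : 'rV[R]_n) :
  (forall e : R, 0 < e -> \forall y \near x,
     `|f y - f x - dotr D (y - x)| <= e * `|y - x|) ->
  gradient f x = D.
Proof.
move=> /differentiable_dotr[df dE]; rewrite /gradient asboolT//.
apply/rowP => i; rewrite mxE dE /dotr (bigD1 i)//= mxE !eqxx mul1r big1 ?addr0//.
by move=> j ji; rewrite mxE (negPf ji) andbF mul0r.
Qed.

Lemma is_derive_line (V : normedModType R) (f : V -> R) (p w : V) (t : R) :
  differentiable f (p + t *: w) ->
  is_derive t 1 (fun t => f (p + t *: w)) ('d f (p + t *: w) w).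
Proof.
move=> df; have E : (fun h : R => h^-1 *: (((fun t : R => f (p + t *: w)) \o shift t) (h *: 1)
    - f (p + t *: w))) =
  (fun h : R => h^-1 *: ((f \o shift (p + t *: w)) (h *: w) - f (p + t *: w))).
  apply/funext => h /=; congr (_ *: (f _ - _)).
  by rewrite [h *: 1]mulr1 scalerDl addrCA.
apply: DeriveDef.
  by rewrite /derivable E; exact: diff_derivable.
by rewrite /derive E -deriveE.
Qed.

Lemma mvt_line (V : normedModType R) (f : V -> R) (p w : V) :
  (forall q, differentiable f q) ->
  exists2 t : R, 0 <= t <= 1 & f (p + w) - f p = 'd f (p + t *: w) w.
Proof.
move=> df; have dl t := is_derive_line (df (p + t *: w)).
have cl : {within `[0, 1], continuous (fun t : R => f (p + t *: w))}.
  apply: continuous_subspaceT => t; apply: differentiable_continuous.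
  by apply/derivable1_diffP; have ? := dl t; exact: ex_derive.
have [t t01] := @MVT_segment R _ _ 0 1 ler01 (fun t _ => dl t) cl.
by rewrite scale1r scale0r addr0 subr0 mulr1 => ?; exists t.
Qed.

End differential.

(** * The chi distribution function *)

Section chi_cdf.
Context {R : realType} (m : nat) (m0 : (0 < m)%N).
Notation leb := (@lebesgue_measure R).
Notation chi := (@chi_density R m).

Lemma continuous_chi : continuous (chi : R -> R).
Proof.
move=> r; apply: cvgM.
  by apply: cvgM; [exact: cvg_cst|exact: exprn_continuous].
apply: (@continuous_comp _ _ _ (fun r : R => - (r ^+ 2 / 2)) expR); last exact: continuous_expR.
by apply: cvgN; apply: cvgM; [exact: exprn_continuous|exact: cvg_cst].
Qed.

Lemma integral_chi : (\int[leb]_(r in `[0%R, +oo[) (chi (r : R))%:E = 1)%E.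
Proof.
transitivity (\int[leb]_(r in [set r : R | (0 <= r)%R /\ [set: R] r]) (chi (r : R))%:E)%E.
  by congr (integral _ _ _); apply/seteqP; split => r /=; rewrite in_itv/= andbT => // -[].
rewrite (integral_chi_pos m0 measurableT).
under [X in (_ * X)%E]eq_integral do rewrite indicT mul1r.
rewrite (chi_mass_fin m0) -EFinM mulVf//.
apply/eqP => /= I0; have := @chi_const R m m0; rewrite I0 invr0 mul0r => /eqP.
by rewrite eq_sym gt_eqF// mulr_gt0 ?ltr0n//; exact: kappa_gt0.
Qed.

Lemma integrable_chi (A : set (measurableTypeR R)) : measurable A -> A `<=` `[0%R, +oo[ ->
  leb.-integrable A (EFin \o (chi : R -> R)).
Proof.
move=> mA sA; apply: (@integrableS _ _ _ leb (`[0%R, +oo[%classic : set (measurableTypeR R))) => //.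
apply/integrableP; split.
  by apply: measurable_funTS; apply/measurable_EFinP; exact: measurable_chi_density.
rewrite (_ : (\int[leb]_(x in _) _)%E = 1%E) ?ltry// -integral_chi.
apply: eq_integral => r; rewrite inE/= in_itv/= andbT => r0.
by rewrite ger0_norm// chi_density_ge0.
Qed.

Definition chi_cdf (r : R) : R := \int[leb]_(s in `[0, r]) chi s.

Lemma chi_cdf_mvt (r r' : R) : 0 < r -> r <= r' ->
  exists2 s : R, r <= s <= r' & chi_cdf r' - chi_cdf r = chi s * (r' - r).
Proof.
move=> r0 rr'.
have dF (x : R) : 0 < x -> is_derive x 1 chi_cdf (chi x).
  move=> x0; have ii : leb.-integrable `[0, x + 1] (EFin \o (chi : R -> R)).
    by apply: integrable_chi => // s /=; rewrite !in_itv/= => /andP[->].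
  have x1 : x < x + 1 by rewrite ltrDl.
  have [d1 d2] := continuous_FTC1_closed x1 ii x0 (@continuous_chi x).
  by apply: DeriveDef; [exact: d1|rewrite -derive1E; exact: d2].
have cF : {within `[r, r'], continuous chi_cdf}.
  apply: continuous_in_subspaceT => x; rewrite inE/= in_itv/= => /andP[rx _].
  apply: differentiable_continuous; apply/derivable1_diffP.
  by have ? := dF x (lt_le_trans r0 rx); exact: ex_derive.
have [|s] := @MVT_segment R chi_cdf (chi : R -> R) r r' rr' _ cF.
  by move=> x; rewrite in_itv/= => /andP[rx _]; apply: dF; exact: lt_trans rx.
by rewrite in_itv/=; exists s.
Qed.

Lemma chi_cdf_le1 (r : R) : chi_cdf r <= 1.
Proof.
rewrite -lee_fin fineK; last first.
  by apply: integral_fune_fin_num => //; apply: integrable_chi => // s /=;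
    rewrite !in_itv/= => /andP[->].
rewrite -integral_chi; apply: ge0_subset_integral => //.
- by apply: measurable_funTS; apply/measurable_EFinP; exact: measurable_chi_density.
- by move=> x /=; rewrite in_itv/= andbT => x0; rewrite lee_fin chi_density_ge0.
- by move=> s /=; rewrite !in_itv/= => /andP[->].
Qed.

(** Every exponential rate is reached: the power of [s] costs at most the rate [m - 1], and
    completing the square shows that the Gaussian factor beats any linear exponent. *)
Lemma chi_le_exp (b : R) : exists2 K : R, 0 < K &
  forall s, 0 <= s -> chi s <= K * expR (- (b * s)).
Proof.
pose A := (2 `^ (m%:R / 2 - 1) * Gamma (m%:R / 2))^-1 : R.
(* The rate [b] asked for, plus the rate spent on [s ^+ m.-1]. In the constant below, the modulus of
   [A] and the extra 1 give positivity whatever the sign of [A]. *)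
pose c : R := b + m.-1%:R.
exists (`|A| * expR (c ^+ 2 / 2) + 1).
  by rewrite ltr_wpDl// mulr_ge0// expR_ge0.
move=> s s0; rewrite /chi_density -/A.
have se : s ^+ m.-1 <= expR (m.-1%:R * s).
  rewrite expRM_natl lerXn2r ?nnegrE ?expR_ge0//.
  by apply: le_trans (expR_ge1Dx s); rewrite lerDr.
have ee : expR (- (s ^+ 2 / 2)) <= expR (c ^+ 2 / 2) * expR (- (c * s)).
  rewrite -expRD ler_expR; have := sqr_ge0 (s - c); rewrite sqrrB => h; lra.
have E : expR (m.-1%:R * s) * expR (- (c * s)) = expR (- (b * s)).
  by rewrite -expRD; congr expR; rewrite /c; ring.
apply: (@le_trans _ _ (`|A| * expR (c ^+ 2 / 2) * expR (- (b * s)))); last first.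
  by rewrite ler_wpM2r ?expR_ge0// lerDl.
have P0 : 0 <= s ^+ m.-1 * expR (- (s ^+ 2 / 2)).
  by rewrite mulr_ge0 ?expR_ge0 ?exprn_ge0.
apply: (@le_trans _ _ (`|A| * (s ^+ m.-1 * expR (- (s ^+ 2 / 2))))).
  by rewrite -mulrA; exact: ler_wpM2r P0 _ _ (ler_norm A).
rewrite -E -mulrA ler_wpM2l//.
apply: (@le_trans _ _ (expR (m.-1%:R * s) * (expR (c ^+ 2 / 2) * expR (- (c * s))))).
  by rewrite ler_pM// ?expR_ge0 ?exprn_ge0//.
by rewrite le_eqVlt; apply/orP; left; apply/eqP; ring.
Qed.

Lemma integral_expRN (a : R) :
  (\int[leb]_(s in `[a, +oo[) (expR (- s))%:E = (expR (- a))%:E)%E.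
Proof.
have dF (x : R) : is_derive x 1 (fun s : R => - expR (- s)) (expR (- x)).
  have d := is_deriveN (is_derive1_comp (is_derive_expR (- x)) (is_deriveNid x 1)).
  by apply: is_derive_eq d _; rewrite ?mulrN1 ?opprK//.
transitivity (0%:E - (- expR (- a))%:E)%E; last by rewrite -EFinN opprK add0e.
apply: (@ge0_continuous_FTC2y _ (fun s => expR (- s)) (fun s => - expR (- s)) a 0).
- by move=> x _; exact: expR_ge0.
- apply: continuous_subspaceT => x.
  by apply: continuous_comp; [exact: opp_continuous|exact: continuous_expR].
- rewrite -oppr0; apply: cvgN; exact: cvgr_expR.
- by move=> x ax; have ? := dF x; exact: ex_derive.
- apply: cvg_at_right_filter; apply: cvgN.
  by apply: continuous_comp; [exact: opp_continuous|exact: continuous_expR].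
- by move=> x _; rewrite derive1E; have ? := dF x; exact: derive_val.
Qed.

(** Of the rate [b], one unit is kept to integrate [e^(-s)] over the tail; the remaining factor
    [e^(-(b - 1) s)] is largest at [s = r]. *)
Lemma chi_cdf_tail (b : R) : 1 <= b -> exists2 K : R, 0 < K &
  forall r, 0 <= r -> 1 - chi_cdf r <= K * expR (- (b * r)).
Proof.
move=> b1; have [K K0 chiK] := chi_le_exp b; exists K => // r r0.
pose I0 := (`[0%R, +oo[%classic : set (measurableTypeR R)).
have iI0 : leb.-integrable I0 (EFin \o (chi : R -> R)) by apply: integrable_chi; [exact: measurable_itv|exact: subset_refl].
have -> : 1 - chi_cdf r = \int[leb]_(s in `]r, +oo[) chi s.
  rewrite -(@Rintegral_itvB _ _ (BLeft 0) +oo%O r)//; congr (_ - _).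
  by rewrite /Rintegral integral_chi.
have ie : leb.-integrable (`[r, +oo[%classic : set (measurableTypeR R)) (EFin \o (fun s : R => expR (- s))).
  apply/integrableP; split.
    apply/measurable_EFinP; apply: measurable_funTS; apply: measurableT_comp => //.
  rewrite (eq_integral (fun s : measurableTypeR R => (expR (- (s : R)))%:E)).
    by rewrite integral_expRN ltry.
  by move=> s _; rewrite /= ger0_norm// expR_ge0.
have so : (`]r, +oo[%classic : set R) `<=` `[r, +oo[%classic.
  by move=> s /=; rewrite !in_itv/= !andbT => /ltW.
have s0 : (`]r, +oo[%classic : set R) `<=` `[0, +oo[%classic.
  by move=> s /=; rewrite !in_itv/= !andbT => /ltW; exact: le_trans.
have ie' := @integrableS _ _ _ leb _ _ _ (measurable_itv _) (measurable_itv _) so ie.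
apply: (@le_trans _ _ (\int[leb]_(s in `]r, +oo[) (K * expR (- ((b - 1) * r)) * expR (- s)))).
  apply: le_Rintegral => //.
  - by apply: integrable_chi s0; exact: measurable_itv.
  - rewrite (_ : EFin \o _ = fun s : R => ((K * expR (- ((b - 1) * r)))%:E *
        (EFin \o (fun s : R => expR (- s))) s)%E); last by apply/funext => s; rewrite /= EFinM.
    by apply: integrableZl => //; exact: measurable_itv.
  - move=> s /=; rewrite in_itv/= andbT => rs.
    apply: le_trans (chiK s _) _; first by rewrite (le_trans r0)// ltW.
    rewrite -mulrA ler_wpM2l ?(ltW K0)// -expRD ler_expR; nra.
rewrite RintegralZl// -mulrA ler_wpM2l ?(ltW K0)//.
rewrite [leRHS](_ : _ = expR (- ((b - 1) * r)) * expR (- r)); last first.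
  by rewrite -expRD; congr expR; ring.
rewrite ler_wpM2l ?expR_ge0// -lee_fin fineK; last exact: integral_fune_fin_num.
rewrite -integral_expRN; apply: ge0_subset_integral => //.
- by case/integrableP : ie.
Qed.

End chi_cdf.

(** * Roots along rays *)

Section rays.
Context {R : realType} (n m : nat) (m0 : (0 < m)%N).
Notation leb := (@lebesgue_measure R).
Notation chi := (@chi_density R m).
Variable g : 'rV[R]_n * 'rV[R]_m -> R.
Hypothesis g_diff : forall p, differentiable g p.
Hypothesis g_convex : forall x,
  convex_function [set: convex_lmodType 'rV[R]_m] (fun y => g (x, y)).

Implicit Types (x : 'rV[R]_n) (t : 'rV[R]_m * 'rV[R]_m) (r s gamma : R).

Definition ray_value x t r : R := g (x, r *: t.1 + t.2).

Definition radial_value x t : R :=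
  \int[leb]_(r in [set r : R | 0 <= r /\ ray_value x t r <= 0]) chi r.

Definition is_root x t r := 0 < r /\ ray_value x t r = 0.

Lemma ray_value0 x t : ray_value x t 0 = g (x, t.2).
Proof. by rewrite /ray_value scale0r add0r. Qed.

Lemma ray_value_convex x t (l r s : R) : 0 <= l <= 1 ->
  ray_value x t (l * r + (1 - l) * s) <=
  l * ray_value x t r + (1 - l) * ray_value x t s.
Proof.
move=> l01; have [l0 l1] := andP l01.
have := @g_convex x (Itv01 l0 l1) (r *: t.1 + t.2) (s *: t.1 + t.2).
rewrite !inE => /(_ I I); apply: le_trans.
rewrite le_eqVlt; apply/orP; left; apply/eqP; congr (g (x, _)).
rewrite /conv/= !scalerDr !scalerA addrACA -!scalerDl.
by rewrite unstable.add_onemK scale1r.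
Qed.

Lemma is_derive_ray_value x t r :
  is_derive r 1 (ray_value x t) ('d g (x, r *: t.1 + t.2) (0, t.1)).
Proof.
have E (s : R) : (x, s *: t.1 + t.2) = (x, t.2) + s *: (0, t.1) :> ('rV[R]_n * 'rV[R]_m).
  by rewrite -[RHS]/(x + s *: 0, t.2 + s *: t.1) scaler0 addr0 addrC.
rewrite (_ : ray_value x t = fun s => g ((x, t.2) + s *: (0, t.1))); last first.
  by apply/funext => s; rewrite /ray_value E.
by rewrite E; exact: is_derive_line.
Qed.

Lemma continuous_ray_value x t : continuous (ray_value x t).
Proof.
move=> r; apply: differentiable_continuous; apply/derivable1_diffP.
by have ? := is_derive_ray_value x t r; exact: ex_derive.
Qed.

Section root.
Variables (x : 'rV[R]_n) (t : 'rV[R]_m * 'rV[R]_m) (gamma : R).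
Hypotheses (gamma0 : 0 < gamma) (ray0 : g (x, t.2) <= - gamma).

(** Convexity at [r], between 0 and [s]: beyond its root the ray value stays above the chord from 0
    to [r], whose slope is at least [gamma / r]. *)
Lemma ray_value_gt_root r s : is_root x t r -> r <= s ->
  gamma * (s - r) / r <= ray_value x t s.
Proof.
move=> [r0 rr0] rs; have s0 : 0 < s := lt_le_trans r0 rs.
have l01 : 0 <= r / s <= 1 by rewrite divr_ge0 ?(ltW r0) ?(ltW s0)//= ler_pdivrMr// mul1r.
have := ray_value_convex x t s 0 l01.
rewrite mulr0 addr0 divfK ?gt_eqF// rr0 ray_value0 => h.
have l1 : 0 <= 1 - r / s by have /andP[_] := l01; rewrite subr_ge0.
have {}h : (1 - r / s) * gamma <= r / s * ray_value x t s.
  have := ler_wpM2l l1 ray0; rewrite mulrN; lra.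
have -> : gamma * (s - r) / r = (1 - r / s) * gamma * (s / r).
  by field; rewrite !gt_eqF.
have -> : ray_value x t s = r / s * ray_value x t s * (s / r).
  by field; rewrite !gt_eqF.
by rewrite ler_wpM2r// divr_ge0 ?(ltW r0) ?(ltW s0).
Qed.

Lemma ray_value_lt_root r s : is_root x t r -> 0 <= s -> s < r -> ray_value x t s < 0.
Proof.
move=> [r0 rr0] s0 sr.
have l01 : 0 <= s / r <= 1 by rewrite divr_ge0 ?(ltW r0)//= ler_pdivrMr// mul1r ltW.
have := ray_value_convex x t r 0 l01.
rewrite mulr0 addr0 divfK ?gt_eqF// rr0 mulr0 add0r ray_value0 => h.
apply: le_lt_trans h _; rewrite pmulr_rlt0; first by rewrite (le_lt_trans ray0)// oppr_lt0.
by rewrite subr_gt0 ltr_pdivrMr// mul1r.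
Qed.

Lemma ray_value_le0_root r s : is_root x t r -> 0 <= s ->
  (ray_value x t s <= 0) = (s <= r).
Proof.
move=> rt s0; have [r0 rr0] := rt; apply/idP/idP => [h|].
  rewrite leNgt; apply/negP => rs.
  have := ray_value_gt_root rt (ltW rs); apply/negP; rewrite -ltNge.
  by apply: le_lt_trans h _; rewrite divr_gt0// mulr_gt0// subr_gt0.
rewrite le_eqVlt => /predU1P[->|sr]; first by rewrite rr0.
exact/ltW/(ray_value_lt_root rt).
Qed.

Lemma is_root_unique r s : is_root x t r -> is_root x t s -> r = s.
Proof.
move=> rt st; have [r0 rr0] := rt; have [s0 ss0] := st; apply/eqP.
rewrite eq_le -(ray_value_le0_root st (ltW r0)) -(ray_value_le0_root rt (ltW s0)).
by rewrite rr0 ss0 lexx.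
Qed.

Lemma radial_value_root r : is_root x t r -> radial_value x t = chi_cdf m r.
Proof.
move=> rt; rewrite /radial_value /chi_cdf; congr (Rintegral _ _ _).
apply/seteqP; split => s /=; rewrite in_itv/=.
  by move=> [s0]; rewrite (ray_value_le0_root rt s0) s0.
by move=> /andP[s0 sr]; rewrite (ray_value_le0_root rt s0).
Qed.

Lemma exists_root r : 0 <= r -> 0 <= ray_value x t r ->
  exists2 s, is_root x t s & s <= r.
Proof.
move=> r0 rr; have rt0 : ray_value x t 0 < 0.
  by rewrite ray_value0 (le_lt_trans ray0)// oppr_lt0.
have [|s] := @IVT R (ray_value x t) 0 r 0 r0
  (continuous_subspaceT (@continuous_ray_value x t)).
  by rewrite ge_min le_max (ltW rt0) rr orbT.
rewrite in_itv/= => /andP[s0 sr] ss; exists s => //; split => //.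
rewrite lt_neqAle s0 andbT; apply: contraTneq rt0 => s00.
have -> : ray_value x t 0 = 0 by rewrite -[RHS]ss; congr (ray_value x t).
by rewrite ltxx.
Qed.

Lemma noroot_lt0 : (forall r, ~ is_root x t r) -> forall r, 0 <= r -> ray_value x t r < 0.
Proof.
move=> nr r r0; rewrite ltNge; apply/negP => h.
by have [s /nr] := exists_root r0 h.
Qed.

Lemma radial_value_noroot : (forall r, ~ is_root x t r) -> radial_value x t = 1.
Proof.
move=> nr; rewrite /radial_value.
rewrite (_ : [set r | _] = `[0, +oo[%classic); first by rewrite /Rintegral integral_chi.
apply/seteqP; split => s /=; rewrite in_itv/= andbT; first by case.
by move=> s0; split => //; exact/ltW/noroot_lt0.
Qed.

(** Limit of the right difference quotients, which the chord bound keeps above [gamma / r]. This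
    transversality keeps the denominator of the gradient away from 0. *)
Lemma diff_root_ge r : is_root x t r ->
  gamma / r <= 'd g (x, r *: t.1 + t.2) (0, t.1).
Proof.
move=> rt; have [r0 rr0] := rt.
have dr := is_derive_ray_value x t r.
have dd : derivable (ray_value x t) r 1 by exact: ex_derive.
rewrite -[leRHS](@derive_val _ _ _ _ _ _ _ dr).
have /cvg_dnbhs_at_right cv : h^-1 *: ((ray_value x t \o shift r) (h *: 1) - ray_value x t r)
  @[h --> 0^'] --> 'D_1 (ray_value x t) r by exact: dd.
apply: (cvgr_to_ge cv); near=> h.
have h0 : 0 < h by near: h; exact: nbhs_right_gt.
have rhr : r <= h + r by rewrite lerDr ltW.
have := ray_value_gt_root rt rhr; rewrite addrK => hh.
rewrite rr0 subr0 /= [h *: 1]mulr1 [h^-1 *: _]mulrC ler_pdivlMr//.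
by rewrite mulrAC.
Unshelve. all: by end_near. Qed.

End root.

End rays.

Section norms.
Context {R : realType}.

Lemma coord_le_norm n (h : 'rV[R]_n) i : `|h 0 i| <= `|h|.
Proof.
rewrite -[`|h|]/(mx_norm h) mx_normrE.
exact: (le_bigmax _ (fun ij : 'I_1 * 'I_n => `|h ij.1 ij.2|) (0, i)).
Qed.

Lemma norm_le_coord n (h : 'rV[R]_n) (M : R) : 0 <= M ->
  (forall i, `|h 0 i| <= M) -> `|h| <= M.
Proof.
move=> M0 hM; rewrite -[`|h|]/(mx_norm h) mx_normrE; apply: bigmax_le => // -[i j] _ /=.
by rewrite ord1.
Qed.

Lemma dotr_le n (D h : 'rV[R]_n) (M : R) : (forall i, `|D 0 i| <= M) ->
  `|dotr D h| <= n%:R * M * `|h|.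
Proof.
move=> DM; apply: le_trans (ler_norm_sum _ _ _) _.
apply: (@le_trans _ _ (\sum_(i < n) `|h| * M)).
  by apply: ler_sum => i _; rewrite normrM ler_pM// coord_le_norm.
by rewrite sumr_const card_ord -[leLHS]mulr_natl (mulrC `|h|) mulrA.
Qed.

Lemma rV_pair_sum n m (h : 'rV[R]_n) :
  ((h, 0) : 'rV[R]_n * 'rV[R]_m) = \sum_(i < n) h 0 i *: (delta_mx 0 i, 0).
Proof.
rewrite [LHS](_ : _ = (\sum_(i < n) h 0 i *: delta_mx 0 i, 0)); last by rewrite -row_sum_delta.
elim/big_ind2 : _ => // [a b a' b' <- <-|i _].
  by rewrite -[RHS]/(b + b', 0 + 0 : 'rV[R]_m) addr0.
by rewrite -[RHS]/(_ *: _, h 0 i *: 0) scaler0.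
Qed.

Lemma rV_pair_sumr n m (u : 'rV[R]_m) :
  ((0, u) : 'rV[R]_n * 'rV[R]_m) = \sum_(i < m) u 0 i *: (0, delta_mx 0 i).
Proof.
rewrite [LHS](_ : _ = (0, \sum_(i < m) u 0 i *: delta_mx 0 i)); last by rewrite -row_sum_delta.
elim/big_ind2 : _ => // [a b a' b' <- <-|i _].
  by rewrite -[RHS]/(0 + 0 : 'rV[R]_n, b + b') addr0.
by rewrite -[RHS]/(u 0 i *: 0, _ *: _) scaler0.
Qed.

End norms.

(** * Joint continuity of the gradient formula *)

Section kernel.
Context {R : realType} (n m : nat) (m0 : (0 < m)%N).
Notation chi := (@chi_density R m).
Notation V := ('rV[R]_n * 'rV[R]_m)%type.
Variable g : V -> R.
Hypothesis g_C1 : continuously_differentiable g.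

Lemma diff_pairl (p : V) (h : 'rV[R]_n) :
  'd g p (h, 0) = \sum_(i < n) h 0 i * 'd g p (delta_mx 0 i, 0).
Proof. by rewrite rV_pair_sum linear_sum; apply: eq_bigr => i _; rewrite linearZ. Qed.

Lemma diff_pairr (p : V) (u : 'rV[R]_m) :
  'd g p (0, u) = \sum_(i < m) u 0 i * 'd g p (0, delta_mx 0 i).
Proof. by rewrite rV_pair_sumr linear_sum; apply: eq_bigr => i _; rewrite linearZ. Qed.

Definition dg (p w : V) : R := 'd g p w.

(** With all arguments taken at a root this is the implicit-function formula: the chi density times
    the partial derivative of the root in [x_i]. The radius, the point of the numerator and the
    point of the denominator are separate arguments because mean value theorems produce different
    intermediate points. *)
Definition kern (i : 'I_n) (q : R * (V * (V * 'rV[R]_m))) : R :=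
  - (chi q.1 * dg q.2.1 (delta_mx 0 i, 0) / dg q.2.2.1 (0, q.2.2.2)).

(** The differential is continuous for each fixed direction; expanding the direction in the
    canonical basis makes it jointly continuous. *)
Lemma continuous_diff_pairr : continuous (fun q : V * 'rV[R]_m => dg q.1 (0, q.2)).
Proof.
case: g_C1 => _ cg.
rewrite (_ : (fun q => _) = fun q : V * 'rV[R]_m =>
    \sum_(i < m) q.2 0 i * dg q.1 (0, delta_mx 0 i)); last first.
  by apply/funext => q; rewrite /dg diff_pairr.
apply: continuous_big => [|i _ q]; first exact: add_continuous.
apply: (@cvgM _ _ _ _ (fun q : V * 'rV[R]_m => q.2 0 i)).
- apply: (@cvg_comp _ _ _ snd (fun u : 'rV[R]_m => u 0 i) _ (nbhs q.2)).
    exact: cvg_snd.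
  exact: (@coord_continuous R 1 m 0 i q.2).
- apply: (@cvg_comp _ _ _ fst (fun p => dg p (0, delta_mx 0 i)) _ (nbhs q.1)).
    exact: cvg_fst.
  exact: cg.
Qed.

Lemma continuous_kern i q : dg q.2.2.1 (0, q.2.2.2) != 0 ->
  {for q, continuous (kern i)}.
Proof.
move=> q0; case: g_C1 => _ cg; apply: cvgN; apply: cvgM.
  apply: cvgM.
    apply: (@cvg_comp _ _ _ fst chi _ (nbhs q.1)); first exact: cvg_fst.
    exact: continuous_chi.
  apply: (@cvg_comp _ _ _ (fun q : R * (V * (V * 'rV[R]_m)) => q.2.1)
      (fun p => dg p (delta_mx 0 i, 0)) _ (nbhs q.2.1)); last exact: cg.
  by apply: (@cvg_comp _ _ _ snd fst _ (nbhs q.2)); [exact: cvg_snd|exact: cvg_fst].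
apply: cvgV => //.
apply: (@cvg_comp _ _ _ (fun q : R * (V * (V * 'rV[R]_m)) => q.2.2)
      (fun q : V * 'rV[R]_m => dg q.1 (0, q.2)) _ (nbhs q.2.2)).
  by apply: (@cvg_comp _ _ _ snd snd _ (nbhs q.2)); [exact: cvg_snd|exact: cvg_snd].
exact: continuous_diff_pairr.
Qed.

Lemma kern_near (q : R * (V * (V * 'rV[R]_m))) (e : R) :
  0 < e -> 0 < dg q.2.2.1 (0, q.2.2.2) ->
  exists2 d : R, 0 < d & forall q', ball q d q' ->
    0 < dg q'.2.2.1 (0, q'.2.2.2) /\ forall i, `|kern i q' - kern i q| <= e.
Proof.
move=> e0 q0.
have : \forall q' \near q, 0 < dg q'.2.2.1 (0, q'.2.2.2) /\
    forall i, `|kern i q' - kern i q| <= e.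
  near=> q'; split; near: q'.
    have c : (fun q' : R * (V * (V * 'rV[R]_m)) => dg q'.2.2.1 (0, q'.2.2.2)) @ q -->
        dg q.2.2.1 (0, q.2.2.2).
      apply: (@cvg_comp _ _ _ (fun q : R * (V * (V * 'rV[R]_m)) => q.2.2)
        (fun q : V * 'rV[R]_m => dg q.1 (0, q.2)) _ (nbhs q.2.2)).
        by apply: (@cvg_comp _ _ _ snd snd _ (nbhs q.2)); [exact: cvg_snd|exact: cvg_snd].
      exact: continuous_diff_pairr.
    exact: (cvgr_gt _ c).
  apply: filter_forall => i.
  have /cvgrPdist_le/(_ _ e0) := @continuous_kern i q (lt0r_neq0 q0).
  by apply: filterS => q' /=; rewrite distrC.
move=> /nbhs_ballP[d /= d0 dP]; exists d => // q' /dP; exact.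
Unshelve. all: by end_near. Qed.

End kernel.

(** * Local first-order estimates, uniform in the ray *)

Section local.
Context {R : realType} (n m : nat) (m0 : (0 < m)%N).
Notation chi := (@chi_density R m).
Notation V := ('rV[R]_n * 'rV[R]_m)%type.
Notation P := ('rV[R]_m * 'rV[R]_m)%type.
Variable g : V -> R.
Hypothesis g_C1 : continuously_differentiable g.
Hypothesis g_convex : forall x,
  convex_function [set: convex_lmodType 'rV[R]_m] (fun y => g (x, y)).

Let g_diff p : differentiable g p. Proof. by case: g_C1. Qed.

Definition ray_pt (x : 'rV[R]_n) (t : P) (r : R) : V := (x, r *: t.1 + t.2).

Lemma le_dist_add (a b c e e' : R) : `|a - b| <= e -> `|c - b| <= e' -> `|a - c| <= e + e'.
Proof.
by move=> ab; rewrite distrC => cb; apply: le_trans (ler_distD b _ _) (lerD ab cb).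
Qed.

Lemma dist_segment_lt (r r' c rho s : R) : `|r - c| < rho -> `|r' - c| < rho ->
  0 <= s -> s <= 1 -> `|r + s * (r' - r) - c| < rho.
Proof.
rewrite !ltr_norml => /andP[a1 a2] /andP[b1 b2] s0 s1.
have [rle|rle] := leP r r'.
  have q0 : 0 <= s * (r' - r) by rewrite mulr_ge0// subr_ge0.
  have q1 : s * (r' - r) <= r' - r by rewrite ler_piMl// subr_ge0.
  by apply/andP; split; lra.
have q0 : 0 <= s * (r - r') by rewrite mulr_ge0// subr_ge0 ltW.
have q1 : s * (r - r') <= r - r' by rewrite ler_piMl// subr_ge0 ltW.
have qE : s * (r' - r) = - (s * (r - r')) by ring.
by rewrite qE; apply/andP; split; lra.
Qed.

Lemma dgZr p (a : R) u : dg g p (0, a *: u) = a * dg g p (0, u).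
Proof.
rewrite /dg (_ : (0, a *: u) = a *: (0, u) :> V); first exact: linearZ.
by rewrite -[RHS]/(a *: 0, a *: u) scaler0.
Qed.

Lemma mvt_dg (p w : V) :
  exists2 t : R, 0 <= t <= 1 & g (p + w) - g p = dg g (p + t *: w) w.
Proof. exact: mvt_line. Qed.

Definition grad_at x t r : 'rV[R]_n :=
  \row_i kern g i (r, (ray_pt x t r, (ray_pt x t r, t.1))).

Lemma grad_atE x t r i :
  grad_at x t r 0 i = kern g i (r, (ray_pt x t r, (ray_pt x t r, t.1))).
Proof. exact: mxE. Qed.

(** Under the Slater bound the root is unique, so the choice is immaterial. The value 0 without root
    agrees with the decay of the gradients as the root goes to infinity. *)
Definition radial_grad x t : 'rV[R]_n :=
  if pselect (exists r, is_root g x t r) is left e then grad_at x t (sval (cid e))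
  else 0.

Lemma radial_grad_noroot x t : (forall r, ~ is_root g x t r) -> radial_grad x t = 0.
Proof.
move=> nr; rewrite /radial_grad; case: pselect => // e; exfalso.
by case: e => r /nr.
Qed.

Lemma radial_grad_root x t r gamma : 0 < gamma -> g (x, t.2) <= - gamma ->
  is_root g x t r -> radial_grad x t = grad_at x t r.
Proof.
move=> gamma0 g0 rt; rewrite /radial_grad; case: pselect => [e|[]]; last by exists r.
by case: cid => s st /=; rewrite (is_root_unique g_convex gamma0 g0 st rt).
Qed.

Lemma ray_pt_shift x t r s : ray_pt x t r + (0, s *: t.1) = ray_pt x t (r + s).
Proof.
rewrite /ray_pt -[LHS]/(x + 0, r *: t.1 + t.2 + s *: t.1) addr0.
by rewrite addrAC -scalerDl.
Qed.

Lemma continuous_ray_pt (s : R) :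
  continuous (fun p : P * 'rV[R]_n => g (ray_pt p.2 p.1 s)).
Proof.
move=> p; apply: (@cvg_comp _ _ _ (fun p : P * 'rV[R]_n => ray_pt p.2 p.1 s) g _
  (nbhs (ray_pt p.2 p.1 s))); last first.
  exact: (differentiable_continuous (g_diff (ray_pt p.2 p.1 s))).
apply: (@cvg_pair _ _ _ (nbhs p) (nbhs p.2) (nbhs (s *: p.1.1 + p.1.2)) _ _ _ (fun p : P * 'rV[R]_n => p.2)); first exact: cvg_snd.
apply: cvgD.
  apply: cvgZ; first exact: cvg_cst.
  by apply: (@cvg_comp _ _ _ fst fst _ (nbhs p.1)); [exact: cvg_fst|exact: cvg_fst].
by apply: (@cvg_comp _ _ _ fst snd _ (nbhs p.1)); [exact: cvg_fst|exact: cvg_snd].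
Qed.

Lemma ray_pt_near (t1 : P) (r1 d : R) : 0 < d -> exists2 e : R, 0 < e & forall t r,
  ball t1 e t -> `|r - r1| < e -> ball (r1 *: t1.1 + t1.2) d (r *: t.1 + t.2).
Proof.
move=> d0.
have : {for (t1, r1), continuous (fun p : P * R => p.2 *: p.1.1 + p.1.2)}.
  apply: cvgD.
    apply: cvgZ; first exact: cvg_snd.
    by apply: (@cvg_comp _ _ _ fst fst _ (nbhs t1)); [exact: cvg_fst|exact: cvg_fst].
  by apply: (@cvg_comp _ _ _ fst snd _ (nbhs t1)); [exact: cvg_fst|exact: cvg_snd].
move=> /cvg_ball/(_ _ d0)/nbhs_ballP[e /= e0 eP]; exists e => // t r t1t r1r.
apply: (eP (t, r)); split => //=.
by rewrite -ball_normE /ball_ /= distrC.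
Qed.

Variables (W : set 'rV[R]_n) (T0 : set P) (gamma : R).
Hypotheses (oW : open W) (gamma0 : 0 < gamma).
Hypothesis Hneg : forall x t, W x -> T0 t -> g (x, t.2) <= - gamma.

Definition local_estimate e x1 x t :=
  `|radial_value g x t - radial_value g x1 t - dotr (radial_grad x1 t) (x - x1)|
     <= e * `|x - x1| /\
  forall i, `|radial_grad x t 0 i - radial_grad x1 t 0 i| <= e.

(** The ray value is negative at [r1 - d0] and positive at [r1 + d0]. Both signs persist for nearby
    [(t, x)] and trap a root in between. *)
Lemma root_near x1 t1 r1 rho : W x1 -> T0 t1 -> is_root g x1 t1 r1 -> 0 < rho ->
  exists2 d : R, 0 < d & forall t x, ball t1 d t -> ball x1 d x -> T0 t ->
    W x /\ exists2 r, is_root g x t r & `|r - r1| < rho.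
Proof.
move=> Wx1 T0t1 rt rho0; have [r0 rr0] := rt.
(* Half of the minimum: [d0] is strictly below [rho], and [r1 - d0] stays positive. *)
pose d0 := Num.min rho r1 / 2.
have mn0 : 0 < Num.min rho r1 by rewrite lt_min rho0.
have d00 : 0 < d0 by rewrite divr_gt0.
have d0rho : d0 < rho.
  have : Num.min rho r1 <= rho by rewrite ge_min lexx.
  rewrite /d0; lra.
have d0r : d0 < r1.
  have : Num.min rho r1 <= r1 by rewrite ge_min lexx orbT.
  rewrite /d0; lra.
have H1 := Hneg Wx1 T0t1.
have lo : ray_value g x1 t1 (r1 - d0) < 0.
  by apply: (ray_value_lt_root g_convex gamma0 H1 rt); [lra|lra].
have r1r : r1 <= r1 + d0 by lra.
have hi : 0 < ray_value g x1 t1 (r1 + d0).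
  apply: (lt_le_trans _ (ray_value_gt_root g_convex H1 rt r1r)).
  by rewrite divr_gt0// mulr_gt0//; lra.
have : \forall p \near (t1, x1), [/\ W p.2, g (ray_pt p.2 p.1 (r1 - d0)) < 0 &
    0 < g (ray_pt p.2 p.1 (r1 + d0))].
  near=> p; split; near: p.
  - apply: (@cvg_snd _ _ (nbhs t1) (nbhs x1)); exact: open_nbhs_nbhs.
  - exact: (cvgr_lt _ (@continuous_ray_pt (r1 - d0) (t1, x1))).
  - exact: (cvgr_gt _ (@continuous_ray_pt (r1 + d0) (t1, x1))).
move=> /nbhs_ballP[d /= dd0 dP]; exists d => // t x t1t x1x T0t.
have [Wx lox hix] := dP (t, x) (conj t1t x1x); split => //.
have Hx := Hneg Wx T0t.
have r1d : 0 <= r1 + d0 by lra.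
have [s st sr] := exists_root g_diff gamma0 Hx r1d (ltW hix).
exists s => //.
have r1d0 : 0 <= r1 - d0 by lra.
have := ray_value_le0_root g_convex gamma0 Hx st r1d0.
rewrite (ltW lox) => /esym sr'.
rewrite ltr_norml; apply/andP; split; lra.
Unshelve. all: by end_near. Qed.

Lemma chi_cdf_mvt_near (r r' c rho : R) : 0 < r -> 0 < r' ->
  `|r - c| < rho -> `|r' - c| < rho ->
  exists2 s, `|s - c| < rho & chi_cdf m r' - chi_cdf m r = chi s * (r' - r).
Proof.
move=> r0 r'0; rewrite !ltr_norml => /andP[a1 a2] /andP[b1 b2].
have [rr|rr] := leP r r'.
  have [s /andP[s1 s2] E] := chi_cdf_mvt m0 r0 rr.
  by exists s => //; rewrite ltr_norml; apply/andP; split; lra.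
have [s /andP[s1 s2] E] := chi_cdf_mvt m0 r'0 (ltW rr).
exists s; first by rewrite ltr_norml; apply/andP; split; lra.
by rewrite -opprB E -mulrN opprB.
Qed.

Lemma dotr_row (k : 'I_n -> R) (h : 'rV[R]_n) :
  dotr (\row_i k i) h = \sum_(i < n) h 0 i * k i.
Proof. by apply: eq_bigr => i _; rewrite mxE. Qed.

(** The two root equations are subtracted exactly. Mean values in [x] at the radius [r'], and along
    the ray at [x1], give [r' - r] as a quotient; a mean value of the chi distribution function
    multiplies it by a density. The increment is thus [kern] at intermediate points, applied to
    [x - x1], and all these points are close to those of [t1], where [kern] is continuous. *)
Lemma local_estimate_root x1 t1 r1 e : W x1 -> T0 t1 -> is_root g x1 t1 r1 -> 0 < e ->
  exists2 d : R, 0 < d & forall t x, ball t1 d t -> ball x1 d x -> T0 t ->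
    W x /\ local_estimate e x1 x t.
Proof.
move=> Wx1 T0t1 rt1 e0; have [r10 rr0] := rt1.
(* An entry of [kern] is moved twice, by at most [e'] each time, and [dotr] sums [n] entries; the
   successor keeps the denominator nonzero. *)
pose e' := e / (2 * n.+1%:R).
have n0 : 0 < n.+1%:R :> R by rewrite ltr0n.
have e'0 : 0 < e' by rewrite divr_gt0// mulr_gt0.
have en : n.+1%:R * (2 * e') = e by rewrite /e'; field; rewrite gt_eqF.
pose q1 : R * (V * (V * 'rV[R]_m)) := (r1, (ray_pt x1 t1 r1, (ray_pt x1 t1 r1, t1.1))).
have den0 : 0 < dg g q1.2.2.1 (0, q1.2.2.2).
  apply: (lt_le_trans _ (diff_root_ge g_diff g_convex (Hneg Wx1 T0t1) rt1)).
  by rewrite divr_gt0.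
have [d2 d20 d2P] := kern_near g_C1 e'0 den0.
have [d3 d30 d3P] := ray_pt_near t1 r1 d20.
pose rho := Num.min d2 d3.
have rho0 : 0 < rho by rewrite lt_min d20.
have [d4 d40 d4P] := root_near Wx1 T0t1 rt1 rho0.
pose d := Num.min d4 rho.
have d0 : 0 < d by rewrite lt_min d40.
have [dd4 drho] : d <= d4 /\ d <= rho by have := lexx d; rewrite {2}/d le_min => /andP.
have [rd2 rd3] : rho <= d2 /\ rho <= d3 by have := lexx rho; rewrite {2}/rho le_min => /andP.
exists d => // t x t1t x1x T0t.
have [Wx [r' rt' rr']] := d4P t x (le_ball dd4 t1t) (le_ball dd4 x1x) T0t.
(* The expansion is at [x1] but along the ray of [t], so it involves the root [r] of [t] at [x1],
   which is close to [r1] but may differ from it. *)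
have [_ [r rt rr]] := d4P t x1 (le_ball dd4 t1t) (ballxx _ d40) T0t.
split => //.
have [r0 rE] := rt; have [r'0 r'E] := rt'.
have Hx1 := Hneg Wx1 T0t; have Hx := Hneg Wx T0t.
have u_ball : ball t1.1 d2 t.1.
  by have [+ _] := t1t; apply: le_ball; apply: le_trans drho rd2.
have pt_ball (y : 'rV[R]_n) s : ball x1 d y -> `|s - r1| < rho ->
    ball (ray_pt x1 t1 r1) d2 (ray_pt y t s).
  move=> x1y sr; split; first by apply: le_ball x1y; apply: le_trans drho rd2.
  apply: d3P; last exact: lt_le_trans rd3.
  by apply: le_ball t1t; apply: le_trans drho rd3.
have q_ball (s s1 s2 : R) (y1 y2 : 'rV[R]_n) : `|s - r1| < rho -> `|s1 - r1| < rho ->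
    `|s2 - r1| < rho -> ball x1 d y1 -> ball x1 d y2 ->
    ball q1 d2 (s, (ray_pt y1 t s1, (ray_pt y2 t s2, t.1))).
  move=> h h1 h2 b1 b2; split => /=.
    by rewrite -ball_normE /ball_ /= distrC (lt_le_trans h).
  by split; [exact: pt_ball|split; [exact: pt_ball|exact: u_ball]].
rewrite /local_estimate.
rewrite (radial_value_root g_convex gamma0 Hx rt') (radial_value_root g_convex gamma0 Hx1 rt).
rewrite (radial_grad_root gamma0 Hx rt') (radial_grad_root gamma0 Hx1 rt).
have x11 : ball x1 d x1 by exact: ballxx.
have [_ kr] := d2P _ (q_ball r r r x1 x1 rr rr rr x11 x11).
have [_ kr'] := d2P _ (q_ball r' r' r' x x rr' rr' rr' x1x x1x).
split; last first.
  move=> i; rewrite [X in `|X - _|]grad_atE [X in `|_ - X|]grad_atE.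
  apply: le_trans (le_dist_add (kr' i) (kr i)) _.
  have n1 : 1 <= n.+1%:R :> R by rewrite ler1n.
  by rewrite -en; nra.
pose h := x - x1.
have [xi xir Exi] := chi_cdf_mvt_near r0 r'0 rr rr'.
have [tau /andP[tau0 tau1] Etau] := mvt_dg (ray_pt x1 t r') (h, 0).
have [sg /andP[sg0 sg1] Esg] := mvt_dg (ray_pt x1 t r) (0, (r' - r) *: t.1).
have P1 : ray_pt x1 t r' + tau *: (h, 0) = ray_pt (x1 + tau *: h) t r'.
  by rewrite -[LHS]/(x1 + tau *: h, r' *: t.1 + t.2 + tau *: 0) scaler0 addr0.
have P2 : ray_pt x1 t r' + (h, 0) = ray_pt x t r'.
  by rewrite -[LHS]/(x1 + h, r' *: t.1 + t.2 + 0) addr0 /h addrC subrK.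
have Q1 : ray_pt x1 t r + sg *: (0, (r' - r) *: t.1) = ray_pt x1 t (r + sg * (r' - r)).
  by rewrite -ray_pt_shift -scalerA -[sg *: (_, _)]/(sg *: 0, sg *: _) scaler0.
move: Etau Esg; rewrite P1 P2 Q1 ray_pt_shift (addrC r (r' - r)) subrK.
rewrite [g (ray_pt x t r')](r'E) [g (ray_pt x1 t r)](rE) sub0r subr0.
set PP := ray_pt (x1 + _) t r'; set QQ := ray_pt x1 t (_ + _) => Etau Esg.
have x1h : ball x1 d (x1 + tau *: h).
  move: x1x; rewrite -!ball_normE /ball_ /= opprD addNKr normrN normrZ (ger0_norm tau0).
  rewrite distrC -/h; apply: le_lt_trans.
  by rewrite ler_piMl.
have sr : `|r + sg * (r' - r) - r1| < rho by exact: dist_segment_lt.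
have [dQ kq] := d2P _ (q_ball xi r' (r + sg * (r' - r)) _ _ xir rr' sr x1h x11).
rewrite /= -/QQ in dQ.
(* An equality, not an estimate: the only error left comes from moving the arguments of [kern]. *)
have Esum : dotr (\row_i kern g i (xi, (PP, (QQ, t.1)))) h = chi_cdf m r' - chi_cdf m r.
  rewrite Exi dotr_row.
  have dP : \sum_(i < n) h 0 i * dg g PP (delta_mx 0 i, 0) = - (r' - r) * dg g QQ (0, t.1).
    transitivity (dg g PP (h, 0)); first by rewrite [in RHS]/dg diff_pairl.
    by move: Etau; rewrite Esg => /esym ->; rewrite dgZr mulNr.
  transitivity (- (chi xi / dg g QQ (0, t.1)) * \sum_(i < n) h 0 i * dg g PP (delta_mx 0 i, 0)).
    by rewrite mulr_sumr; apply: eq_bigr => i _; rewrite /kern /=; ring.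
  by rewrite dP; field; rewrite gt_eqF.
rewrite -/h -Esum.
have -> : dotr (\row_i kern g i (xi, (PP, (QQ, t.1)))) h - dotr (grad_at x1 t r) h =
    dotr (\row_i kern g i (xi, (PP, (QQ, t.1))) - grad_at x1 t r) h.
  by rewrite /dotr -sumrB; apply: eq_bigr => i _; rewrite -mulrBr [X in _ = _ * X]mxE [X in _ = _ * (_ + X)]mxE.
apply: le_trans (dotr_le _ (M := 2 * e') _) _.
  move=> i; rewrite mxE [X in `|X + _|]mxE [X in `|_ + X|]mxE [X in `|_ - X|]grad_atE.
  by apply: le_trans (le_dist_add (kq i) (kr i)) _; lra.
rewrite ler_wpM2r//; rewrite -en ler_wpM2r ?ler_nat//.
by rewrite mulr_ge0// ltW.
Qed.

Variables (eta a b : R).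
Hypotheses (eta0 : 0 < eta) (a0 : 0 < a) (b0 : 0 < b).
Hypothesis T0_bounded : forall t, T0 t -> `|t.1| <= eta /\ `|t.2| <= eta.
Hypothesis growth : forall x y h, W x -> `|dg g (x, y) (h, 0)| <= a * expR (b * `|y|) * `|h|.

Let A := a * expR (b * eta).
(** The decay rate asked of the chi density: [b * eta] offsets the growth of the gradient along a
    ray, 1 absorbs a factor [r], and 1 is left as the decay [e^(-r)]. *)
Let beta := b * eta + 2.

Let A0 : 0 < A. Proof. by rewrite mulr_gt0// expR_gt0. Qed.

Lemma growth_ray x t s h : W x -> T0 t -> 0 <= s ->
  `|dg g (ray_pt x t s) (h, 0)| <= A * expR (b * eta * s) * `|h|.
Proof.
move=> Wx T0t s0; apply: le_trans (growth _ _ Wx) _.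
rewrite ler_wpM2r// /A -mulrA -expRD ler_pM2l// ler_expR.
have [t1 t2] := T0_bounded T0t.
have : `|s *: t.1 + t.2| <= s * eta + eta.
  by rewrite (le_trans (ler_normD _ _))// lerD// normrZ ger0_norm// ler_wpM2l.
by move=> H; have := ler_wpM2l (ltW b0) H; lra.
Qed.

Lemma mul_expRN_le (r : R) : 0 <= r -> r * expR (- (2 * r)) <= expR (- r).
Proof.
move=> r0; rewrite (_ : - (2 * r) = - r + - r); last by ring.
rewrite expRD mulrA ler_piMl ?expR_ge0// expRN ler_pdivrMr ?expR_gt0// mul1r.
by have := expR_ge1Dx r; lra.
Qed.

(** The chi density beats the product of the numerator, at most [A e^(b eta r)], and the inverse
    slope, at most [r / gamma]. *)
Lemma radial_grad_decay : exists2 K, 0 < K & forall x t r i, W x -> T0 t ->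
  is_root g x t r -> `|radial_grad x t 0 i| <= K * expR (- r).
Proof.
have [K K0 chiK] := chi_le_exp m beta.
exists (K * A / gamma); first by rewrite divr_gt0// mulr_gt0.
move=> x t r i Wx T0t rt; have [r0 _] := rt.
rewrite (radial_grad_root gamma0 (Hneg Wx T0t) rt) (grad_atE x t r i) /kern /= normrN.
rewrite normrM normrM ger0_norm ?(chi_density_ge0 m0 (ltW r0))//.
have dQ := diff_root_ge g_diff g_convex (Hneg Wx T0t) rt.
have dQ0 : 0 < dg g (ray_pt x t r) (0, t.1) by apply: lt_le_trans dQ; rewrite divr_gt0.
have dQi : `|(dg g (ray_pt x t r) (0, t.1))^-1| <= r / gamma.
  rewrite ger0_norm ?invr_ge0 ?(ltW dQ0)// -[leRHS]invrK lef_pV2 ?posrE// ?invr_gt0 ?divr_gt0//.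
  by rewrite invf_div.
have dP := growth_ray (delta_mx 0 i) Wx T0t (ltW r0).
have d1 : `|delta_mx 0 i : 'rV[R]_n| <= 1.
  apply: norm_le_coord => // j; rewrite mxE eqxx /=; case: eqP => _; first by rewrite normr1.
  by rewrite normr0.
have dP' : `|dg g (ray_pt x t r) (delta_mx 0 i, 0)| <= A * expR (b * eta * r).
  apply: le_trans dP _; rewrite ler_piMr// mulr_ge0 ?expR_ge0// ltW//.
apply: (@le_trans _ _ (K * expR (- (beta * r)) * (A * expR (b * eta * r)) * (r / gamma))).
  apply: ler_pM => //; first by rewrite mulr_ge0// (chi_density_ge0 m0 (ltW r0)).
  apply: ler_pM => //; first by rewrite (chi_density_ge0 m0 (ltW r0)).
  exact: chiK (ltW r0).
rewrite (_ : _ * _ = K * A / gamma * (r * (expR (- (beta * r)) * expR (b * eta * r)))); last by ring.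
rewrite ler_pM2l; last by rewrite divr_gt0// mulr_gt0.
rewrite -expRD (_ : _ + _ = - (2 * r)); last by rewrite /beta; ring.
exact: mul_expRN_le (ltW r0).
Qed.

Lemma chi_cdf_le (r s : R) : 0 < r -> r <= s -> chi_cdf m r <= chi_cdf m s.
Proof.
move=> r0 rs; rewrite -subr_ge0; have [u /andP[ru _] ->] := chi_cdf_mvt m0 r0 rs.
rewrite mulr_ge0 ?subr_ge0//; apply: (chi_density_ge0 m0); lra.
Qed.

Lemma radial_value_le1 x t : W x -> T0 t -> radial_value g x t <= 1.
Proof.
move=> Wx T0t; have [[r rt]|nr] := pselect (exists r, is_root g x t r).
  by rewrite (radial_value_root g_convex gamma0 (Hneg Wx T0t) rt) (chi_cdf_le1 m0).
rewrite (radial_value_noroot m0 g_diff gamma0 (Hneg Wx T0t))// => r rt; apply: nr.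
by exists r.
Qed.

(* A decrease of [g] along the segment from [x'] to [x] that moves the root from
   [r'] beyond [s] is paid for by the growth bound. *)
Lemma root_shift_le x x' t r' s : T0 t ->
  (forall tau : R, 0 <= tau <= 1 -> W (x + tau *: (x' - x))) -> is_root g x' t r' ->
  r' <= s -> ray_value g x t s <= 0 ->
  s - r' <= r' / gamma * (A * expR (b * eta * s)) * `|x' - x|.
Proof.
move=> T0t seg rt rs xs; have [r0 _] := rt.
have Wx' : W x' by have := seg 1; rewrite scale1r addrC subrK; apply; rewrite ler01 lexx.
have s0 : 0 <= s by lra.
have H := ray_value_gt_root g_convex (Hneg Wx' T0t) rt rs.
have [tau tau01 E] := mvt_dg (ray_pt x t s) (x' - x, 0).
have E1 : ray_pt x t s + (x' - x, 0) = ray_pt x' t s.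
  by rewrite -[LHS]/(x + (x' - x), s *: t.1 + t.2 + 0) addr0 addrC subrK.
have E2 : ray_pt x t s + tau *: (x' - x, 0) = ray_pt (x + tau *: (x' - x)) t s.
  by rewrite -[LHS]/(x + tau *: _, s *: t.1 + t.2 + tau *: 0) scaler0 addr0.
move: E; rewrite E1 E2 => E.
have := growth_ray (x' - x) (seg _ tau01) T0t s0.
rewrite -E => /ler_normlP[_ G].
have : gamma * (s - r') / r' <= A * expR (b * eta * s) * `|x' - x|.
  by apply: le_trans H (le_trans _ G); rewrite -/(ray_pt x t s) in xs *; rewrite /ray_value in xs *; rewrite lerBrDr gerDl.
rewrite ler_pdivrMr// -ler_pdivlMl// => G'; apply: le_trans G' _.
by rewrite (_ : _^-1 * _ = r' / gamma * (A * expR (b * eta * s)) * `|x' - x|)//; ring.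
Qed.

(** A Lipschitz bound whose constant decays with the root. [x'] carries the smaller root and [x] may
    have none, so a root that moves and a root that escapes to infinity are treated together. *)
Lemma radial_value_decay : exists2 K, 0 < K & forall x x' t r', T0 t ->
  (forall tau : R, 0 <= tau <= 1 -> W (x + tau *: (x' - x))) -> is_root g x' t r' ->
  (forall s, is_root g x t s -> r' <= s) ->
  `|radial_value g x t - radial_value g x' t| <= K * expR (- r') * `|x' - x|.
Proof.
have [K1 K10 chiK] := chi_le_exp m beta.
have beta1 : 1 <= beta by rewrite /beta; have := mulr_gt0 b0 eta0; lra.
have [K2 K20 cdfK] := chi_cdf_tail m0 beta1.
pose K := K1 + K2; have K0 : 0 < K by rewrite addr_gt0.
exists (K * A * expR (b * eta) / gamma).
  by rewrite divr_gt0// !mulr_gt0// expR_gt0.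
move=> x x' t r' T0t seg rt rs; have [r'0 _] := rt.
have Wx : W x by have := seg 0; rewrite scale0r addr0; apply; rewrite lexx ler01.
have Wx' : W x' by have := seg 1; rewrite scale1r addrC subrK; apply; rewrite ler01 lexx.
rewrite (radial_value_root g_convex gamma0 (Hneg Wx' T0t) rt).
(* Either case bounds the difference by [K e^(-beta r')] times a quantity that
   the growth condition bounds in turn. *)
suff [q q0 [Hq Hd]] : exists2 q, 0 <= q & q <= r' / gamma * (A * expR (b * eta * (r' + 1))) * `|x' - x|
    /\ `|radial_value g x t - chi_cdf m r'| <= K * expR (- (beta * r')) * q.
  apply: le_trans Hd _.
  apply: (@le_trans _ _ (K * expR (- (beta * r')) *
      (r' / gamma * (A * expR (b * eta * (r' + 1))) * `|x' - x|))).
    by rewrite ler_wpM2l// mulr_ge0 ?expR_ge0// ltW.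
  rewrite mulrDr mulr1 expRD.
  rewrite (_ : _ * _ = K * A * expR (b * eta) / gamma *
    (r' * (expR (- (beta * r')) * expR (b * eta * r'))) * `|x' - x|); last by ring.
  rewrite ler_wpM2r// ler_pM2l; last by rewrite divr_gt0// !mulr_gt0// expR_gt0.
  rewrite -expRD (_ : _ + _ = - (2 * r')); last by rewrite /beta; ring.
  exact: mul_expRN_le (ltW r'0).
have KK : K1 * expR (- (beta * r')) <= K * expR (- (beta * r')) /\
    K2 * expR (- (beta * r')) <= K * expR (- (beta * r')).
  by split; rewrite ler_wpM2r ?expR_ge0// /K; lra.
(* The cut at [r' + 1] keeps the growth factor at the root of [x] within [e^(b eta)] of the one at
   [r']. *)
have [[s [st sr]]|ns] := pselect (exists s, is_root g x t s /\ s <= r' + 1).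
  have rs' := rs _ st.
  rewrite (radial_value_root g_convex gamma0 (Hneg Wx T0t) st).
  exists (s - r'); first by rewrite subr_ge0.
  split.
    apply: le_trans (root_shift_le T0t seg rt rs' _) _.
      by case: st => _ ->.
    rewrite ler_wpM2r// ler_wpM2l ?divr_ge0 ?(ltW r'0) ?(ltW gamma0)//.
    by rewrite ler_wpM2l ?(ltW A0)// ler_expR ler_wpM2l// mulr_ge0 ?(ltW b0) ?(ltW eta0).
  rewrite ger0_norm; last by rewrite subr_ge0 chi_cdf_le.
  have [u /andP[u1 _] ->] := chi_cdf_mvt m0 r'0 rs'.
  rewrite ler_wpM2r ?subr_ge0//; apply: le_trans KK.1.
  apply: le_trans (chiK u _) _; first by lra.
  by rewrite ler_pM2l// ler_expR lerN2 ler_wpM2l//; lra.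
have xr : ray_value g x t (r' + 1) <= 0.
  have r'1 : 0 <= r' + 1 by lra.
  have [[s st]|nr] := pselect (exists s, is_root g x t s).
    rewrite (ray_value_le0_root g_convex gamma0 (Hneg Wx T0t) st)// leNgt.
    by apply/negP => sr; apply: ns; exists s; split => //; exact: ltW.
  apply/ltW/(noroot_lt0 g_diff gamma0 (Hneg Wx T0t)) => // s st; apply: nr; by exists s.
(* The root has moved by at least one unit, or has disappeared: the shift bound over a unit length
   is then at least 1, and the difference of values is at most the chi tail beyond [r']. *)
exists 1 => //; split.
  have := root_shift_le T0t seg rt _ xr; rewrite addrAC subrr add0r; apply.
  by rewrite lerDl.
have lo : chi_cdf m r' <= radial_value g x t.
  have [[s st]|nr] := pselect (exists s, is_root g x t s).
    by rewrite (radial_value_root g_convex gamma0 (Hneg Wx T0t) st) chi_cdf_le// rs.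
  rewrite (radial_value_noroot m0 g_diff gamma0 (Hneg Wx T0t)) ?(chi_cdf_le1 m0)//.
  by move=> s st; apply: nr; exists s.
rewrite ger0_norm ?subr_ge0// mulr1; apply: le_trans KK.2; apply: le_trans (cdfK _ (ltW r'0)).
by rewrite lerB// radial_value_le1.
Qed.

(** Without root the ray value is negative at every radius. At a large radius [Rad] this persists
    nearby, so every nearby root lies beyond [Rad]. By the decay bounds each term of the expansion
    is then small on its own. *)
Lemma local_estimate_noroot x1 t1 e : W x1 -> T0 t1 -> (forall r, ~ is_root g x1 t1 r) ->
  0 < e ->
  exists2 d : R, 0 < d & forall t x, ball t1 d t -> ball x1 d x -> T0 t ->
    W x /\ local_estimate e x1 x t.
Proof.
move=> Wx1 T0t1 nr e0.
have [K1 K10 gK] := radial_grad_decay; have [K2 K20 vK] := radial_value_decay.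
pose K := K1 + K2; have K0 : 0 < K by rewrite addr_gt0.
have n0 : 0 < n.+2%:R :> R by rewrite ltr0n.
(* As [e^Rad >= Rad], this radius gives [(n + 2) K e^(-Rad) <= e]. In units of [K e^(-Rad)], the
   expansion costs 1 for the values and [n] for the linear term, and a difference of gradients costs
   2. *)
pose Rad := n.+2%:R * K / e; have Rad0 : 0 < Rad by rewrite divr_gt0// mulr_gt0.
have Rade : n.+2%:R * (K * expR (- Rad)) <= e.
  rewrite mulrA (_ : n.+2%:R * K = Rad * e); last by rewrite /Rad divfK// gt_eqF.
  rewrite mulrAC ler_piMl ?(ltW e0)// expRN ler_pdivrMr ?expR_gt0// mul1r.
  by have := expR_ge1Dx Rad; lra.
have : \forall p \near (t1, x1), W p.2 /\ g (ray_pt p.2 p.1 Rad) < 0.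
  near=> p; split; near: p.
    apply: (@cvg_snd _ _ (nbhs t1) (nbhs x1)); exact: open_nbhs_nbhs.
  apply: (cvgr_lt _ (@continuous_ray_pt Rad (t1, x1))).
  exact: (noroot_lt0 g_diff gamma0 (Hneg Wx1 T0t1) nr (ltW Rad0)).
move=> /nbhs_ballP[d /= d0 dP]; exists d => // t x t1t x1x T0t.
have [Wx _] := dP (t, x) (conj t1t x1x); split => //.
have far y r : ball x1 d y -> is_root g y t r -> Rad <= r.
  move=> x1y rt; have [Wy yR] := dP (t, y) (conj t1t x1y).
  rewrite -(ray_value_le0_root g_convex gamma0 (Hneg Wy T0t) rt (ltW Rad0)).
  exact: ltW.
have seg (y y' : 'rV[R]_n) : ball x1 d y -> ball x1 d y' ->
    forall tau : R, 0 <= tau <= 1 -> W (y + tau *: (y' - y)).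
  move=> by_ by' tau /andP[tau0 tau1].
  suff : ball x1 d (y + tau *: (y' - y)).
    by move=> h; have [] := dP (t, y + tau *: (y' - y)) (conj t1t h).
  move: by_ by'; rewrite -!ball_normE /ball_ /= => by_ by'.
  rewrite (_ : x1 - (y + tau *: (y' - y)) = (1 - tau) *: (x1 - y) + tau *: (x1 - y')); last first.
    by rewrite scalerBl scale1r !scalerBr; apply/rowP => j; rewrite !mxE; ring.
  have [tau1'|] := eqVneq tau 1.
    by rewrite tau1' subrr scale0r add0r scale1r.
  move=> tau1'; apply: le_lt_trans (ler_normD _ _) _; rewrite !normrZ.
  have tau2 : 0 < 1 - tau by rewrite subr_gt0 lt_neqAle tau1'.
  rewrite (gtr0_norm tau2) (ger0_norm tau0); nra.
have x11 : ball x1 d x1 by exact: ballxx.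
have K1K : K1 * expR (- Rad) <= K * expR (- Rad) by rewrite ler_wpM2r ?expR_ge0// /K; lra.
have K2K : K2 * expR (- Rad) <= K * expR (- Rad) by rewrite ler_wpM2r ?expR_ge0// /K; lra.
have grad_le y i : ball x1 d y -> `|radial_grad y t 0 i| <= K * expR (- Rad).
  move=> x1y; have [Wy _] := dP (t, y) (conj t1t x1y).
  have [[r rt]|nr'] := pselect (exists r, is_root g y t r).
    apply: le_trans (gK _ _ _ i Wy T0t rt) (le_trans _ K1K).
    by rewrite ler_pM2l// ler_expR lerN2 (far y).
  rewrite radial_grad_noroot ?mxE ?normr0 ?mulr_ge0 ?expR_ge0 ?(ltW K0)//.
  by move=> r rt; apply: nr'; exists r.
have val_le (y y' : 'rV[R]_n) r : ball x1 d y -> ball x1 d y' -> is_root g y' t r ->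
    (forall s, is_root g y t s -> r <= s) ->
    `|radial_value g y t - radial_value g y' t| <= K * expR (- Rad) * `|y' - y|.
  move=> x1y x1y' rt rs; apply: le_trans (vK _ _ _ _ T0t (seg _ _ x1y x1y') rt rs) _.
  rewrite ler_wpM2r//; apply: le_trans K2K.
  by rewrite ler_pM2l// ler_expR lerN2 (far y').
(* The endpoint with the smaller root plays the part of [x'] in the decay bound; if neither has a
   root, both values are 1. *)
have val : `|radial_value g x t - radial_value g x1 t| <= K * expR (- Rad) * `|x - x1|.
  have [[r rt]|nr'] := pselect (exists r, is_root g x t r);
    have [[r1 rt1]|nr1] := pselect (exists r, is_root g x1 t r).
  - have [rr|rr] := leP r1 r.
      rewrite (distrC x); apply: (val_le _ _ r1) => // s st.
      by rewrite (is_root_unique g_convex gamma0 (Hneg Wx T0t) st rt).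
    rewrite distrC; apply: (val_le _ _ r) => // s st.
    by rewrite (is_root_unique g_convex gamma0 (Hneg Wx1 T0t) st rt1) ltW.
  - by rewrite distrC; apply: (val_le _ _ r) => // s st; exfalso; apply: nr1; exists s.
  - by rewrite (distrC x); apply: (val_le _ _ r1) => // s st; exfalso; apply: nr'; exists s.
  - rewrite !(radial_value_noroot m0 g_diff gamma0); first by rewrite subrr normr0 !mulr_ge0 ?expR_ge0 ?(ltW K0).
    + exact: Hneg Wx1 T0t.
    + by move=> r rt; apply: nr1; exists r.
    + exact: Hneg Wx T0t.
    + by move=> r rt; apply: nr'; exists r.
have Ke0 : 0 <= K * expR (- Rad) by rewrite mulr_ge0 ?expR_ge0 ?(ltW K0).
have nE : n.+2%:R = n%:R + 2 :> R by rewrite -natrD addn2.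
have nn : 0 <= n%:R :> R by exact: ler0n.
split.
  apply: le_trans (ler_normB _ _) _.
  have := dotr_le (x - x1) (fun i => grad_le x1 i x11).
  move=> /(lerD val) h; apply: le_trans h _; rewrite -mulrDl ler_wpM2r//.
  by apply: le_trans Rade; rewrite nE; nra.
move=> i; apply: le_trans (ler_normB _ _) _.
apply: le_trans (lerD (grad_le x i x1x) (grad_le x1 i x11)) _.
by apply: le_trans Rade; rewrite nE; nra.
Unshelve. all: by end_near. Qed.

End local.

(** * Uniformity over a compact set of rays *)

Section uniform_local.
Context {R : realType} (n m : nat) (m0 : (0 < m)%N).
Notation V := ('rV[R]_n * 'rV[R]_m)%type.
Notation P := ('rV[R]_m * 'rV[R]_m)%type.
Variable g : V -> R.
Hypothesis g_C1 : continuously_differentiable g.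
Hypothesis g_convex : forall x,
  convex_function [set: convex_lmodType 'rV[R]_m] (fun y => g (x, y)).

Let g_diff p : differentiable g p. Proof. by case: g_C1. Qed.

(** For each [t1] the estimate holds on a product of balls around [t1] and [x1], within [T0];
    compactness of [T0] provides a common neighbourhood of [x1]. *)
Lemma local_estimate_near (W : set 'rV[R]_n) (T0 : set P) (gamma eta a b : R) :
  open W -> compact T0 -> 0 < gamma -> 0 < eta -> 0 < a -> 0 < b ->
  (forall x t, W x -> T0 t -> g (x, t.2) <= - gamma) ->
  (forall t, T0 t -> `|t.1| <= eta /\ `|t.2| <= eta) ->
  (forall x y h, W x -> `|dg g (x, y) (h, 0)| <= a * expR (b * `|y|) * `|h|) ->
  forall x1 e, W x1 -> 0 < e ->
  \forall x \near x1, forall t, T0 t -> local_estimate g e x1 x t.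
Proof.
move=> oW cT gamma0 eta0 a0 b0 Hneg T0b growth x1 e Wx1 e0.
have /near_covering_withinP H := (compact_near_coveringP T0).1 cT.
apply: (H _ (nbhs x1) (fun x t => local_estimate g e x1 x t)).
move=> t1 T0t1.
have [d d0 dP] : exists2 d : R, 0 < d & forall t x, ball t1 d t -> ball x1 d x -> T0 t ->
    W x /\ local_estimate g e x1 x t.
  have [[r1 rt1]|nr] := pselect (exists r, is_root g x1 t1 r).
    exact: (local_estimate_root m0 g_C1 g_convex oW gamma0 Hneg Wx1 T0t1 rt1 e0).
  apply: (local_estimate_noroot m0 g_C1 g_convex oW gamma0 Hneg eta0 a0 b0 T0b growth Wx1 T0t1 _ e0).
  by move=> r rt; apply: nr; exists r.
exists (ball t1 d, ball x1 d); first by split; exact: nbhsx_ballx.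
move=> [t x] [/= t1t x1x] T0t.
exact: (dP t x t1t x1x T0t).2.
Qed.

(** The Slater inequality is imposed at the single point [x0], so that one null set is discarded,
    and in its non-strict form, so that the set is closed and hence compact. *)
Definition ray_params (x0 : 'rV[R]_n) (gamma eta : R) : set P :=
  [set u | `|u| <= eta] `*` [set z | `|z| <= eta /\ g (x0, z) <= - gamma].

Lemma closed_norm_le (eta : R) : closed [set u : 'rV[R]_m | `|u| <= eta].
Proof.
apply: (@preimage_closed _ _ (fun u : 'rV[R]_m => `|u|) [set r | r <= eta]).
  by move=> x _; exact: norm_continuous.
exact: closed_le.
Qed.

Lemma continuous_g2 (x0 : 'rV[R]_n) : continuous (fun z : 'rV[R]_m => g (x0, z)).
Proof.
move=> z; apply: (@cvg_comp _ _ _ (fun z => (x0, z)) g _ (nbhs (x0, z))); last first.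
  exact: (differentiable_continuous (g_diff (x0, z))).
apply: (@cvg_pair _ _ _ (nbhs z) (nbhs x0) (nbhs z) _ _ _ (fun=> x0) id).
  exact: cvg_cst.
exact: cvg_id.
Qed.

Lemma closed_slater (x0 : 'rV[R]_n) (gamma eta : R) :
  closed [set z : 'rV[R]_m | `|z| <= eta /\ g (x0, z) <= - gamma].
Proof.
apply: closedI; first exact: closed_norm_le.
apply: (@preimage_closed _ _ (fun z : 'rV[R]_m => g (x0, z)) [set r | r <= - gamma]).
  by move=> x _; exact: continuous_g2.
exact: closed_le.
Qed.

Lemma compact_ray_params x0 gamma eta : compact (ray_params x0 gamma eta).
Proof.
have bnd (A : set 'rV[R]_m) : A `<=` [set u | `|u| <= eta] -> bounded_set A.
  move=> AE; exists eta; split; first exact: num_real.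
  by move=> M /ltW eM u /AE /= ue; exact: le_trans ue eM.
apply: compact_setX; apply: bounded_closed_compact.
- exact: bnd.
- exact: closed_norm_le.
- by apply: bnd => z [].
- exact: closed_slater.
Qed.

(** Halving [gamma] leaves room for [x] to move; by compactness one neighbourhood of [x0] serves all
    parameters. *)
Lemma slater_near (x0 : 'rV[R]_n) (gamma eta : R) : 0 < gamma ->
  \forall x \near x0, forall t, ray_params x0 gamma eta t -> g (x, t.2) <= - (gamma / 2).
Proof.
move=> gamma0.
have /near_covering_withinP H := (compact_near_coveringP _).1 (@compact_ray_params x0 gamma eta).
apply: (H _ (nbhs x0) (fun x t => g (x, t.2) <= - (gamma / 2))) => t1 [_ [_ gt1]].
have c : (fun p : P * 'rV[R]_n => g (ray_pt p.2 p.1 0)) @ (t1, x0) --> g (ray_pt x0 t1 0).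
  exact: (@continuous_ray_pt _ _ _ _ g_C1 0 (t1, x0)).
have lt1 : g (ray_pt x0 t1 0) < - (gamma / 2).
  by rewrite /ray_pt scale0r add0r; lra.
have : nbhs (t1, x0) [set p : P * 'rV[R]_n | g (ray_pt p.2 p.1 0) < - (gamma / 2)].
  exact: (cvgr_lt _ c _ lt1).
move=> [[B C] [/= B1 C1] BC]; exists (B, C) => // -[t x] [/= Bt Cx] _.
have := BC (t, x) (conj Bt Cx); move=> /=; by rewrite /ray_pt scale0r add0r; exact: ltW.
Qed.

Lemma local_estimate_nbhs (x0 : 'rV[R]_n) (gamma eta eps a b : R) :
  0 < gamma -> 0 < eta -> 0 < eps -> 0 < a -> 0 < b ->
  (forall x y h, ball x0 eps x -> `|dg g (x, y) (h, 0)| <= a * expR (b * `|y|) * `|h|) ->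
  exists2 W : set 'rV[R]_n, open_nbhs x0 W & forall x1 e, W x1 -> 0 < e ->
    \forall x \near x1, forall t, ray_params x0 gamma eta t -> local_estimate g e x1 x t.
Proof.
move=> gamma0 eta0 eps0 a0 b0 growth.
pose A := ball x0 eps `&` [set x | forall t, ray_params x0 gamma eta t -> g (x, t.2) <= - (gamma / 2)].
have x0A : nbhs x0 A by apply: filterI; [exact: nbhsx_ballx|exact: slater_near].
exists A°; first by split; [exact: open_interior|].
have sA := @interior_subset _ A.
apply: (@local_estimate_near _ _ (gamma / 2) eta a b) => //.
- exact: open_interior.
- exact: compact_ray_params.
- by rewrite divr_gt0.
- by move=> x t /sA[_]; exact.
- by move=> t [? []].
- by move=> x y h /sA[xb _]; exact: growth.
Qed.

End uniform_local.

(** * Laws of large numbers *)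

Section bounded_measurable.
Context d (T : measurableType d) (R : realType).
Implicit Types f g : T -> R.

Definition bounded_mfun f :=
  measurable_fun setT f /\ exists M : R, forall t, `|f t| <= M.

Lemma bounded_mfun_cst (r : R) : bounded_mfun (fun=> r).
Proof. by split => //; exists `|r|. Qed.

Lemma bounded_mfunD f g :
  bounded_mfun f -> bounded_mfun g -> bounded_mfun (fun t => f t + g t).
Proof.
move=> [mf [M fM]] [mg [N gN]]; split; first exact: measurable_funD.
exists (M + N) => t; apply: le_trans (ler_normD _ _) _; exact: lerD.
Qed.

Lemma bounded_mfunM f g :
  bounded_mfun f -> bounded_mfun g -> bounded_mfun (fun t => f t * g t).
Proof.
move=> [mf [M fM]] [mg [N gN]]; split; first exact: measurable_funM.
by exists (M * N) => t; rewrite normrM ler_pM.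
Qed.

Lemma bounded_mfun_sum (I : Type) (r : seq I) (f : I -> T -> R) :
  (forall i, bounded_mfun (f i)) -> bounded_mfun (fun t => \sum_(i <- r) f i t).
Proof.
move=> bf; elim: r => [|i r IH].
  by under eq_fun do rewrite big_nil; exact: bounded_mfun_cst.
by under eq_fun do rewrite big_cons; exact: bounded_mfunD.
Qed.

Lemma bounded_mfun_integrable (mu : {measure set T -> \bar R}) f :
  (mu setT < +oo)%E -> bounded_mfun f -> mu.-integrable setT (EFin \o f).
Proof.
move=> muT [mf [M fM]]; apply: measurable_bounded_integrable => //.
exists M; split; first exact: num_real.
by move=> N MN t _ /=; exact: le_trans (fM t) (ltW MN).
Qed.

Variable P : probability T R.

Lemma probability_integrable f : bounded_mfun f -> P.-integrable setT (EFin \o f).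
Proof.
apply: bounded_mfun_integrable.
by rewrite [X in (X < _)%E](_ : _ = 1%E) ?ltry//; exact: probability_setT.
Qed.

Lemma Rintegral_sum_bounded (I : Type) (r : seq I) (f : I -> T -> R) :
  (forall i, bounded_mfun (f i)) ->
  \int[P]_t (\sum_(i <- r) f i t) = \sum_(i <- r) \int[P]_t f i t.
Proof.
move=> bf; elim: r => [|i r IH].
  rewrite big_nil; under eq_Rintegral do rewrite big_nil.
  by rewrite Rintegral_cst ?mul0r.
rewrite big_cons -IH -RintegralD//.
- by apply: eq_Rintegral => t _; rewrite big_cons.
- exact: probability_integrable.
- by apply: probability_integrable; exact: bounded_mfun_sum.
Qed.

Lemma le_Rintegral_bounded f g : bounded_mfun f -> bounded_mfun g ->
  (forall t, f t <= g t) -> \int[P]_t f t <= \int[P]_t g t.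
Proof.
by move=> bf bg fg; apply: le_Rintegral => //; exact: probability_integrable.
Qed.

Lemma Rintegral_cst_probability (r : R) : \int[P]_t r = r.
Proof.
by rewrite Rintegral_cst// [X in fine X](_ : _ = 1%E) ?mulr1//; exact: probability_setT.
Qed.

End bounded_measurable.

Section pairwise.
Context d d' (Omega : measurableType d) (T : measurableType d') (R : realType).
Context (P : probability Omega R) (X : nat -> Omega -> T) (Q : set T -> \bar R).
Hypothesis iidX : iid P X Q.
Variables (F : T -> R).
Hypothesis bF : bounded_mfun F.

Let mX i : measurable_fun setT (X i). Proof. by case: iidX. Qed.

Let mean := \int[P]_w F (X 0%N w).

Let X0 : {mfun Omega >-> T} := HB.pack (X 0%N) (isMeasurableFun.Build _ _ _ _ (X 0%N) (mX 0%N)).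

(** In [iid], [Q] is a mere set function; the law of [X 0] is a probability measure, of which
    products can be formed. *)
Let law := distribution P X0.

Let lawE i A : measurable A -> law A = P (X i @^-1` A).
Proof. by case: iidX => _ PQ _ mA; rewrite PQ// -(PQ 0%N). Qed.

Lemma iid_pair_law i j (A B : set T) : i != j -> measurable A -> measurable B ->
  P ((fun w => (X i w, X j w)) @^-1` (A `*` B)) = (law A * law B)%E.
Proof.
move=> ij mA mB; case: iidX => _ _ ind.
pose AB k := if k == i then A else B.
have mAB k : measurable (AB k) by rewrite /AB; case: ifP.
have := ind [:: i; j] AB; rewrite /= !inE ij big_cons big_seq1 => /(_ isT mAB).
rewrite /AB eqxx eq_sym (negPf ij) -!lawE// => <-; congr (P _).
apply/seteqP; split => w /=.
  by move=> [Ai Bj] k; rewrite /= !inE => /orP[/eqP->|/eqP->];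
    rewrite ?eqxx// eq_sym (negPf ij).
move=> H; split; first by have := H i; rewrite /= !inE eqxx; apply.
by have := H j; rewrite /= !inE eqxx orbT eq_sym (negPf ij); apply.
Qed.

(** The law of the pair and the product law agree on rectangles, hence everywhere. Fubini's theorem
    then brings out the mean of the centred [F], which is 0. *)
Lemma iid_uncorrelated i j : i != j ->
  \int[P]_w ((F (X i w) - mean) * (F (X j w) - mean)) = 0.
Proof.
move=> ij; pose Z t := F t - mean.
have bZ : bounded_mfun Z by apply: bounded_mfunD => //; exact: bounded_mfun_cst.
have mXij : measurable_fun setT (fun w => (X i w, X j w)).
  by apply/measurable_fun_pairP; split; exact: mX.
pose G (xy : T * T) := (Z xy.1 * Z xy.2)%:E.
have bG : bounded_mfun (fun xy : T * T => Z xy.1 * Z xy.2).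
  apply: bounded_mfunM; case: bZ => mZ [M ZM]; split.
  - exact: (measurableT_comp mZ measurable_fst).
  - by exists M.
  - exact: (measurableT_comp mZ measurable_snd).
  - by exists M.
have bGX : bounded_mfun (fun w => Z (X i w) * Z (X j w)).
  case: bG => mG [M GM]; split; first exact: (measurableT_comp mG mXij).
  by exists M => w; exact: (GM (X i w, X j w)).
rewrite /Rintegral; rewrite [X in fine X](_ : _ = 0%E)//.
transitivity (\int[pushforward P (fun w => (X i w, X j w))]_xy G xy)%E.
  have mG : measurable_fun setT G by apply/measurable_EFinP; case: bG.
  have iG := probability_integrable P bGX.
  exact/esym/(integral_pushforward mXij mG iG measurableT).
transitivity (\int[law \x law]_xy G xy)%E.
  apply: eq_measure_integral => A mA _.
  have := @product_measure_unique _ _ _ _ R law law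
    (measure_function_pushforward__canonical__measure_function_Measure P mXij).
  move=> H; apply/esym; apply: H => // A' B' mA' mB'; exact: iid_pair_law.
rewrite -integral12_prod_meas1; last first.
  apply: bounded_mfun_integrable => //.
  have : (law \x law)%E setT = 1%E.
    rewrite -setXTT product_measure1E//; transitivity (1 * 1 : \bar R)%E.
      by congr (_ * _)%E; exact: probability_setT.
    by rewrite mule1.
  by move=> HT; rewrite [X in (X < _)%E]HT ltry.
have Z0 : (\int[law]_y (Z y)%:E = 0)%E.
  have bZX : bounded_mfun (fun w => Z (X 0%N w)).
    case: bZ => mZ [M ZM]; split; first exact: (measurableT_comp mZ).
    by exists M => w; exact: ZM.
  have mZ : measurable_fun setT (EFin \o Z) by apply/measurable_EFinP; case: bZ.
  have iZ := probability_integrable P bZX.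
  rewrite [LHS](integral_pushforward (mX 0%N) mZ iZ measurableT) preimage_setT.
  rewrite -[LHS]fineK; last exact: integral_fune_fin_num.
  congr EFin; rewrite -[LHS]/(\int[P]_w (F (X 0%N w) - mean)).
  have bFX : bounded_mfun (fun w => F (X 0%N w)).
    case: bF => mF [M FM]; split; first exact: (measurableT_comp mF).
    by exists M => w; exact: FM.
  rewrite RintegralB//.
  - by rewrite Rintegral_cst_probability subrr.
  - exact: probability_integrable.
  - by apply: probability_integrable; exact: bounded_mfun_cst.
apply: integral0_eq => x _; rewrite /fubini_F /G/=.
under eq_integral do rewrite EFinM.
rewrite integralZl//; first by rewrite Z0 mule0.
exact: probability_integrable.
Qed.

End pairwise.

(** * Averages along the squares *)

Section gap.
Context {R : realType}.

Lemma exists_floor_sqrt N : (0 < N)%N -> exists k, (k.+1 ^ 2 <= N < k.+2 ^ 2)%N.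
Proof.
elim: N => // -[_ _|N IH _]; first by exists 0%N.
have [k /andP[k1 k2]] := IH isT.
have [Nk|kN] := ltnP N.+2 (k.+2 ^ 2); first by exists k; rewrite Nk (leq_trans k1).
exists k.+1; rewrite kN/=; apply: (leq_ltn_trans k2).
by rewrite ltn_sqr.
Qed.

(** If [(k + 1)^2 <= N < (k + 2)^2], at most [2 (k + 1)] bounded terms are added after the square;
    divided by [N >= (k + 1)^2] they are negligible. *)
Lemma cvg_avg_of_squares (y : nat -> R) (K : R) : (forall i, `|y i| <= K) ->
  (\sum_(i < n.+1 ^ 2) y i / (n.+1 ^ 2)%:R) @[n --> \oo] --> 0 ->
  (N%:R^-1 * \sum_(i < N) y i) @[N --> \oo] --> 0.
Proof.
move=> yK cs; have K0 : 0 <= K := le_trans (normr_ge0 _) (yK 0%N).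
apply/cvgrPdist_le => e e0.
have e2 : 0 < e / 2 by rewrite divr_gt0.
move/cvgrPdist_le : cs => /(_ _ e2)[N1 _ N1P].
(* For [k >= N2] one has [4 K <= e (k + 1)], so that the added terms weigh at most [e / 2]. *)
pose N2 := (Num.trunc (4 * K / e)).+1.
exists ((N1 + N2).+1 ^ 2)%N => // N /= NN.
have N0 : (0 < N)%N by apply: leq_trans NN; rewrite expn_gt0.
have [k /andP[k1 k2]] := exists_floor_sqrt N0.
have kN : (N1 + N2 <= k)%N.
  rewrite -2!ltnS; have := leq_ltn_trans NN k2; by rewrite ltn_sqr.
have := N1P k (leq_trans (leq_addr _ _) kN).
rewrite !sub0r !normrN; set q := (k.+1 ^ 2)%N in k1 *.
have q0 : 0 < q%:R :> R by rewrite ltr0n expn_gt0.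
have NR0 : 0 < N%:R :> R by rewrite ltr0n.
rewrite -mulr_suml normrM normfV (ger0_norm (ltW q0)) ler_pdivrMr// => sq.
rewrite normrM normfV (ger0_norm (ltW NR0)) ler_pdivrMl//.
have -> : \sum_(i < N) y i = \sum_(i < q) y i + \sum_(q <= i < N) y i.
  by rewrite -!(big_mkord xpredT) (big_cat_nat _ k1).
apply: le_trans (ler_normD _ _) _.
have rest : `|\sum_(q <= i < N) y i| <= (N - q)%:R * K.
  apply: le_trans (ler_norm_sum _ _ _) _.
  apply: le_trans (ler_sum _ (fun i _ => yK i)) _.
  by rewrite sumr_const_nat mulr_natl.
have qN : q%:R <= N%:R :> R by rewrite ler_nat.
have Nq : (N - q)%:R <= 2 * k.+1%:R :> R.
  rewrite -natrM ler_nat leq_subLR /q -ltnS; apply: leq_trans k2 _.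
  by rewrite leq_eqVlt; apply/orP; left; apply/eqP; ring.
have Ke : 4 * K <= e * k.+1%:R.
  rewrite [leRHS]mulrC -ler_pdivrMr// ltW//; apply: (lt_le_trans (truncnS_gt _)).
  by rewrite ler_nat -/N2 (leq_trans _ (leqnSn k))// (leq_trans _ kN)// leq_addl.
have qE : q%:R = k.+1%:R * k.+1%:R :> R by rewrite -natrM.
have k0 : 0 < k.+1%:R :> R by rewrite ltr0n.
rewrite qE in sq qN; have := ler_wpM2r K0 Nq; move: sq rest Ke qN k0.
move: (k.+1%:R : R) => kk; move: `|_| => s1; move: `|_| => s2.
move: ((N - q)%:R : R) => d; move: (N%:R : R) => NN'.
move=> sq rest Ke qN k0 dK.
have : 4 * K * kk <= e * kk * kk by rewrite ler_wpM2r// ltW.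
have := ler_wpM2l (ltW e0) qN.
lra.
Qed.

(** Telescoping; the induction needs the sharper bound with the remainder [- 1 / (n + 1)]. *)
Lemma sum_inv_sqr_le (n : nat) : \sum_(0 <= i < n) (i.+1%:R ^+ 2)^-1 <= 2 :> R.
Proof.
have H : \sum_(0 <= i < n.+1) (i.+1%:R ^+ 2)^-1 <= 2 - n.+1%:R^-1 :> R.
  elim: n => [|n IH]; first by rewrite big_nat1 expr1n invr1; lra.
  rewrite big_nat_recr//=; apply: (le_trans (lerD IH (lexx _))).
  have : (n.+2%:R ^+ 2)^-1 <= n.+1%:R^-1 - n.+2%:R^-1 :> R.
    have -> : n.+1%:R^-1 - n.+2%:R^-1 = (n.+1%:R * n.+2%:R)^-1 :> R.
      have E : n.+2%:R = n.+1%:R + 1 :> R by rewrite natr1.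
      have x0 : 0 < n.+1%:R :> R by [].
      rewrite E; move: (n.+1%:R : R) x0 => x x0; field.
      by rewrite !gt_eqF// addr_gt0.
    rewrite lef_pV2 ?posrE ?exprn_gt0 ?mulr_gt0 ?ltr0n// expr2.
    by rewrite ler_pM2r ?ltr0n// ler_nat.
  by rewrite -addrA lerD2l -lerBrDl opprK addrC.
apply: le_trans (le_trans H _); last by rewrite gerBl invr_ge0.
by rewrite big_nat_recr//= lerDl invr_ge0 exprn_ge0.
Qed.

End gap.

(** * The strong law of large numbers for bounded functions *)

Section slln.
Context d d' (Omega : measurableType d) (T : measurableType d') (R : realType).
Context (P : probability Omega R) (X : nat -> Omega -> T) (Q : set T -> \bar R).
Hypothesis iidX : iid P X Q.
Variables (F : T -> R).
Hypothesis bF : bounded_mfun F.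

Let mX i : measurable_fun setT (X i). Proof. by case: iidX. Qed.

Let mean := \int[P]_w F (X 0%N w).

Let Y i w := F (X i w) - mean.

Let bY i : bounded_mfun (Y i).
Proof.
apply: bounded_mfunD; last exact: bounded_mfun_cst.
case: bF => mF [M FM]; split; first exact: (measurableT_comp mF).
by exists M => w; exact: FM.
Qed.

Let Ybound : exists K : R, forall i w, `|Y i w| <= K.
Proof.
case: bF => _ [M FM]; exists (M + `|mean|) => i w.
by apply: le_trans (ler_normB _ _) _; rewrite lerD2r.
Qed.

Let S n w := \sum_(i < n) Y i w.

Let bS n : bounded_mfun (S n).
Proof. exact: bounded_mfun_sum. Qed.

(** Each new term is uncorrelated with the partial sum, so the second moments add up. *)
Lemma sum_second_moment K n : (forall i w, `|Y i w| <= K) ->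
  \int[P]_w (S n w) ^+ 2 <= n%:R * K ^+ 2.
Proof.
move=> YK; elim: n => [|n IH].
  under eq_Rintegral do rewrite /S big_ord0 expr0n/=.
  by rewrite Rintegral_cst_probability mul0r.
have bSY : bounded_mfun (fun w => S n w * Y n w) by exact: bounded_mfunM.
have SY0 : \int[P]_w (S n w * Y n w) = 0.
  under eq_Rintegral do rewrite /S mulr_suml.
  rewrite Rintegral_sum_bounded => [|i]; last exact: bounded_mfunM.
  apply: big1 => i _; apply: (iid_uncorrelated iidX) => //.
  by rewrite neq_ltn ltn_ord.
rewrite -natr1 mulrDl mul1r; apply: le_trans (lerD IH (lexx _)).
have bS2 : bounded_mfun (fun w => S n w ^+ 2).
  by under eq_fun do rewrite expr2; exact: bounded_mfunM.
pose B w := S n w ^+ 2 + (2 * (S n w * Y n w) + K ^+ 2).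
have b2SY : bounded_mfun (fun w => 2 * (S n w * Y n w)).
  by apply: bounded_mfunM => //; exact: bounded_mfun_cst.
have bB : bounded_mfun B.
  by do 2 (apply: bounded_mfunD => //); exact: bounded_mfun_cst.
apply: (@le_trans _ _ (\int[P]_w B w)).
  apply: le_Rintegral_bounded => // [|w].
    by under eq_fun do rewrite expr2; exact: bounded_mfunM.
  rewrite /B {1}/S big_ord_recr/= -/(S n w) sqrrD -addrA lerD2l -mulr_natl lerD2l.
  by rewrite -real_normK ?num_real// lerXn2r ?nnegrE// (le_trans (normr_ge0 _) (YK n w)).
rewrite /B RintegralD//; last 2 first.
- exact: probability_integrable.
- by apply: probability_integrable; apply: bounded_mfunD => //; exact: bounded_mfun_cst.
rewrite RintegralD//; last 2 first.
- exact: probability_integrable.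
- by apply: probability_integrable; exact: bounded_mfun_cst.
rewrite RintegralZl//; last exact: probability_integrable.
by rewrite SY0 mulr0 add0r Rintegral_cst_probability.
Qed.

Let sq n w : R := (S (n.+1 ^ 2) w / (n.+1 ^ 2)%:R) ^+ 2.

Let bsq n : bounded_mfun (sq n).
Proof.
rewrite /sq; under eq_fun do rewrite expr2.
by apply: bounded_mfunM; apply: bounded_mfunM => //; exact: bounded_mfun_cst.
Qed.

Let sq_ge0 n w : 0 <= sq n w.
Proof. exact: sqr_ge0. Qed.

(** Along the squares the second moments of the averages are at most [K^2 / (n + 1)^2], which is
    summable. The sum of the squared averages thus has finite expectation, is almost surely finite,
    and its terms tend to 0. *)
Lemma ae_cvg_sq : {ae P, forall w, sq n w @[n --> \oo] --> 0}.
Proof.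
have [K YK] := Ybound.
have intsq n : (\int[P]_w (sq n w)%:E <= (K ^+ 2 * (n.+1%:R ^+ 2)^-1)%:E)%E.
  have isq := probability_integrable P (bsq n).
  rewrite -[leLHS]fineK; last exact: integral_fune_fin_num.
  rewrite lee_fin -[leLHS]/(\int[P]_w (sq n w)).
  under eq_Rintegral do rewrite /sq exprMn exprVn.
  rewrite RintegralZr//; last first.
    apply: probability_integrable; under eq_fun do rewrite expr2.
    exact: bounded_mfunM.
  have p0 : 0 < (n.+1 ^ 2)%:R :> R by rewrite ltr0n expn_gt0.
  rewrite ler_pdivrMr ?exprn_gt0//.
  apply: le_trans (sum_second_moment _ YK) _.
  rewrite natrX; rewrite natrX in p0.
  have n0 : n.+1%:R != 0 :> R by rewrite pnatr_eq0.
  rewrite le_eqVlt; apply/orP; left; apply/eqP.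
  by move: (n.+1%:R : R) n0 => x x0; field.
have msq n : measurable_fun setT (fun w => (sq n w)%:E).
  by apply/measurable_EFinP; case: (bsq n).
have tot : (\int[P]_w (\sum_(n <oo) (sq n w)%:E) <= (K ^+ 2 * 2)%:E)%E.
  rewrite integral_nneseries//; last by move=> n w _; rewrite lee_fin.
  apply: lime_le.
    by apply: is_cvg_nneseries => n _ _; apply: integral_ge0 => w _; rewrite lee_fin.
  apply: nearW => n.
  apply: (@le_trans _ _ (\sum_(0 <= i < n) (K ^+ 2 * (i.+1%:R ^+ 2)^-1)%:E)%E).
    by apply: lee_sum => i _; exact: intsq.
  rewrite sumEFin lee_fin -mulr_sumr ler_wpM2l ?sqr_ge0//.
  exact: sum_inv_sqr_le.
have iS : P.-integrable setT (fun w => \sum_(n <oo) (sq n w)%:E)%E.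
  apply/integrableP; split.
    by apply: ge0_emeasurable_sum => // n w _; rewrite lee_fin.
  rewrite (eq_integral (fun w => \sum_(n <oo) (sq n w)%:E))%E; last first.
    by move=> w _; rewrite gee0_abs// nneseries_ge0// => n _ _; rewrite lee_fin.
  by apply: le_lt_trans tot _; rewrite ltry.
have := integrable_ae measurableT iS; apply: filterS => w /(_ I) fin.
apply: cvg_series_cvg_0; apply: nondecreasing_is_cvgn.
  by apply/nondecreasing_seqP => n; rewrite /series/= big_nat_recr//= lerDl.
exists (fine (\sum_(n <oo) (sq n w)%:E)%E) => _ [n _ <-].
rewrite -lee_fin fineK// /series/= -sumEFin.
by apply: nneseries_lim_ge => k _ _; rewrite lee_fin.
Qed.

Theorem slln_bounded : {ae P, forall w,
  (N%:R^-1 * \sum_(i < N) F (X i w)) @[N --> \oo] --> \int[P]_w F (X 0%N w)}.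
Proof.
have [K YK] := Ybound.
apply: filterS ae_cvg_sq => w sq0.
have c0 : (N%:R^-1 * \sum_(i < N) Y i w) @[N --> \oo] --> 0.
  apply: (@cvg_avg_of_squares _ (Y ^~ w) K) => [i|]; first exact: YK.
  apply/cvgrPdist_le => e e0; move/cvgrPdist_le : sq0 => /(_ (e ^+ 2)).
  rewrite exprn_gt0// => /(_ isT); apply: filterS => n.
  rewrite !sub0r !normrN -mulr_suml (ger0_norm (sq_ge0 _ _)) /sq.
  by rewrite -real_normK ?num_real// ler_pXn2r// nnegrE ltW.
have c1 : (N%:R^-1 * \sum_(i < N) Y i w + mean) @[N --> \oo] --> mean.
  by rewrite -[X in _ --> X]add0r; apply: cvgD => //; exact: cvg_cst.
(* The two averages differ at [N = 0], where both prefactors are 0 and [mean] is added back. *)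
apply: cvg_trans c1; apply: near_eq_cvg; exists 1%N => // N /= N0.
have {}N0 : N%:R != 0 :> R by rewrite pnatr_eq0 -lt0n.
rewrite /Y sumrB sumr_const card_ord -[X in _ - X]mulr_natr.
by move: (\sum_(i < N) _) => s; field.
Qed.

End slln.

(** * A uniform law of large numbers on a compact set *)

Lemma ball_uniform_cvg (U : choiceType) (R : realType) (V : pseudoMetricType R)
    (K : set U) (f : nat -> U -> V) (phi : U -> V) :
  (forall e : R, 0 < e -> \forall N \near \oo, forall x, K x -> ball (phi x) e (f N x)) ->
  {uniform K, f @ \oo --> phi}.
Proof.
move=> H A /uniform_nbhs[E [entE EA]]; apply: filterS EA _.
move: entE; rewrite -entourage_ballE => -[e /= e0 eE].
by apply: filterS (H e e0) => N HN x Kx; apply: eE; exact: HN.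
Qed.

Section ulln.
Context d d' (Omega : measurableType d) (T : measurableType d') (R : realType).
Context (P : probability Omega R) (X : nat -> Omega -> T) (Q : set T -> \bar R).
Hypothesis iidX : iid P X Q.
Variable Y : ptopologicalType.
Variables (K : set Y) (f : Y -> T -> R) (phi : Y -> R).
Hypothesis cK : compact K.

(** [F] depends on [t] alone, so that one application of the strong law covers a whole neighbourhood
    of [x]. Measurability and boundedness are asked of [F], which suits gradients: these are
    controlled on the almost sure set [G] only. *)
Definition locally_approximable (x : Y) (e : R) := exists F : T -> R, exists G : set T,
  [/\ bounded_mfun F, {ae P, forall w, forall i, G (X i w)} &
   \forall x' \near x, (forall t, G t -> `|f x' t - F t| <= e) /\
                       `|phi x' - \int[P]_w F (X 0%N w)| <= e].

Let avg (h : T -> R) N w := N%:R^-1 * \sum_(i < N) h (X i w).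

Let avg_close (g h : T -> R) (G : set T) e N w : 0 <= e ->
  (forall t, G t -> `|g t - h t| <= e) -> (forall i, G (X i w)) ->
  `|avg g N w - avg h N w| <= e.
Proof.
move=> e0 gh GX; rewrite /avg -mulrBr -sumrB normrM.
case: N => [|N]; first by rewrite invr0 normr0 mul0r.
rewrite normfV (ger0_norm (ler0n R N.+1)) ler_pdivrMl//.
apply: le_trans (ler_norm_sum _ _ _) _.
apply: (@le_trans _ _ (\sum_(i < N.+1) e)).
  by apply: ler_sum => i _; exact: gh.
by rewrite sumr_const card_ord mulr_natl.
Qed.

(** A finite cover of [K] leaves finitely many [F]. The three errors are: the sample mean of [f x]
    against that of [F], the latter against the expectation of [F], and this expectation against
    [phi x]. *)
Lemma ulln_fixed e : 0 < e -> (forall x, K x -> locally_approximable x e) ->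
  {ae P, forall w, \forall N \near \oo, forall x, K x ->
     `|phi x - avg (f x) N w| <= 3 * e}.
Proof.
move=> e0 app.
have /choice[F FP] : forall x : Y, exists F : T -> R, K x -> exists G : set T,
    [/\ bounded_mfun F, {ae P, forall w, forall i, G (X i w)} &
   \forall x' \near x, (forall t, G t -> `|f x' t - F t| <= e) /\
                       `|phi x' - \int[P]_w F (X 0%N w)| <= e].
  move=> x; have [Kx|nKx] := pselect (K x); last by exists (fun=> 0).
  by have [F [G H]] := app x Kx; exists F => _; exists G.
have /choice[G GP] : forall x : Y, exists G : set T, K x ->
    [/\ bounded_mfun (F x), {ae P, forall w, forall i, G (X i w)} &
   \forall x' \near x, (forall t, G t -> `|f x' t - F x t| <= e) /\
                       `|phi x' - \int[P]_w F x (X 0%N w)| <= e].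
  move=> x; have [Kx|nKx] := pselect (K x); last by exists set0.
  by have [G H] := FP x Kx; exists G.
pose V x := [set x' | (forall t, G x t -> `|f x' t - F x t| <= e) /\
                       `|phi x' - \int[P]_w F x (X 0%N w)| <= e].
have cov : cover_compact K by rewrite -compact_cover.
case: (cov Y K (fun x => interior (V x))).
- by move=> x _; exact: open_interior.
- by move=> x Kx; exists x => //; have [_ _] := GP x Kx.
move=> D DK Kcov; pose s := finmap.enum_fset D.
(* [ohead (drop j s)] is the [j]-th centre of the cover, if any: indexing by naturals gives a
   countable intersection of almost sure events, and no default centre is required. *)
have gd : {ae P, forall w, forall j x, ohead (drop j s) = Some x -> K x ->
    (forall i, G x (X i w)) /\
    (avg (F x) N w @[N --> \oo] --> \int[P]_w F x (X 0%N w))}.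
  apply: ae_foralln => j.
  case E : (ohead (drop j s)) => [x|]; last by apply: filterE => w y.
  have [Kx|nKx] := pselect (K x); last by apply: filterE => w y [<-].
  have [bF aeG _] := GP x Kx.
  have := slln_bounded iidX bF; apply: filterS2 aeG => w Gw cw y [<-] _.
  by split.
apply: filterS gd => w gw.
have nr : \forall N \near \oo, forall j : 'I_(size s), forall x,
    ohead (drop j s) = Some x -> K x ->
    `|avg (F x) N w - \int[P]_w F x (X 0%N w)| <= e.
  apply: filter_forall => j.
  case E : (ohead (drop j s)) => [x|]; last by apply: nearW => w' y.
  have [Kx|nKx] := pselect (K x); last by apply: nearW => w' y [<-].
  have [_ /cvgrPdist_le/(_ _ e0)] := gw j x E Kx.
  by apply: filterS => N HN y [<-] _; rewrite distrC.
apply: filterS nr => N HN x Kx.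
have [x0 x0D Vx] := Kcov x Kx.
have x0s : x0 \in s by exact: x0D.
have js : (index x0 s < size s)%N by rewrite index_mem.
have E : ohead (drop (index x0 s) s) = Some x0.
  by rewrite (drop_nth x0)//= nth_index.
have Kx0 : K x0 by exact/set_mem/DK.
have [GX _] := gw _ _ E Kx0.
have [fF phiF] := interior_subset Vx.
have := HN (Ordinal js) x0 E Kx0.
have := avg_close N (ltW e0) fF GX; move: phiF.
rewrite -/(avg _ _ _); move: (avg _ _ _) => a; move: (avg _ _ _) => b.
move: (\int[P]_w _) (phi x) => c d0; rewrite !ler_norml => /andP[? ?] /andP[? ?] /andP[? ?].
by apply/andP; split; lra.
Qed.

Lemma ulln : (forall x e, K x -> 0 < e -> locally_approximable x e) ->
  {ae P, forall w, forall e, 0 < e -> \forall N \near \oo, forall x, K x ->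
     `|phi x - N%:R^-1 * \sum_(i < N) f x (X i w)| <= e}.
Proof.
move=> app; have : {ae P, forall w, forall k : nat, \forall N \near \oo, forall x, K x ->
     `|phi x - avg (f x) N w| <= 3 * k.+1%:R^-1}.
  by apply: ae_foralln => k; apply: ulln_fixed => // x Kx; exact: app.
apply: filterS => w H e e0.
have [k ke] : exists k : nat, k.+1%:R^-1 < e / 3.
  have /ltr_add_invr[k] : (0 : R) < e / 3 by rewrite divr_gt0.
  by rewrite add0r; exists k.
apply: filterS (H k) => N HN x Kx; apply: le_trans (HN x Kx) _.
by move/ltW: ke; rewrite ler_pdivlMr// mulrC.
Qed.

End ulln.

(** * Differentiation under the expectation *)

Section parametric_mean.
Context d d' (Omega : measurableType d) (T : measurableType d') (R : realType) (n : nat).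
Context (P : probability Omega R) (Z : Omega -> T).
Hypothesis mZ : measurable_fun setT Z.
Variable G : set T.
Hypotheses (mG : measurable G) (GZ : {ae P, forall w, G (Z w)}).
Implicit Types h k : T -> R.

Let mean h := \int[P]_w h (Z w).

Let bounded_comp h : bounded_mfun h -> bounded_mfun (h \o Z).
Proof. by move=> [mh [M hM]]; split; [exact: measurableT_comp|exists M => w; exact: hM]. Qed.

Lemma bounded_mfunN h : bounded_mfun h -> bounded_mfun (fun t => - h t).
Proof. by move=> [mh [M hM]]; split; [exact: measurableT_comp|exists M => t; rewrite normrN]. Qed.

Lemma meanB h k : bounded_mfun h -> bounded_mfun k ->
  mean (fun t => h t - k t) = mean h - mean k.
Proof.
by move=> bh bk; rewrite /mean RintegralB//; apply: probability_integrable; exact: bounded_comp.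
Qed.

Lemma mean_dotr (D : 'I_n -> T -> R) (v : 'rV[R]_n) : (forall i, bounded_mfun (D i)) ->
  mean (fun t => \sum_(i < n) v 0 i * D i t) = dotr (\row_i mean (D i)) v.
Proof.
move=> bD; rewrite /mean Rintegral_sum_bounded; last first.
  by move=> i; apply: (bounded_comp (bounded_mfunM (bounded_mfun_cst _ (v 0 i)) (bD i))).
apply: eq_bigr => i _; rewrite mxE RintegralZl//.
by apply: probability_integrable; exact: bounded_comp.
Qed.

Lemma mean_le h (M : R) : bounded_mfun h -> (forall t, G t -> `|h t| <= M) -> `|mean h| <= M.
Proof.
move=> bh hM.
have b1 : bounded_mfun (\1_G : T -> R).
  split; first exact: measurable_indic.
  by exists 1 => t; rewrite indicE normr_nat lern1 leq_b1.
have -> : mean h = mean (fun t => h t * \1_G t).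
  rewrite /mean /Rintegral; congr fine; apply: ae_eq_integral => //.
  - by apply/measurable_EFinP; exact: (bounded_comp bh).1.
  - by apply/measurable_EFinP; exact: (bounded_comp (bounded_mfunM bh b1)).1.
  - by apply: filterS GZ => w Gw _; rewrite indicE mem_set// mulr1.
(* Were [M] negative, [G] would be empty, against the total mass 1. *)
have M0 : 0 <= M.
  rewrite leNgt; apply/negP => M0; have : P setT = 0%E.
    have [N [mN PN sN]] := GZ.
    apply/eqP; rewrite -measure_le0 -PN le_measure ?inE// => w _; apply: sN => /= /hM.
    by move=> hw; have := le_lt_trans (le_trans (normr_ge0 _) hw) M0; rewrite ltxx.
  by have -> := @probability_setT _ _ _ P; move/eqP; rewrite onee_eq0.
have bhG := bounded_comp (bounded_mfunM bh b1).
have hG t : `|h t * \1_G t| <= M.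
  by rewrite indicE; case: (boolP (t \in G)) => [/set_mem/hM|_]; rewrite ?mulr1// mulr0 normr0.
rewrite ler_norml; apply/andP; split.
  rewrite -[leLHS](Rintegral_cst_probability P); apply: le_Rintegral_bounded => //.
    exact: bounded_mfun_cst.
  by move=> w; have := hG (Z w); rewrite ler_norml => /andP[].
rewrite -[leRHS](Rintegral_cst_probability P); apply: le_Rintegral_bounded => //.
  exact: bounded_mfun_cst.
by move=> w; have := hG (Z w); rewrite ler_norml => /andP[].
Qed.

Variables (f : 'rV[R]_n -> T -> R) (D : 'rV[R]_n -> T -> 'rV[R]_n).
Variable W : set 'rV[R]_n.
Hypotheses (bf : forall x, bounded_mfun (f x)) (f1 : forall x t, `|f x t| <= 1).
Hypothesis oW : open W.
Hypothesis fD : forall x e, W x -> 0 < e -> \forall x' \near x, forall t, G t ->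
  `|f x' t - f x t - dotr (D x t) (x' - x)| <= e * `|x' - x| /\
  forall i, `|D x' t 0 i - D x t 0 i| <= e.

Lemma gradient_pointwise x t : W x -> G t -> gradient (f^~ t) x = D x t.
Proof.
move=> Wx Gt; apply: gradient_dotr => e e0.
by apply: filterS (fD Wx e0) => x' /(_ t Gt)[].
Qed.

Let norm_delta i : `|delta_mx 0 i : 'rV[R]_n| <= 1.
Proof.
apply: norm_le_coord => // j; rewrite mxE eqxx /=.
by case: eqP => _; rewrite ?normr1 ?normr0.
Qed.

Let dotr_delta (v : 'rV[R]_n) (s : R) i : dotr v (s *: delta_mx 0 i) = s * v 0 i.
Proof.
rewrite /dotr (bigD1 i)//= !mxE !eqxx mulr1 big1 ?addr0// => j ji.
by rewrite !mxE (negPf ji) andbF mulr0 mul0r.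
Qed.

Let quotient_close x i e : W x -> 0 < e -> exists2 s0 : R, 0 < s0 &
  forall s t, 0 < s -> s < s0 -> G t ->
    `|s^-1 * (f (x + s *: delta_mx 0 i) t - f x t) - D x t 0 i| <= e.
Proof.
move=> Wx e0; have /nbhs_ballP[s0 /= s00 H] := fD Wx e0; exists s0 => // s t s_gt0 ss Gt.
have sd : `|s *: delta_mx 0 i : 'rV[R]_n| <= s.
  by rewrite normrZ gtr0_norm// ler_piMr// ltW.
have xs : ball x s0 (x + s *: delta_mx 0 i).
  by rewrite -ball_normE /ball_ /= opprD addNKr normrN (le_lt_trans sd).
have [+ _] := H _ xs t Gt; rewrite [x + _]addrC addrK dotr_delta => Hs.
rewrite -(ler_pM2l s_gt0) -{1}(gtr0_norm s_gt0) -normrM mulrBr mulVKf ?gt_eqF//.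
apply: le_trans Hs _.
by rewrite mulrC ler_wpM2r// ltW.
Qed.

(** As [f] is bounded by 1, a difference quotient of fixed step [s] is at most [2 / s]; for a step
    within the radius of the uniform expansion it lies within 1 of the gradient. *)
Lemma gradient_bounded x : W x -> exists2 M : R, 0 <= M &
  forall t i, G t -> `|D x t 0 i| <= M.
Proof.
move=> Wx.
have H i : exists M : R, forall t, G t -> `|D x t 0 i| <= M.
  have [s0 s00 H] := quotient_close i Wx ltr01; pose s := s0 / 2.
  have sp : 0 < s by rewrite divr_gt0.
  exists (1 + s^-1 * 2) => t Gt; have ss : s < s0 by rewrite /s; lra.
  have := H s t sp ss Gt; set q := s^-1 * (_ - _) => qD.
  have qs : `|q| <= s^-1 * 2.
    have si : 0 < s^-1 by rewrite invr_gt0.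
    rewrite /q normrM (gtr0_norm si) (ler_pM2l si).
    by apply: le_trans (ler_normB _ _) _; have := f1 x t; have := f1 (x + s *: delta_mx 0 i) t; lra.
  rewrite -[X in `|X|](subrK q); apply: (le_trans (ler_normD _ _)).
  by rewrite distrC; apply: lerD.
have /choice[M MP] := H.
exists (\sum_(i < n) `|M i|); first by rewrite sumr_ge0.
move=> t i Gt; apply: le_trans (MP i t Gt) _; apply: le_trans (ler_norm _) _.
by rewrite (bigD1 i)//= lerDl sumr_ge0.
Qed.

(** On [G] the entry is a limit of difference quotients, which are measurable in [t]; the indicator
    discards the [t] where [D] is not controlled. *)
Lemma bounded_mfun_gradient x i : W x -> bounded_mfun (fun t => D x t 0 i * \1_G t).
Proof.
move=> Wx; split; last first.
  have [M M0 DM] := gradient_bounded Wx; exists M => t.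
  rewrite indicE; case: (boolP (t \in G)) => [/set_mem|_]; last by rewrite mulr0 normr0.
  by rewrite mulr1; exact: DM.
pose q (k : nat) t := k.+1%:R * (f (x + k.+1%:R^-1 *: delta_mx 0 i) t - f x t) * \1_G t.
apply: (@measurable_fun_cvg _ _ _ _ q).
  move=> k; apply: measurable_funM; last exact: measurable_indic.
  by apply: measurable_funM => //; apply: measurable_funB; exact: (bf _).1.
move=> t _; rewrite /q indicE; case: (boolP (t \in G)) => [/set_mem Gt|_]; last first.
  by under eq_cvg do rewrite mulr0; rewrite mulr0; exact: cvg_cst.
under eq_cvg do rewrite mulr1.
rewrite mulr1; apply/cvgrPdist_le => e e0.
have [s0 s00 H] := quotient_close i Wx e0.
have [k0 ks] : exists k : nat, k.+1%:R^-1 < s0.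
  by have /ltr_add_invr[k] := s00; rewrite add0r; exists k.
near=> k; rewrite distrC -{1}[k.+1%:R]invrK; apply: H => //.
apply: le_lt_trans ks; rewrite lef_pV2 ?posrE// ler_nat ltnS.
by near: k; exact: nbhs_infty_ge.
Unshelve. all: by end_near. Qed.

Definition mean_gradient x := \row_i mean (fun t => D x t 0 i * \1_G t).

(** The error of the first-order expansion is uniform on [G], so it passes to the mean with the same
    bound. *)
Lemma gradient_mean x : W x ->
  differentiable (fun x => mean (f x)) x /\ gradient (fun x => mean (f x)) x = mean_gradient x.
Proof.
move=> Wx.
have H e : 0 < e -> \forall y \near x,
    `|mean (f y) - mean (f x) - dotr (mean_gradient x) (y - x)| <= e * `|y - x|.
  move=> e0; apply: filterS (fD Wx e0) => y Hy.
  have bD i := bounded_mfun_gradient i Wx.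
  have bS : bounded_mfun (fun t => \sum_(i < n) (y - x) 0 i * (D x t 0 i * \1_G t)).
    by apply: bounded_mfun_sum => i; apply: bounded_mfunM => //; exact: bounded_mfun_cst.
  have bB : bounded_mfun (fun t => f y t - f x t).
    by apply: bounded_mfunD => //; exact: bounded_mfunN.
  rewrite -(mean_dotr _ bD) -meanB// -meanB//; apply: mean_le.
    by apply: bounded_mfunD => //; exact: bounded_mfunN.
  move=> t Gt; have [+ _] := Hy t Gt; congr (`|_ - _| <= _).
  by apply: eq_bigr => i _; rewrite indicE mem_set// mulr1.
by split; [exact: (differentiable_dotr H).1|exact: gradient_dotr].
Qed.

Lemma value_near x e : W x -> 0 < e -> \forall x' \near x,
  (forall t, G t -> `|f x' t - f x t| <= e) /\ `|mean (f x') - mean (f x)| <= e.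
Proof.
move=> Wx e0; have [M M0 DM] := gradient_bounded Wx.
(* A local Lipschitz constant: [n * M] from the gradient, and 1 from the expansion with error rate
   1. *)
pose c := n%:R * M + 1.
have c0 : 0 < c by rewrite ltr_wpDl// mulr_ge0.
have : \forall x' \near x, forall t, G t -> `|f x' t - f x t| <= e.
  near=> x' => t Gt.
  have xx : `|x' - x| <= e / c.
    by rewrite distrC; near: x'; apply: cvgr_dist_le; [exact: cvg_id|rewrite divr_gt0].
  have [+ _] : `|f x' t - f x t - dotr (D x t) (x' - x)| <= 1 * `|x' - x| /\
      forall i, `|D x' t 0 i - D x t 0 i| <= 1.
    by move: t Gt; near: x'; exact: fD.
  rewrite mul1r => H; have := dotr_le (x' - x) (fun i => DM t i Gt) => H2.
  rewrite -[f x' t - _](subrK (dotr (D x t) (x' - x))).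
  apply: le_trans (ler_normD _ _) _; apply: le_trans (lerD H H2) _.
  rewrite -[X in X + _]mul1r -mulrDl addrC -/c.
  by rewrite -[leRHS](divfK (lt0r_neq0 c0)) mulrC ler_wpM2r// ltW.
apply: filterS => x' H; split => //; rewrite -meanB//; apply: mean_le => //.
by apply: bounded_mfunD => //; exact: bounded_mfunN.
Unshelve. all: by end_near. Qed.

Lemma gradient_near x e i : W x -> 0 < e -> \forall x' \near x,
  (forall t, G t -> `|gradient (f^~ t) x' 0 i - D x t 0 i * \1_G t| <= e) /\
  `|gradient (fun x => mean (f x)) x' 0 i - mean (fun t => D x t 0 i * \1_G t)| <= e.
Proof.
move=> Wx e0; near=> x'.
have Wx' : W x' by near: x'; exact: open_nbhs_nbhs.
have DD : forall t, G t -> `|D x' t 0 i - D x t 0 i| <= e.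
  near: x'; apply: filterS (fD Wx e0) => x' H t Gt.
  by have [_] := H t Gt; exact.
split=> [t Gt|].
  by rewrite (gradient_pointwise Wx' Gt) indicE mem_set// mulr1; exact: DD.
rewrite (gradient_mean Wx').2 /mean_gradient mxE -meanB; try exact: bounded_mfun_gradient.
apply: mean_le.
  by apply: bounded_mfunD; [|apply: bounded_mfunN]; exact: bounded_mfun_gradient.
by move=> t Gt; rewrite -mulrBl indicE mem_set// mulr1; exact: DD.
Unshelve. all: by end_near. Qed.

End parametric_mean.

(** * Uniform convergence of sample means and of their gradients *)

Section parametric_ulln.
Context d d' (Omega : measurableType d) (T : measurableType d') (R : realType) (n : nat).
Context (P : probability Omega R) (X : nat -> Omega -> T) (Q : set T -> \bar R).
Hypothesis iidX : iid P X Q.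
Variables (f : 'rV[R]_n -> T -> R) (K : set 'rV[R]_n).
Hypotheses (bf : forall x, bounded_mfun (f x)) (f1 : forall x t, `|f x t| <= 1).
Hypothesis cK : compact K.

Let phi x := \int[P]_w f x (X 0%N w).

Hypothesis fK : forall x, K x -> exists W D G, [/\ open_nbhs x W, measurable G,
  {ae P, forall w, forall i, G (X i w)} &
  forall x1 e, W x1 -> 0 < e -> \forall x' \near x1, forall t, G t ->
    `|f x' t - f x1 t - dotr (D x1 t) (x' - x1)| <= e * `|x' - x1| /\
    forall i, `|D x' t 0 i - D x1 t 0 i| <= e].

Let mX0 : measurable_fun setT (X 0%N). Proof. by case: iidX. Qed.

Lemma parametric_ulln : (forall x, K x -> differentiable phi x) /\
  {ae P, forall w,
    {uniform K, (fun N x => N%:R^-1 * \sum_(i < N) f x (X i w)) @ \oo --> phi} /\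
    {uniform K, (fun N x => N%:R^-1 *: \sum_(i < N) gradient (f^~ (X i w)) x)
      @ \oo --> gradient phi}}.
Proof.
have G0 (G : set T) : {ae P, forall w, forall i, G (X i w)} -> {ae P, forall w, G (X 0%N w)}.
  by apply: filterS => w; exact.
split=> [x /fK[W [D [G [[oW Wx] mG aeG fD]]]]|].
  exact: (gradient_mean mX0 mG (G0 _ aeG) bf f1 fD Wx).1.
have ae1 : {ae P, forall w e, 0 < e -> \forall N \near \oo, forall x, K x ->
    `|phi x - N%:R^-1 * \sum_(i < N) f x (X i w)| <= e}.
  apply: (ulln iidX cK) => x e /fK[W [D [G [[oW Wx] mG aeG fD]]]] e0.
  exists (f x), G; split => //.
  exact: (value_near mX0 mG (G0 _ aeG) bf f1 fD Wx e0).
(* Gradients are treated coordinate by coordinate: there are finitely many, and the sup norm is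
   bounded through them. *)
have ae2 : {ae P, forall w (i : 'I_n) e, 0 < e -> \forall N \near \oo, forall x, K x ->
    `|gradient phi x 0 i - N%:R^-1 * \sum_(j < N) gradient (f^~ (X j w)) x 0 i| <= e}.
  apply: filter_forall => i.
  apply: (ulln iidX cK (f := fun x t => gradient (f^~ t) x 0 i) (phi := fun x => gradient phi x 0 i)).
  move=> x e /fK[W [D [G [[oW Wx] mG aeG fD]]]] e0.
  exists (fun t => D x t 0 i * \1_G t), G; split => //.
    exact: (bounded_mfun_gradient mG bf f1 fD i Wx).
  exact: (gradient_near mX0 mG (G0 _ aeG) bf f1 oW fD i Wx e0).
apply: filterS2 ae1 ae2 => w H1 H2; split; apply: ball_uniform_cvg => e e0.
  have e2 : 0 < e / 2 by rewrite divr_gt0.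
  apply: filterS (H1 _ e2) => N H x Kx.
  by rewrite -ball_normE /ball_ /=; apply: le_lt_trans (H x Kx) _; lra.
have e2 : 0 < e / 2 by rewrite divr_gt0.
have : \forall N \near \oo, forall i x, K x ->
    `|gradient phi x 0 i - N%:R^-1 * \sum_(j < N) gradient (f^~ (X j w)) x 0 i| <= e / 2.
  by apply: filter_forall => i; exact: H2.
apply: filterS => N H x Kx; rewrite -ball_normE /ball_ /=.
apply: (@le_lt_trans _ _ (e / 2)); last by lra.
apply: norm_le_coord => [|i]; first exact: ltW.
by rewrite !mxE summxE; exact: H.
Qed.

End parametric_ulln.

(** * The probability function as a mean of radial probabilities *)

Section norm2_bounds.
Context {R : realType}.

Lemma coord_le_norm2 k (u : 'rV[R]_k) j : `|u 0 j| <= norm2 u.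
Proof.
rewrite -(ler_pXn2r (n := 2)) ?nnegrE ?norm2_ge0// norm2_sqr real_normK ?num_real//.
by rewrite (bigD1 j)//= lerDl sumr_ge0// => i _; exact: sqr_ge0.
Qed.

Lemma norm_le_norm2 k (u : 'rV[R]_k) : `|u| <= norm2 u.
Proof. by apply: norm_le_coord (norm2_ge0 u) _ => j; exact: coord_le_norm2. Qed.

Lemma norm2_le_sum k (u : 'rV[R]_k) : norm2 u <= \sum_(j < k) `|u 0 j|.
Proof.
have S0 : 0 <= \sum_(j < k) `|u 0 j| by rewrite sumr_ge0.
rewrite -(ler_pXn2r (n := 2)) ?nnegrE ?norm2_ge0// norm2_sqr expr2 mulr_suml.
apply: ler_sum => j _; rewrite -[leLHS]real_normK ?num_real// expr2 ler_wpM2l//.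
by rewrite (bigD1 j)//= lerDl sumr_ge0.
Qed.

Lemma norm2_le_norm k (u : 'rV[R]_k) : norm2 u <= k%:R * `|u|.
Proof.
apply: le_trans (norm2_le_sum u) _.
apply: (@le_trans _ _ (\sum_(j < k) `|u|)); first by apply: ler_sum => j _; exact: coord_le_norm.
by rewrite sumr_const card_ord -[leLHS]mulr_natl.
Qed.

Let has_ubound_opnorm k (A : 'M[R]_k) :
  has_ubound [set norm2 (v *m A^T) | v in [set v : 'rV[R]_k | norm2 v <= 1]].
Proof.
exists (\sum_(j < k) \sum_(i < k) `|A j i|) => _ [v /= v1 <-].
apply: le_trans (norm2_le_sum _) _; apply: ler_sum => j _; rewrite mxE.
apply: le_trans (ler_norm_sum _ _ _) _; apply: ler_sum => i _.
by rewrite normrM mxE ler_piMl// (le_trans (coord_le_norm2 v i)).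
Qed.

Lemma norm2_mul_le_opnorm k (A : 'M[R]_k) (v : 'rV[R]_k) : norm2 v <= 1 ->
  norm2 (v *m A^T) <= opnorm A.
Proof. by move=> v1; apply: (ub_le_sup (@has_ubound_opnorm k A)); exists v. Qed.

Lemma opnorm_ge0 k (A : 'M[R]_k) : 0 <= opnorm A.
Proof.
apply: le_trans (norm2_mul_le_opnorm A (v := 0) _); first exact: norm2_ge0.
by rewrite (eqP (_ : norm2 0 == 0)) ?norm2_eq0.
Qed.

End norm2_bounds.

(** * The growth condition in terms of the total differential *)

Section partial_gradient.
Context {R : realType} (n m : nat).
Variable g : 'rV[R]_n * 'rV[R]_m -> R.
Hypothesis g_C1 : continuously_differentiable g.

Lemma gradient_partial x y i : gradient (fun x' => g (x', y)) x 0 i = dg g (x, y) (delta_mx 0 i, 0).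
Proof.
case: g_C1 => dgg _.
have di : differentiable (fun x' : 'rV[R]_n => x') x by exact: ex_diff.
have dc : differentiable (fun=> y : 'rV[R]_m) x by exact: differentiable_cst.
have dp : differentiable (fun x' : 'rV[R]_n => (x', y)) x by exact: differentiable_pair.
have df : differentiable (fun x' => g (x', y)) x.
  exact: (differentiable_comp (f := fun x' => (x', y)) dp (dgg (x, y))).
rewrite /gradient asboolT// mxE.
rewrite (_ : 'd _ x = 'd (g \o (fun x' => (x', y))) x)// diff_comp//= diff_pair//.
by rewrite (diff_cst y x) (diff_val (f := id)).
Qed.

Lemma exp_growth_dg x0 : exp_growth_at g x0 -> (0 < m)%N ->
  exists eps a b : R, [/\ 0 < eps, 0 < a, 0 < b &
    forall x y h, ball x0 eps x -> `|dg g (x, y) (h, 0)| <= a * expR (b * `|y|) * `|h|].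
Proof.
move=> [eps [a [b [eps0 a0 b0 growth]]]] m0.
have n0 : 0 < n.+1%:R :> R by rewrite ltr0n.
(* Conversion to sup norms: [norm2] is at most the dimension times the sup norm, which affects the
   radius through [x] and the rate through [y], while [dotr] sums [n] entries. The successor avoids
   a division by 0. *)
exists (eps / n.+1%:R), (n.+1%:R * a), (b * m%:R); split.
- by rewrite divr_gt0.
- by rewrite mulr_gt0.
- by rewrite mulr_gt0// ltr0n.
move=> x y h xb.
have xe : norm2 (x - x0) < eps.
  apply: le_lt_trans (norm2_le_norm _) _.
  move: xb; rewrite -ball_normE /ball_ /= distrC ltr_pdivlMr// mulrC => xb.
  by apply: le_lt_trans xb; rewrite ler_wpM2r// ler_nat.
have G := growth x y xe.
have -> : dg g (x, y) (h, 0) = dotr (gradient (fun x' => g (x', y)) x) h.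
  by rewrite /dg diff_pairl; apply: eq_bigr => i _; rewrite gradient_partial.
have Gi i : `|gradient (fun x' => g (x', y)) x 0 i| <= a * expR (b * m%:R * `|y|).
  apply: le_trans (coord_le_norm2 _ i) (le_trans G _).
  by rewrite ler_pM2l// ler_expR -mulrA ler_pM2l// norm2_le_norm.
apply: le_trans (dotr_le h Gi) _; rewrite ler_wpM2r// -[leRHS]mulrA ler_wpM2r ?ler_nat//.
by rewrite mulr_ge0 ?expR_ge0// ltW.
Qed.

End partial_gradient.

(** * Measurability and the polar form of the probability function *)

Section radial_representation.
Context {R : realType} (n m p : nat) (m0 : (0 < m)%N).
Notation leb := (@lebesgue_measure R).
Notation chi := (@chi_density R m).
Notation T := ('rV[R]_m * 'rV[R]_p)%type.
Variables (C : set 'rV[R]_p) (mC : measurable C).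
Variables (mu : probability 'rV[R]_p R) (muC : mu C = 1%E).
Variables (z : 'rV[R]_p -> 'rV[R]_m) (Sigma L : 'rV[R]_p -> 'M[R]_m).
Hypotheses (mz : measurable_fun C z) (mL : measurable_fun C L).
Hypothesis L_cholesky : forall c, C c -> cholesky_factor (Sigma c) (L c).
Variable g : 'rV[R]_n * 'rV[R]_m -> R.
Hypothesis g_C1 : continuously_differentiable g.

Let g_diff q : differentiable g q. Proof. by case: g_C1. Qed.

Lemma closed_measurable_rV k (A : set 'rV[R]_k) : closed A -> measurable A.
Proof.
by move=> cA; rewrite -(setCK A); apply: measurableC; apply: open_measurable_mx; exact: closed_openC.
Qed.

(* [z] and [L] are measurable on [C] only, hence the restrictions. *)
Definition ray_of (t : T) : 'rV[R]_m * 'rV[R]_m := (t.1 *m ((L \_ C) t.2)^T, (z \_ C) t.2).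

Let mzC : measurable_fun setT (z \_ C).
Proof. by apply/(measurable_restrict z mC measurableT); rewrite setTI. Qed.

Let mLC : measurable_fun setT (L \_ C).
Proof. by apply/(measurable_restrict L mC measurableT); rewrite setTI. Qed.

Lemma measurable_ray_of1 : measurable_fun setT (fun t => (ray_of t).1).
Proof.
apply: measurable_fun_mx => i j /=; under eq_fun do rewrite mxE.
apply: measurable_sum => k; apply: measurable_funM.
  exact: (measurableT_comp (@measurable_mx_coord R 1 m i k) measurable_fst).
under eq_fun do rewrite mxE.
apply: (measurableT_comp (@measurable_mx_coord R m m j k)).
exact: (measurableT_comp mLC measurable_snd).
Qed.

Lemma measurable_ray_of2 : measurable_fun setT (fun t => (ray_of t).2).
Proof. exact: (measurableT_comp mzC measurable_snd). Qed.

Definition radial x t := radial_value g x (ray_of t).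

Let sec x := [set tr : T * measurableTypeR R | ray_value g x (ray_of tr.1) (tr.2 : R) <= 0].

Lemma measurable_sublevel x : measurable [set y : 'rV[R]_m | g (x, y) <= 0].
Proof.
apply: closed_measurable_rV.
apply: (@preimage_closed _ _ (fun z : 'rV[R]_m => g (x, z)) [set r | r <= 0]).
  by move=> y _; exact: continuous_g2.
exact: closed_le.
Qed.

Let msec x : measurable (sec x).
Proof.
pose F (tr : T * measurableTypeR R) : 'rV[R]_m := (tr.2 : R) *: (ray_of tr.1).1 + (ray_of tr.1).2.
have mF : measurable_fun setT F.
  apply: measurable_fun_mx => i j; rewrite /F; under eq_fun do rewrite mxE [X in X + _]mxE.
  apply: measurable_funD.
    apply: measurable_funM; first exact: measurable_snd.
    apply: (measurableT_comp (@measurable_mx_coord R 1 m i j)).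
    exact: (measurableT_comp measurable_ray_of1 measurable_fst).
  apply: (measurableT_comp (@measurable_mx_coord R 1 m i j)).
  exact: (measurableT_comp measurable_ray_of2 measurable_fst).
rewrite (_ : sec x = setT `&` F @^-1` [set y | g (x, y) <= 0]); last by rewrite setTI.
exact: mF (measurable_sublevel x).
Qed.

Let radial_int x t := (\int[leb]_(r in [set r : R | (0 <= r)%R /\ sec x (t, r)]) (chi r)%:E)%E.

Let measurable_radial_int x : measurable_fun setT (radial_int x).
Proof. exact: (measurable_chi_section m0 (msec x)). Qed.

Let measurable_ray_set x t :
  measurable ([set r : R | (0 <= r)%R /\ sec x (t, r)] : set (measurableTypeR R)).
Proof.
rewrite (_ : mkset _ = `[0%R, +oo[%classic `&` xsection (sec x) t); last first.
  by apply/seteqP; split => r /=; rewrite in_itv/= andbT /xsection/= inE.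
by apply: measurableI; [exact: measurable_itv|exact: measurable_xsection].
Qed.

Let radial_int01 x t : (0 <= radial_int x t <= 1)%E.
Proof.
apply/andP; split.
  by apply: integral_ge0 => r [r0 _]; rewrite lee_fin; exact: (chi_density_ge0 m0).
rewrite -(integral_chi m0); apply: ge0_subset_integral => //.
- by apply: measurable_funTS; apply/measurable_EFinP; exact: measurable_chi_density.
- by move=> r /=; rewrite in_itv/= andbT lee_fin; exact: (chi_density_ge0 m0).
- by move=> r [r0 _] /=; rewrite in_itv/= r0.
Qed.

Let radialE x t : (radial x t)%:E = radial_int x t.
Proof.
rewrite /radial /radial_value /Rintegral fineK//.
have /andP[h0 h1] := radial_int01 x t.
rewrite fin_numE -ltNye -ltey; apply/andP; split.
  by apply: lt_le_trans h0; rewrite ltNyr.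
by apply: le_lt_trans h1 _; rewrite ltry.
Qed.

Lemma radial_ge0 x t : 0 <= radial x t.
Proof. by rewrite -lee_fin radialE; have /andP[] := radial_int01 x t. Qed.

Lemma radial_norm_le1 x t : `|radial x t| <= 1.
Proof.
by rewrite ger0_norm ?radial_ge0// -lee_fin radialE; have /andP[] := radial_int01 x t.
Qed.

Lemma bounded_mfun_radial x : bounded_mfun (radial x).
Proof.
split; last by exists 1; exact: radial_norm_le1.
by apply/measurable_EFinP; rewrite (_ : _ \o _ = radial_int x)//; apply/funext => t; exact: radialE.
Qed.

Lemma radial_prob_funE x v c : C c -> radial_prob_fun z L g c x v = radial x (v, c).
Proof. by move=> Cc; rewrite /radial /ray_of /= !patchE mem_set. Qed.

Let zeta := uniform_sphere R m.

Let cond_prob_funE c x : C c -> cond_prob_fun z Sigma g c x = \int[zeta]_v radial x (v, c).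
Proof.
move=> Cc; rewrite /cond_prob_fun /Rintegral; congr fine.
rewrite (gauss_density_polar m0 (z c) (L_cholesky Cc) (measurable_sublevel x)).
apply: eq_integral => v _; rewrite radialE /radial_int.
by rewrite /sec /ray_value /ray_of /= !patchE mem_set.
Qed.

(** For [c] in [C] the Gaussian probability is the mean over the sphere of the chi masses on the
    rays; Tonelli's theorem then gathers direction and parameter into the product law. *)
Lemma prob_fun_radial x :
  (prob_fun C mu z Sigma g x)%:E = (\int[zeta \x mu]_t (radial x t)%:E)%E.
Proof.
have mr : measurable_fun setT (fun t => (radial x t)%:E).
  by apply/measurable_EFinP; exact: (bounded_mfun_radial x).1.
have r0 t : (0 <= (radial x t)%:E)%E by rewrite lee_fin radial_ge0.
have zeta1 : (\int[zeta]_v 1 = 1)%E.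
  by rewrite integral_cst// mul1e; exact: probability_setT.
have fr c : (\int[zeta]_v (radial x (v, c))%:E \is a fin_num)%E.
  rewrite ge0_fin_numE; last by apply: integral_ge0 => v _.
  apply: (@le_lt_trans _ _ (\int[zeta]_v 1)%E).
    apply: ge0_le_integral => //.
    - exact: (measurableT_comp mr (measurable_pair2 c)).
    - by move=> v _; rewrite lee_fin (le_trans (ler_norm _))// radial_norm_le1.
  by rewrite zeta1 ltry.
rewrite (fubini_tonelli2 _ mr r0) /fubini_G.
rewrite /prob_fun /Rintegral.
rewrite (_ : integral mu C _ = \int[mu]_(c in C) \int[zeta]_v (radial x (v, c))%:E)%E; last first.
  by apply: eq_integral => c /set_mem Cc; rewrite (cond_prob_funE _ Cc) /Rintegral fineK.
have mG : measurable_fun setT (fun c => \int[zeta]_v (radial x (v, c))%:E)%E.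
  exact: (measurable_fun_fubini_tonelli_G _ mr r0).
have G0 c : (0 <= \int[zeta]_v (radial x (v, c))%:E)%E by apply: integral_ge0 => v _.
(* Outside [C] the restricted [z] and [L] vanish and the radial value has no probabilistic meaning,
   but that set is null, so the integrals over [C] and over the whole space agree. *)
have muNC : mu (~` C) = 0%E by rewrite probability_setC// [X in (_ - X)%E]muC subee.
rewrite [in RHS](ge0_negligible_integral (measurableC mC) measurableT mG (fun c _ => G0 c) muNC).
rewrite setDE setCK setTI fineK// ge0_fin_numE; last by apply: integral_ge0.
apply: (@le_lt_trans _ _ (\int[mu]_(c in C) 1)%E).
  apply: ge0_le_integral => //.
  - exact: measurable_funTS.
  - move=> c _; rewrite -[leRHS]zeta1.
    apply: ge0_le_integral => //.
    + exact: (measurableT_comp mr (measurable_pair2 c)).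
    + by move=> v _; rewrite lee_fin (le_trans (ler_norm _))// radial_norm_le1.
rewrite (_ : (\int[mu]_(c in C) 1)%E = mu C) ?muC ?ltry//.
by rewrite integral_cst// mul1e.
Qed.

Lemma prob_fun_mean d (Omega : measurableType d) (P : probability Omega R)
    (X : nat -> Omega -> T) (iidX : iid P X (zeta \x mu)%E) x :
  prob_fun C mu z Sigma g x = \int[P]_w radial x (X 0%N w).
Proof.
rewrite /Rintegral -[LHS]/(fine (prob_fun C mu z Sigma g x)%:E) prob_fun_radial; congr fine.
have [mX lawX _] := iidX.
have mr : measurable_fun setT (fun t => (radial x t)%:E).
  by apply/measurable_EFinP; exact: (bounded_mfun_radial x).1.
pose X0 : {mfun Omega >-> T} := HB.pack (X 0%N) (isMeasurableFun.Build _ _ _ _ (X 0%N) (mX 0%N)).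
transitivity (\int[distribution P X0]_t (radial x t)%:E)%E.
  by apply: eq_measure_integral => A mA _; exact: esym (lawX 0%N A mA).
rewrite (ge0_integral_distribution X0 mr)//.
by move=> t; rewrite lee_fin radial_ge0.
Qed.

End radial_representation.

(** * The sampled rays satisfy the uniform local expansions *)

Theorem theorem2 (R : realType) (n m p : nat) (m_gt0 : (0 < m)%N)
  (C : set 'rV[R]_p) (mC : measurable C)
  (mu : probability 'rV[R]_p R) (muC : mu C = 1%E)
  (z : 'rV[R]_p -> 'rV[R]_m) (Sigma L : 'rV[R]_p -> 'M[R]_m)
  (mz : measurable_fun C z) (mL : measurable_fun C L)
  (Sigma_posdef : forall c, C c -> posdefmx (Sigma c))
  (L_cholesky : forall c, C c -> cholesky_factor (Sigma c) (L c))
  (zL_bounded : exists2 eta0 : R, 0 < eta0 &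
     forall c, C c -> norm2 (z c) + opnorm (L c) <= eta0)
  (g : 'rV[R]_n * 'rV[R]_m -> R)
  (g_C1 : continuously_differentiable g)
  (g_convex : forall x,
     convex_function [set: convex_lmodType 'rV[R]_m] (fun y => g (x, y)))
  (d : measure_display) (Omega : measurableType d) (P : probability Omega R)
  (v : nat -> Omega -> 'rV[R]_m) (c : nat -> Omega -> 'rV[R]_p)
  (v_sphere : forall i w, unit_sphere (v i w))
  (c_C : forall i w, C (c i w))
  (vc_iid : iid P (fun i w => (v i w, c i w)) (uniform_sphere R m \x mu)%E)
  (X : set 'rV[R]_n) (X_compact : compact X)
  (X_slater : forall x, X x -> uniform_slater_point C mu z g x)
  (X_growth : forall x, X x -> exp_growth_at g x) :
  let Phi := prob_fun C mu z Sigma g in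
  let e := radial_prob_fun z L g in
  (forall x, X x -> differentiable Phi x) /\
  {ae P, forall w,
    {uniform X, (fun N x => N%:R^-1 * \sum_(i < N) e (c i w) x (v i w))
       @ \oo --> Phi} /\
    {uniform X, (fun N x => N%:R^-1 *:
         \sum_(i < N) gradient (fun x' => e (c i w) x' (v i w)) x)
       @ \oo --> gradient Phi}}.
Proof.
pose f := radial C z L g.
move=> Phi e.
have bf x : bounded_mfun (f x) by exact: bounded_mfun_radial.
have f1 x t : `|f x t| <= 1 by exact: radial_norm_le1.
pose Z i w := (v i w, c i w).
have mZ i : measurable_fun setT (Z i) by case: vc_iid => + _ _; exact.
have PhiE : Phi = (fun x => \int[P]_w f x (Z 0%N w)).
  by apply/funext => x; exact: (prob_fun_mean m_gt0 mC muC mz mL L_cholesky g_C1 vc_iid).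
have eE i w : (fun x => e (c i w) x (v i w)) = f^~ (Z i w).
  by apply/funext => x; exact: radial_prob_funE.
rewrite PhiE.
have HK x : X x -> exists W D G, [/\ open_nbhs x W, measurable G,
    {ae P, forall w, forall i, G (Z i w)} &
    forall x1 eps, W x1 -> 0 < eps -> \forall x' \near x1, forall t, G t ->
      `|f x' t - f x1 t - dotr (D x1 t) (x' - x1)| <= eps * `|x' - x1| /\
      forall i, `|D x' t 0 i - D x1 t 0 i| <= eps].
  move=> Xx; have [U [gamma [[_ Ux] gamma0 slater]]] := X_slater x Xx.
  have [eps [a [b [eps0 a0 b0 growth]]]] := exp_growth_dg g_C1 (X_growth x Xx) m_gt0.
  have [eta eta0 zL] := zL_bounded.
  have [W W_x HW] := local_estimate_nbhs m_gt0 g_C1 g_convex gamma0 eta0 eps0 a0 b0 growth.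
  pose rho := ray_of C z L.
  have mrho1 : measurable_fun setT (fun t => (rho t).1) by exact: measurable_ray_of1.
  have mrho2 : measurable_fun setT (fun t => (rho t).2) by exact: measurable_ray_of2.
  (* The good set consists of the pairs whose ray lies in the compact set of parameters, where the
     expansions on [W] are uniform. *)
  exists W, (fun x t => radial_grad g x (rho t)), (rho @^-1` ray_params g x gamma eta).
  split => //.
  - rewrite (_ : _ @^-1` _ = (setT `&` (fun t => (rho t).1) @^-1` [set u | `|u| <= eta]) `&`
      (setT `&` (fun t => (rho t).2) @^-1` [set y | `|y| <= eta /\ g (x, y) <= - gamma])).
      apply: measurableI.
        by apply: mrho1 => //; apply: closed_measurable_rV; exact: closed_norm_le.
      by apply: mrho2 => //; apply: closed_measurable_rV; exact: closed_slater.
    by rewrite !setTI.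
  - apply: ae_foralln => i.
    (* The null set is the one of the centre [x], the point at which [ray_params] takes its
       inequality. *)
    have [N [mN muN sN]] := slater x Ux.
    exists ((c i) @^-1` N); split.
    + have mci : measurable_fun setT (c i) by exact: (measurableT_comp measurable_snd (mZ i)).
      by rewrite -[X in measurable X]setTI; exact: mci.
    + have [_ lawZ _] := vc_iid.
      (* Only the law of the pair is given, so [N] is read as a cylinder; its mass is a product with
         the factor [mu N = 0]. *)
      rewrite (_ : _ @^-1` _ = Z i @^-1` (setT `*` N)); last by apply/seteqP; split => w //= [].
      apply: etrans (lawZ i (setT `*` N) (measurableX measurableT mN)) _.
      by rewrite product_measure1E// [X in (_ * X)%E]muN mule0.
    + move=> w /= nG; apply: sN => /= cN; apply: nG.
      have Cc := c_C i w.
      rewrite /rho /ray_of /ray_params /= !patchE mem_set//=.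
      have := zL _ Cc; have := opnorm_ge0 (L (c i w)); have := norm2_ge0 (z (c i w)) => z0 l0 zl.
      split => /=.
        apply: le_trans (norm_le_norm2 _) _.
        apply: le_trans (norm2_mul_le_opnorm _ _) _; last by lra.
        by rewrite v_sphere.
      by split; [apply: le_trans (norm_le_norm2 _) _; lra|exact/ltW/cN].
  - move=> x1 ep Wx1 ep0; apply: filterS (HW x1 ep Wx1 ep0) => x' H t Gt.
    exact: H _ Gt.
have [H1 H2] := parametric_ulln vc_iid bf f1 X_compact HK.
have e1 w : (fun N x => N%:R^-1 * \sum_(i < N) e (c i w) x (v i w)) =
    (fun N x => N%:R^-1 * \sum_(i < N) f x (Z i w)).
  apply/funext => N; apply/funext => x; congr (_ * _); apply: eq_bigr => i _.
  exact: (congr1 (@^~ x) (eE i w)).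
have e2 w : (fun N x => N%:R^-1 *: \sum_(i < N) gradient (fun x' => e (c i w) x' (v i w)) x) =
    (fun N x => N%:R^-1 *: \sum_(i < N) gradient (f^~ (Z i w)) x).
  by apply/funext => N; apply/funext => x; congr (_ *: _); apply: eq_bigr => i _; exact: (congr1 (fun h => gradient h x) (eE i w)).
split; first exact: H1.
apply: filterS H2 => w [U1 U2]; split.
  exact: (eq_ind_r (fun F : nat -> 'rV[R]_n -> R => {uniform X, F @ \oo --> _}) U1 (e1 w)).
exact: (eq_ind_r (fun F : nat -> 'rV[R]_n -> 'rV[R]_n => {uniform X, F @ \oo --> _}) U2 (e2 w)).
Qed.
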